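(* Let $\{Y_n,n\ge1\}$ be a stationary sequence of standard Gaussian random variables (jointly Gaussian, mean $0$, variance $1$) with covariance function $r_n=\mathrm{Cov}(Y_1,Y_{n+1})$ satisfying $r_n\log n\to0$ as $n\to\infty$. Let $\boldsymbol{\varepsilon}=\{\varepsilon_n,n\ge1\}$ be a sequence of Bernoulli ($\{0,1\}$-valued) random variables, independent of $\{Y_n,n\ge1\}$, such that $\frac1n\sum_{k=1}^n\varepsilon_k\to\lambda$ in probability as $n\to\infty$ for some random variable $\lambda$ with $\lambda\in[0,1]$ a.s. Let $\{\widehat{Y}_n,n\ge1\}$ be a copy (in law) of $\{Y_n\}$ independent of $(\{Y_n\},\boldsymbol{\varepsilon})$, and put $Y_n(\boldsymbol{\varepsilon})=\varepsilon_nY_n+(1-\varepsilon_n)\widehat{Y}_n$, $M_n(Y)=\max_{1\le k\le n}Y_k$, $M_n(Y(\boldsymbol{\varepsilon}))=\max_{1\le k\le n}Y_k(\boldsymbol{\varepsilon})$. Then for any $x,y\in\mathbb{R}$, $$\lim_{n\to\infty}P\left[M_n(Y(\boldsymbol{\varepsilon}))\le a_n^{-1}x+b_n,\ M_n(Y)\le a_n^{-1}y+b_n\right]=\exp\left(-e^{-\min\{x,y\}}\right)E\exp\left(-(1-\lambda)e^{-\max\{x,y\}}\right),$$ where $a_n=(2\log n)^{1/2}$ and $b_n=a_n-\dfrac{\log\log n+\log(4\pi)}{2a_n}$.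
   Context: The variables $\varepsilon_n$ need be neither independent nor identically distributed. The constants $a_n,b_n$ are considered for $n\ge2$. *)

(* Defs.v *)
From HB Require Import structures.
From mathcomp Require Import all_boot all_order all_algebra.
From mathcomp Require Import all_classical all_reals all_analysis.
Set Implicit Arguments.
Unset Strict Implicit.
Unset Printing Implicit Defensive.
Import Order.TTheory GRing.Theory Num.Theory.
Import numFieldNormedType.Exports.
Local Open Scope classical_set_scope.
Local Open Scope ring_scope.

(** Sequences are indexed from 0: the term of index [k] of a Rocq sequence is
    the term of index [k + 1] of the mathematical one. *)

(** The sigma-algebra sigma(X_0, X_1, ...) on the domain of the [X n]. *)
Definition sigma_gen d' (T : Type) (T' : measurableType d')
    (X : nat -> T -> T') : set (set T) :=
  <<s \bigcup_n preimage_set_system setT (X n) measurable >>.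

(** The product sigma-algebra on R^nat, generated by the coordinate maps. *)
Definition path_sigma (R : realType) : set (set (nat -> R)) :=
  sigma_gen (fun n (u : nat -> R) => u n).

Definition same_law d (T : measurableType d) (R : realType)
    (P : probability T R) (X Z : nat -> T -> R) : Prop :=
  forall A : set (nat -> R), path_sigma A ->
    P [set w | A (fun n => X n w)] = P [set w | A (fun n => Z n w)].

Definition stationary d (T : measurableType d) (R : realType)
    (P : probability T R) (X : nat -> T -> R) : Prop :=
  forall k : nat, same_law P (fun n => X (k + n)%N) X.

Definition indep_sigma d (T : measurableType d) (R : realType)
    (P : probability T R) (F G : set (set T)) : Prop :=
  forall A B : set T, F A -> G B -> P (A `&` B) = (P A * P B)%E.

(** [normal_prob m 0] is the uniform law on [0, 1]; the degenerate Gaussian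
    law must be the Dirac mass at [m]. *)
Definition gaussian_law (R : realType) (m s : R) (A : set R) : \bar R :=
  if s == 0 then \d_m A else normal_prob m s A.

Definition gaussian d (T : measurableType d) (R : realType)
    (P : probability T R) (X : T -> R) : Prop :=
  exists m s : R, forall A : set R, measurable A ->
    P (X @^-1` A) = gaussian_law m s A.

Definition jointly_gaussian d (T : measurableType d) (R : realType)
    (P : probability T R) (X : nat -> T -> R) : Prop :=
  forall (n : nat) (c : 'I_n -> R),
    gaussian P (fun w => \sum_(i < n) c i * X i w).

Definition standard_gaussian d (T : measurableType d) (R : realType)
    (P : probability T R) (X : T -> R) : Prop :=
  forall A : set R, measurable A -> P (X @^-1` A) = normal_prob 0 1 A.

Definition cvg_in_probability d (T : measurableType d) (R : realType)
    (P : probability T R) (X : nat -> T -> R) (Z : T -> R) : Prop :=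
  forall e : R, 0 < e ->
    P [set w | e <= `|X n w - Z w|] @[n --> \oo] --> 0%E.

Definition mixed_seq (T : Type) (R : realType) (eps : nat -> T -> bool)
    (Y Yhat : nat -> T -> R) (k : nat) (w : T) : R :=
  (eps k w)%:R * Y k w + (1 - (eps k w)%:R) * Yhat k w.

(** [run_max X n w] is the maximum of the first [n] terms of [X]; for [n = 0],
    where there is no term, it is [X 0 w]. *)
Definition run_max (T : Type) (R : realType) (X : nat -> T -> R)
    (n : nat) (w : T) : R :=
  \big[Num.max/X 0%N w]_(k < n) X k w.

(** [norm_a n] and [norm_b n] are meaningful only for [n >= 2]. *)
Definition norm_a (R : realType) (n : nat) : R := Num.sqrt (2 * ln n%:R).

Definition norm_b (R : realType) (n : nat) : R :=
  norm_a R n - (ln (ln n%:R) + ln (4 * pi)) / (2 * norm_a R n).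

(* Main.v *)
(** Conditionally on the thinning sequence, the event asks [Y_k <= min u v] at
    the indices with [eps_k = 1], and [Y_k <= v], [Yhat_k <= u] at the others,
    where [u] and [v] are the two thresholds.  Both Gaussian sequences behave as
    if they were independent: replacing one coordinate at a time by an
    independent copy shows that the probability of a box differs from the
    product of its marginals by at most the sum of the covariances of the pairs
    of indicators.  That sum tends to 0 under [r_n log n -> 0]: lags up to a
    small power of [n] are bounded by Chernoff's inequality for [Y_j + Y_k], and
    for larger lags the regression of [Y_j] on [Y_k] moves the threshold by
    less than [eta / a_n].  Since [Phi u * Phi v = Phi (min u v) * Phi (max u v)],
    the probability of the event is asymptotically
    [Phi (min u v)^n * E (Phi (max u v)^(n - sum eps_k))], and
    [n (1 - Phi (a_n^-1 x + b_n)) -> e^(-x)] by Mills' ratio.  Joint laws are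
    identified through their trigonometric moments: composing
    [(1 + cos (b X + u)) / 2] with the polynomials [cutoff n] and letting
    [b -> 0] recovers the half-line indicators. *)
Require Import Defs.
From HB Require Import structures.
From mathcomp Require Import all_boot all_order all_algebra.
From mathcomp Require Import all_classical all_reals all_analysis.
From mathcomp Require Import measurable_realfun.
From mathcomp Require Import ring lra.
Import Order.TTheory GRing.Theory Num.Theory.
Import numFieldNormedType.Exports.
Local Open Scope classical_set_scope.
Local Open Scope ring_scope.
Set Implicit Arguments.
Unset Strict Implicit.
Unset Printing Implicit Defensive.

Local Notation ind b := ((b)%R%:R) (only parsing).

(** * Expectations of bounded functions *)

(** Gaussian vectors are met only through [E (cos (sum_j c_j X_j + t))], that is through
    one-dimensional laws; no density in several variables and no inverse covariance matrix appears.
    Replacing a coordinate costs exactly a sum of covariances because the conditional probability of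
    [Y_j <= s] given [Y_k = y] is monotone in [y]: absolute values then enter the expectation
    without loss.

    The exponents are dictated by counting pairs. About [n^(1 + al)] pairs have lag at most [n^al],
    and Chernoff must give less than [n^-(1 + al)] for each; this is possible because the
    correlations at positive lags stay below some [D < 1]. Each of the other pairs, fewer than
    [n^2], must give a small multiple of [n^-2]: one factor [1/n] is the tail of [Y_k], the other is
    the mass of [Y_j] in a window of width of order [eta / a_n] at its threshold. The window can be
    that narrow because the drift is of order [|r| a_n], hence [|r| a_n^2 = 2 |r| log n] in units of
    [1 / a_n].

    All bounds are uniform in the tested coordinates and their levels, so conditioning on [eps]
    reduces to a finite sum over its patterns. *)

Definition mean d (T : measurableType d) (R : realType)
  (P : probability T R) (f : T -> R) : R := \int[P]_w f w.

Definition bounded_measurable d (T : measurableType d) (R : realType)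
  (f : T -> R) := measurable_fun setT f /\ exists M, forall w, `|f w| <= M.

Section mean_theory.
Context d (T : measurableType d) (R : realType) (P : probability T R).
Implicit Types (f g : T -> R).
Local Notation itg f := (P.-integrable setT (EFin \o f)).
Local Notation bmf := (@bounded_measurable d T R).

Lemma bmf_integrable f : bmf f -> itg f.
Proof.
move=> [mf [M fM]]; apply: measurable_bounded_integrable => //.
  by rewrite ltey_eq fin_num_measure.
exists M; split; first exact: num_real.
by move=> x Mx w _ /=; apply: le_trans (fM w) _; exact: ltW.
Qed.

Lemma bmf_cst (c : R) : bmf (fun=> c).
Proof. by split => //; exists `|c|. Qed.

Lemma bmfD f g : bmf f -> bmf g -> bmf (fun w => f w + g w).
Proof.
move=> [mf [M fM]] [mg [N gN]]; split; first exact: measurable_funD.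
by exists (M + N) => w; rewrite (le_trans (ler_normD _ _))// lerD.
Qed.

Lemma bmfN f : bmf f -> bmf (fun w => - f w).
Proof.
move=> [mf [M fM]]; split; first exact: measurableT_comp.
by exists M => w; rewrite normrN.
Qed.

Lemma bmfB f g : bmf f -> bmf g -> bmf (fun w => f w - g w).
Proof. by move=> bf bg; apply: bmfD => //; exact: bmfN. Qed.

Lemma bmfM f g : bmf f -> bmf g -> bmf (fun w => f w * g w).
Proof.
move=> [mf [M fM]] [mg [N gN]]; split; first exact: measurable_funM.
by exists (M * N) => w; rewrite normrM ler_pM.
Qed.

Lemma bmfX f n : bmf f -> bmf (fun w => f w ^+ n).
Proof.
move=> bf; elim: n => [|n IH].
  by under [X in bmf X]eq_fun do rewrite expr0; exact: bmf_cst.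
by under [X in bmf X]eq_fun do rewrite exprS; exact: bmfM.
Qed.

Lemma bmf_sum (I : Type) (s : seq I) (Q : pred I) (F : I -> T -> R) :
  (forall i, bmf (F i)) -> bmf (fun w => \sum_(i <- s | Q i) F i w).
Proof.
move=> bF; elim: s => [|i s IH].
  by under [X in bmf X]eq_fun do rewrite big_nil; exact: bmf_cst.
under [X in bmf X]eq_fun do rewrite big_cons.
by case: (Q i) => //; exact: bmfD.
Qed.

Lemma bmf_prod (I : Type) (s : seq I) (Q : pred I) (F : I -> T -> R) :
  (forall i, bmf (F i)) -> bmf (fun w => \prod_(i <- s | Q i) F i w).
Proof.
move=> bF; elim: s => [|i s IH].
  by under [X in bmf X]eq_fun do rewrite big_nil; exact: bmf_cst.
under [X in bmf X]eq_fun do rewrite big_cons.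
by case: (Q i) => //; exact: bmfM.
Qed.

Lemma bmf_cos f : measurable_fun setT f -> bmf (fun w => cos (f w)).
Proof.
move=> mf; split; last first.
  by exists 1 => w; rewrite ler_norml cos_geN1 cos_le1.
apply: measurableT_comp => //; apply: continuous_measurable_fun.
exact: continuous_cos.
Qed.

Lemma bmf_sin f : measurable_fun setT f -> bmf (fun w => sin (f w)).
Proof.
move=> mf; split; last first.
  by exists 1 => w; rewrite ler_norml sin_geN1 sin_le1.
apply: measurableT_comp => //; apply: continuous_measurable_fun.
exact: continuous_sin.
Qed.

Lemma measurable_boolR (b : T -> bool) : measurable_fun setT b ->
  measurable_fun setT (fun w => (b w)%:R : R).
Proof.
move=> mb; rewrite (_ : (fun w => _) = \1_(b @^-1` [set true])).
  by apply: measurable_indic; rewrite -[X in measurable X]setTI; exact: mb.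
apply/funext => w; rewrite indicE; congr (nat_of_bool _)%:R.
by apply/idP/idP; rewrite inE /=.
Qed.

Lemma bmf_bool (b : T -> bool) : measurable_fun setT b ->
  bmf (fun w => (b w)%:R).
Proof.
move=> mb; split; first exact: measurable_boolR.
by exists 1 => w; case: (b w); rewrite ?normr1 ?normr0.
Qed.

Lemma bmf_le f (s : R) : measurable_fun setT f ->
  bmf (fun w => ind (f w <= s)).
Proof.
by move=> mf; apply: bmf_bool; exact: measurable_fun_ler.
Qed.

Lemma bmf_gt f (s : R) : measurable_fun setT f ->
  bmf (fun w => ind (s < f w)).
Proof.
by move=> mf; apply: bmf_bool; exact: measurable_fun_ltr.
Qed.

Lemma meanE f : itg f -> (mean P f)%:E = (\int[P]_w (f w)%:E)%E.
Proof. by move=> itf; rewrite fineK//; exact: integrable_fin_num. Qed.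

Lemma eq_mean f g : f =1 g -> mean P f = mean P g.
Proof. by move=> fg; congr mean; exact/funext. Qed.

Lemma mean_cst (c : R) : mean P (fun=> c) = c.
Proof. by rewrite /mean Rintegral_cst//= [X in fine X](@probability_setT _ _ _ P) mulr1. Qed.

Lemma meanD f g : itg f -> itg g ->
  mean P (fun w => f w + g w) = mean P f + mean P g.
Proof. by move=> itf itg'; rewrite /mean RintegralD. Qed.

Lemma meanB f g : itg f -> itg g ->
  mean P (fun w => f w - g w) = mean P f - mean P g.
Proof. by move=> itf itg'; rewrite /mean RintegralB. Qed.

Lemma meanZl (c : R) f : itg f -> mean P (fun w => c * f w) = c * mean P f.
Proof. by move=> itf; rewrite /mean RintegralZl. Qed.

Lemma itgZl (c : R) f : itg f -> itg (fun w => c * f w).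
Proof. by move=> itf; apply: (integrableZl measurableT c itf). Qed.

Lemma itgD f g : itg f -> itg g -> itg (fun w => f w + g w).
Proof. by move=> itf itg'; apply: (integrableD measurableT itf itg'). Qed.

Lemma itg_sum (I : Type) (s : seq I) (Q : pred I) (F : I -> T -> R) :
  (forall i, itg (F i)) -> itg (fun w => \sum_(i <- s | Q i) F i w).
Proof.
move=> bF; elim: s => [|i s IH].
  under [X in itg X]eq_fun do rewrite big_nil.
  by apply: bmf_integrable; exact: bmf_cst.
under [X in itg X]eq_fun do rewrite big_cons.
by case: (Q i) => //; exact: itgD.
Qed.

Lemma mean_sum (I : Type) (s : seq I) (Q : pred I) (F : I -> T -> R) :
  (forall i, itg (F i)) ->
  mean P (fun w => \sum_(i <- s | Q i) F i w) = \sum_(i <- s | Q i) mean P (F i).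
Proof.
move=> bF; elim: s => [|i s IH].
  by under [X in mean P X]eq_fun do rewrite big_nil; rewrite mean_cst big_nil.
under [X in mean P X]eq_fun do rewrite big_cons.
rewrite big_cons; case: (Q i) => //; rewrite meanD ?IH//.
exact: itg_sum.
Qed.

Lemma le_mean f g : itg f -> itg g -> (forall w, f w <= g w) ->
  mean P f <= mean P g.
Proof. by move=> itf itg' fg; apply: le_Rintegral. Qed.

Lemma mean_ge0 f : (forall w, 0 <= f w) -> 0 <= mean P f.
Proof. by move=> f0; apply: Rintegral_ge0. Qed.

Lemma itg_le f g : measurable_fun setT f -> itg g ->
  (forall w, `|f w| <= g w) -> itg f.
Proof.
move=> mf ig fg; apply: le_integrable ig => //; first exact/measurable_EFinP.
by move=> w _ /=; rewrite lee_fin (le_trans (fg w))// ler_norm.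
Qed.

Lemma ge0_itgP f : measurable_fun setT f -> (forall w, 0 <= f w) ->
  itg f <-> (\int[P]_w (f w)%:E < +oo)%E.
Proof.
move=> mf f0.
have E : (\int[P]_w `|(EFin \o f) w| = \int[P]_w (f w)%:E)%E.
  by apply: eq_integral => w _ /=; rewrite ger0_norm.
by rewrite -E; split=> [/integrableP[]//|foo]; apply/integrableP; split => //; exact/measurable_EFinP.
Qed.

Lemma itg_norm f : itg f -> itg (fun w => `|f w|).
Proof. by move/integrable_norm. Qed.

Lemma itg_measurable f : itg f -> measurable_fun setT f.
Proof. by move=> /measurable_int /measurable_EFinP. Qed.

Lemma norm_mean f : itg f -> `|mean P f| <= mean P (fun w => `|f w|).
Proof. by move=> itf; exact: le_normr_Rintegral. Qed.

Lemma pr_mean (b : T -> bool) : measurable_fun setT b ->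
  P [set w | b w] = (mean P (fun w => (b w)%:R))%:E.
Proof.
move=> mb; rewrite meanE; last by apply: bmf_integrable; exact: bmf_bool.
have mb' : measurable [set w | b w].
  by rewrite -[X in measurable X]setTI; exact: (mb measurableT [set true]).
rewrite -(setIT [set w | b w]) -integral_indic//.
apply: eq_integral => w _; rewrite indicE; congr (nat_of_bool _)%:R%:E.
by apply/idP/idP; rewrite inE/=.
Qed.

Lemma mean_cvg (f_ : nat -> T -> R) f g :
  (forall n, measurable_fun setT (f_ n)) -> itg g ->
  (forall n w, `|f_ n w| <= g w) ->
  (forall w, f_ n w @[n --> \oo] --> f w) ->
  mean P (f_ n) @[n --> \oo] --> mean P f.
Proof.
move=> mf ig fg ff.
have mlim : measurable_fun setT f.
  by apply: (measurable_fun_cvg mf) => w _; exact: ff.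
have [] := @dominated_convergence _ _ _ P setT measurableT
  (fun n w => (f_ n w)%:E) (EFin \o f) (EFin \o g).
- by move=> n; apply/measurable_EFinP; exact: mf.
- exact/measurable_EFinP.
- by apply: aeW => w _; apply: cvg_EFin; [exact: nearW|exact: ff].
- exact: ig.
- by apply: aeW => w n _ /=; rewrite lee_fin fg.
- move=> itf _.
  rewrite [X in _ --> X -> _](_ : _ = (mean P f)%:E); last by rewrite meanE.
  by case/fine_cvgP.
Qed.

Lemma mean_cvg_bounded (f_ : nat -> T -> R) f (M : R) :
  (forall n, measurable_fun setT (f_ n)) ->
  (forall n w, `|f_ n w| <= M) ->
  (forall w, f_ n w @[n --> \oo] --> f w) ->
  mean P (f_ n) @[n --> \oo] --> mean P f.
Proof.
move=> mf fM ff; apply: (mean_cvg mf _ fM ff).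
by apply: bmf_integrable; exact: bmf_cst.
Qed.

End mean_theory.

(** * One-dimensional Gaussian integrals *)

Import HBNNSimple.

(** Both sides are limits of integrals of simple functions increasing to [f], where the claim is the
    formula for [nu] on their level sets. *)
Lemma ge0_integral_density d (T : measurableType d) (R : realType)
    (mu nu : {measure set T -> \bar R}) (g : T -> R) (f : T -> \bar R) :
  measurable_fun setT g -> (forall x, 0 <= g x) ->
  (forall A, measurable A -> nu A = (\int[mu]_(x in A) (g x)%:E)%E) ->
  measurable_fun setT f -> (forall x, 0 <= f x)%E ->
  (\int[nu]_x f x = \int[mu]_x (f x * (g x)%:E))%E.
Proof.
move=> mg g0 nuE mf f0; pose f_ := nnsfun_approx measurableT mf.
have mfg n : measurable_fun setT (fun x => (f_ n x)%:E * (g x)%:E)%E.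
  by apply: emeasurable_funM; exact/measurable_EFinP.
have fg0 n x : (0 <= (f_ n x)%:E * (g x)%:E)%E by rewrite -EFinM lee_fin mulr_ge0.
transitivity (lim (\int[nu]_x (f_ n x)%:E @[n --> \oo])%E).
  rewrite -monotone_convergence//=.
  - apply: eq_integral => ? /[!inE] xD; apply/esym/cvg_lim => //=.
    exact: cvg_nnsfun_approx.
  - by move=> n; exact/measurable_EFinP/measurable_funTS.
  - by move=> n ? _; rewrite lee_fin.
  - by move=> ? _ ? ? mn; rewrite lee_fin; exact/lefP/nd_nnsfun_approx.
transitivity (lim (\int[mu]_x ((f_ n x)%:E * (g x)%:E) @[n --> \oo])%E); last first.
  rewrite -monotone_convergence//=.
  - apply: eq_integral => x _; apply/cvg_lim => //=.
    apply: cvgeZr => //; exact: cvg_nnsfun_approx.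
  - move=> x _ m n mn; rewrite lee_wpmul2r ?lee_fin//.
    exact/lefP/nd_nnsfun_approx.
apply: congr_lim; apply/funext => n /=.
under [LHS]eq_integral do rewrite fimfunE -fsumEFin//.
rewrite [LHS]ge0_integral_fsum//; last 2 first.
  - by move=> r; exact/measurable_EFinP/measurableT_comp.
  - by move=> r x _; rewrite EFinM nnfun_muleindic_ge0.
under [RHS]eq_integral.
  move=> x xD; rewrite fimfunE -fsumEFin// ge0_mule_fsuml; last first.
    by move=> r; rewrite EFinM nnfun_muleindic_ge0.
  over.
have mfi r : measurable_fun setT (fun x => (r * \1_(f_ n @^-1` [set r]) x)%:E).
  by apply/measurable_EFinP; apply/measurableT_comp.
rewrite [RHS]ge0_integral_fsum//; last 2 first.
  - by move=> r; apply: emeasurable_funM => //; exact/measurable_EFinP.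
  - move=> r x _; apply: mule_ge0; last by rewrite lee_fin.
    by rewrite EFinM nnfun_muleindic_ge0.
apply: eq_fsbigr => r _; rewrite integralZl_indic_nnsfun//= integral_indic// setIT.
rewrite nuE//; have [r0|r0] := leP 0 r; last first.
  have -> : f_ n @^-1` [set r] = set0.
    apply/seteqP; split => // x /= fr.
    by have : 0 <= f_ n x by []; rewrite fr leNgt r0.
  rewrite integral_set0 mule0; under eq_integral do rewrite indic0 mulr0 mul0e.
  by rewrite integral0.
rewrite -ge0_integralZl//; last 2 first.
  - exact/measurable_funTS/measurable_EFinP.
  - by move=> x _; rewrite lee_fin.
rewrite integral_mkcond; apply: eq_integral => x _; rewrite patchE indicE.
by case: (x \in _); rewrite ?mulr1 ?mulr0 ?mul0e.
Qed.

Section normal_integral.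
Context {R : realType}.
Local Notation mu := (@lebesgue_measure R).

Lemma ge0_integral_normal (m s : R) (f : R -> \bar R) :
  measurable_fun setT f -> (forall x, 0 <= f x)%E ->
  (\int[normal_prob m s]_x f x = \int[mu]_x (f x * (normal_pdf m s x)%:E))%E.
Proof.
move=> mf f0; apply: ge0_integral_density => //.
- exact: measurable_normal_pdf.
- by move=> x; exact: normal_pdf_ge0.
Qed.

Lemma normal_pdf_affine (m s z : R) : 0 < s ->
  normal_pdf m s (m + s * z) * s = normal_pdf 0 1 z.
Proof.
move=> s0; have sN0 : s != 0 by rewrite gt_eqF.
rewrite !normal_pdfE// /normal_peak /normal_fun mulrAC; congr (_ * _).
  rewrite expr1n mul1r -mulrnAr sqrtrM ?sqr_ge0// sqrtr_sqr gtr0_norm// invfM.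
  by rewrite mulrAC mulVf// mul1r.
congr expR; rewrite expr1n subr0.
by field.
Qed.

(** The scale in [gaussian] may be negative; the density depends on it through its square only, so
    one may pass to a positive scale before changing variables. *)
Lemma normal_pdf_abs (m s : R) : normal_pdf m `|s| = normal_pdf m s.
Proof.
apply/funext => x; rewrite /normal_pdf normr_eq0.
by rewrite /normal_peak /normal_fun real_normK ?num_real.
Qed.

Lemma normal_prob_abs (m s : R) : normal_prob m `|s| = normal_prob m s.
Proof. by apply/funext => A; rewrite /normal_prob normal_pdf_abs. Qed.

(** The increasing substitution [x = m + s z], done for continuous integrands. Powers, exponentials
    and cosines are enough; indicators are reached later, through [trig_transfer]. *)
Lemma ge0_integral_normal_affine (m s : R) (f : R -> R) : 0 < s ->
  continuous f -> (forall x, 0 <= f x) ->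
  (\int[normal_prob m s]_x (f x)%:E =
   \int[normal_prob 0 1]_z (f (m + s * z))%:E)%E.
Proof.
move=> s0 cf f0.
have cF : continuous (fun z : R => m + s * z).
  by move=> z; apply: cvgD; [exact: cvg_cst|apply: cvgM; [exact: cvg_cst|exact: cvg_id]].
have cfF : continuous (fun z => f (m + s * z)).
  by move=> z; apply: continuous_comp; [exact: cF|exact: cf].
have mc (h : R -> R) : continuous h -> measurable_fun setT (fun x => (h x)%:E).
  by move=> ch; apply/measurable_EFinP; exact: continuous_measurable_fun.
rewrite !ge0_integral_normal; [|exact: mc| |exact: mc|]; last 2 first.
- by move=> x; rewrite lee_fin.
- by move=> x; rewrite lee_fin.
have dF z : is_derive (z : R) 1 (fun z : R => m + s * z) s.
  by apply: is_derive_eq; rewrite add0r ?scaler0 ?addr0 scaler1 mul1r.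
have F'E : derive1 (fun z : R => m + s * z) = cst s.
  by apply/funext => z; rewrite derive1E; exact: derive_val.
under eq_integral do rewrite -EFinM.
rewrite (@increasing_ge0_integration_by_substitutionT _ (fun z => m + s * z)
  (fun x => f x * normal_pdf m s x)).
- apply: eq_integral => z _; rewrite -EFinM; congr EFin.
  by rewrite F'E -(normal_pdf_affine m z s0) mulrA.
- by move=> x y xy; rewrite ltrD2l ltr_pM2l.
- by rewrite F'E => ?; exact: cvg_cst.
- by rewrite F'E; exact: is_cvg_cst.
- by rewrite F'E; exact: is_cvg_cst.
- by move=> z; have [] := dF z.
- apply: (@cvg_comp _ _ _ (fun z => s * z) (fun z => m + z)); last exact: cvg_addrl_Ny.
  by apply/gt0_cvgMrNy.
- apply: (@cvg_comp _ _ _ (fun z => s * z) (fun z => m + z)); last exact: cvg_addrl.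
  by apply/gt0_cvgMry.
- move=> x; apply: cvgM; first exact: cf.
  by apply: continuous_normal_pdf; rewrite gt_eqF.
- by move=> x; rewrite mulr_ge0// normal_pdf_ge0.
Qed.

(** Completing the square: an exponential tilt recenters the density at [a]. *)
Lemma normal_pdf_shift (a x : R) :
  expR (a * x) * normal_pdf 0 1 x = expR (a ^+ 2 / 2) * normal_pdf a 1 x.
Proof.
rewrite !normal_pdfE ?oner_eq0// mulrCA [RHS]mulrCA; congr (_ * _).
rewrite /normal_fun -!expRD; congr expR; rewrite expr1n.
by field.
Qed.

End normal_integral.

(** Differentiation under the expectation by domination. A window of fixed radius 1 is enough for a
    single integrable [G] to dominate the exponentials used below. *)
Lemma is_derive_mean d (T : measurableType d) (R : realType)
    (P : probability T R) (f f' : R -> T -> R) (G : T -> R) (a : R) :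
  (forall (x : R) w, a - 1 < x < a + 1 -> is_derive x (1 : R) (f ^~ w) (f' x w)) ->
  (forall x : R, a - 1 < x < a + 1 -> P.-integrable setT (EFin \o f x)) ->
  P.-integrable setT (EFin \o G) ->
  (forall (x : R) w, a - 1 < x < a + 1 -> `|f' x w| <= G w) ->
  is_derive a (1 : R) (fun x => mean P (f x)) (mean P (f' a)).
Proof.
move=> df itf itG f'G.
have Ia : `](a - 1), (a + 1)[%classic a by rewrite /= in_itv/=; lra.
have aa : a - 1 < a < a + 1 by lra.
have G0 w : 0 <= G w by rewrite (le_trans (normr_ge0 _) (f'G _ w aa)).
have dfE x w : a - 1 < x < a + 1 -> partial1of2 f x w = f' x w.
  by move=> ax; rewrite partial1of2E; have ? := df x w ax; exact: derive_val.
have itf' x : `](a - 1), (a + 1)[%classic x -> P.-integrable setT (EFin \o f x).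
  by rewrite /= in_itv/=; exact: itf.
have der x w : `](a - 1), (a + 1)[%classic x -> [set: T] w -> derivable (f ^~ w) x 1.
  by rewrite /= in_itv/= => ax _; have [] := df x w ax.
have ub x w : `](a - 1), (a + 1)[%classic x -> [set: T] w ->
    `|partial1of2 f x w| <= G w.
  by rewrite /= in_itv/= => ax _; rewrite dfE// f'G.
have H1 := derivable_under_integral measurableT Ia itf' der G0 itG ub.
have H2 := differentiation_under_integral measurableT Ia itf' der G0 itG ub.
apply: DeriveDef; first exact: H1.
by rewrite -derive1E H2; apply: eq_mean => w; rewrite dfE.
Qed.

(** * Moments, characteristic function and tails of Gaussian variables *)

Section gaussian_rv.
Context d (T : measurableType d) (R : realType) (P : probability T R).
Local Notation itg f := (P.-integrable setT (EFin \o f)).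

Lemma ge0_integral_law d' (T' : measurableType d') (X : T -> T')
    (nu : {measure set T' -> \bar R}) (f : T' -> \bar R) : measurable_fun setT X ->
  (forall A, measurable A -> P (X @^-1` A) = nu A) ->
  measurable_fun setT f -> (forall x, 0 <= f x)%E ->
  (\int[P]_w f (X w) = \int[nu]_x f x)%E.
Proof.
move=> mX XE mf f0.
pose X' : {mfun T >-> T'} := HB.pack X (isMeasurableFun.Build _ _ _ _ _ mX).
rewrite -[LHS](@ge0_integral_distribution _ _ _ _ _ P X' f)//.
by apply: eq_measure_integral => A mA _; rewrite -XE.
Qed.

Section standard.
Variable Y : T -> R.
Hypotheses (mY : measurable_fun setT Y) (stdY : standard_gaussian P Y).

Lemma ge0_integral_standard (f : R -> R) : continuous f -> (forall x, 0 <= f x) ->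
  (\int[P]_w (f (Y w))%:E = \int[normal_prob 0 1]_x (f x)%:E)%E.
Proof.
move=> cf f0; apply: (@ge0_integral_law _ (measurableTypeR R) Y
  (normal_prob 0 1) (EFin \o f)) => //.
by apply/measurable_EFinP; exact: continuous_measurable_fun.
Qed.

(** Any Gaussian [X], degenerate or not, is tested as [m + s * Y] with the one fixed standard
    variable [Y], so that everything reduces to integrals of functions of [Y]. *)
Lemma gaussian_affine (X : T -> R) : measurable_fun setT X -> gaussian P X ->
  exists m s : R, forall f : R -> R, continuous f -> (forall x, 0 <= f x) ->
    (\int[P]_w (f (X w))%:E = \int[P]_w (f (m + s * Y w))%:E)%E.
Proof.
move=> mX [m [s XE]]; rewrite /gaussian_law in XE.
have mc (h : R -> R) : continuous h -> measurable_fun setT (EFin \o h).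
  by move=> ch; apply/measurable_EFinP; exact: continuous_measurable_fun.
have [s0|s0] := eqVneq s 0.
  exists m, 0 => f cf f0.
  transitivity (f m)%:E; last first.
    under eq_integral do rewrite mul0r addr0.
    rewrite integral_cst// [X in (_ * X)%E](@probability_setT _ _ _ P).
    by rewrite mule1.
  transitivity (\int[\d_m]_x ((EFin \o f) x))%E.
    apply: (@ge0_integral_law _ R X (\d_m) (EFin \o f)) => //; last exact: mc.
    by move=> A mA; rewrite XE// s0 eqxx.
  by rewrite integral_dirac//=; [rewrite diracT mul1e|exact: mc].
exists m, `|s| => f cf f0.
transitivity (\int[normal_prob m s]_x ((EFin \o f) x))%E.
  apply: (@ge0_integral_law _ (measurableTypeR R) X (normal_prob m s)) => //.
    by move=> A mA; rewrite XE// (negbTE s0).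
  exact: mc.
transitivity (\int[normal_prob 0 1]_y (f (m + `|s| * y))%:E)%E; last first.
  symmetry; apply: (@ge0_integral_standard (fun y => f (m + `|s| * y))) => // z.
  apply: continuous_comp; last exact: cf.
  by apply: cvgD; [exact: cvg_cst|apply: cvgM; [exact: cvg_cst|exact: cvg_id]].
transitivity (\int[normal_prob m `|s|]_y (f y)%:E)%E; last first.
  by apply: (@ge0_integral_normal_affine _ m `|s| f) => //; rewrite normr_gt0.
apply: eq_measure_integral => A mA _.
exact: (congr1 (fun h => h A) (esym (normal_prob_abs m s))).
Qed.

(** The Cameron-Martin formula in dimension one. The moments of [Y] and the Stein identity come from
    it, by differentiating at [a = 0] for a suitable [f]. *)
Lemma ge0_gaussian_shift (a : R) (f : R -> R) :
  continuous f -> (forall x, 0 <= f x) ->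
  (\int[P]_w (f (Y w) * expR (a * Y w))%:E =
   (expR (a ^+ 2 / 2))%:E * \int[P]_w (f (a + Y w))%:E)%E.
Proof.
move=> cf f0.
have cfa : continuous (fun y => f (a + y)).
  move=> z; apply: continuous_comp; last exact: cf.
  by apply: cvgD; [exact: cvg_cst|exact: cvg_id].
have cfe : continuous (fun y => f y * expR (a * y)).
  move=> z; apply: cvgM; first exact: cf.
  apply: (@continuous_comp _ _ _ (fun z => a * z) expR); last exact: continuous_expR.
  by apply: cvgM; [exact: cvg_cst|exact: cvg_id].
rewrite (@ge0_integral_standard (fun y => f y * expR (a * y)))//; last first.
  by move=> x; rewrite mulr_ge0// expR_ge0.
rewrite (@ge0_integral_standard (fun y => f (a + y)))//.
have mc (h : R -> R) : continuous h -> measurable_fun setT (EFin \o h).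
  by move=> ch; apply/measurable_EFinP; exact: continuous_measurable_fun.
have -> : (\int[normal_prob 0 1]_y (f (a + y))%:E = \int[normal_prob a 1]_y (f y)%:E)%E.
  rewrite (@ge0_integral_normal_affine _ a 1 f)//.
  by apply: eq_integral => y _; rewrite mul1r.
transitivity (\int[lebesgue_measure]_x
    ((f x * expR (a * x))%:E * (normal_pdf 0 1 x)%:E))%E.
  apply: (@ge0_integral_normal _ 0 1 (EFin \o (fun y => f y * expR (a * y)))).
    exact: mc.
  by move=> x; rewrite lee_fin mulr_ge0// expR_ge0.
transitivity ((expR (a ^+ 2 / 2))%:E * \int[lebesgue_measure]_x
    ((f x)%:E * (normal_pdf a 1 x)%:E))%E; last first.
  congr (_ * _)%E; symmetry.
  by apply: (@ge0_integral_normal _ a 1 (EFin \o f)) => //; exact: mc.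
rewrite -ge0_integralZl//; last 2 first.
- apply: emeasurable_funM; first exact: mc.
  by apply/measurable_EFinP; exact: measurable_normal_pdf.
- by move=> x _; rewrite -EFinM lee_fin mulr_ge0// normal_pdf_ge0.
apply: eq_integral => x _; rewrite -!EFinM; congr EFin.
by rewrite -mulrA normal_pdf_shift; ring.
Qed.

Let mcY (h : R -> R) : continuous h -> measurable_fun setT (fun w => h (Y w)).
Proof. by move=> ch; apply: measurableT_comp => //; exact: continuous_measurable_fun. Qed.

Let cexp a : continuous (fun y : R => expR (a * y)).
Proof.
move=> z; apply: (@continuous_comp _ _ _ (fun z => a * z) expR); last exact: continuous_expR.
by apply: cvgM; [exact: cvg_cst|exact: cvg_id].
Qed.

Lemma gaussian_exp_itg a : itg (fun w => expR (a * Y w)).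
Proof.
apply/ge0_itgP => [|w|]; [|exact: expR_ge0|].
  by apply: (@mcY (fun y => expR (a * y))); exact: cexp.
have -> : (\int[P]_w (expR (a * Y w))%:E = \int[P]_w (1 * expR (a * Y w))%:E)%E.
  by apply: eq_integral => w _ /=; rewrite mul1r.
rewrite (@ge0_gaussian_shift a (fun=> 1))//; last by move=> x; exact: cvg_cst.
by rewrite integral_cst// [X in (_ * (_ * X))%E](@probability_setT _ _ _ P) !mule1 ltry.
Qed.

Lemma gaussian_shift_ge0 a (f : R -> R) : continuous f -> (forall x, 0 <= f x) ->
  mean P (fun w => f (Y w) * expR (a * Y w)) =
  expR (a ^+ 2 / 2) * mean P (fun w => f (a + Y w)).
Proof.
move=> cf f0; rewrite /mean /Rintegral ge0_gaussian_shift//.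
have : (0 <= \int[P]_x (f (a + Y x))%:E)%E.
  by apply: integral_ge0 => w _; rewrite lee_fin.
case: (\int[P]_x (f (a + Y x))%:E)%E => [r| |]// _.
(* When the integral is infinite, both means are 0 by convention, so the identity holds without
   integrability. *)
by rewrite gt0_muley ?lte_fin ?expR_gt0//= mulr0.
Qed.

Lemma mean_posneg (f : T -> R) : itg f ->
  mean P f = mean P (fun w => Num.max (f w) 0) - mean P (fun w => Num.max (- f w) 0).
Proof.
move=> itf; have mf := itg_measurable itf.
have ip : itg (fun w => Num.max (f w) 0).
  apply: (@itg_le _ _ _ _ _ (fun w => `|f w|)); [|exact: itg_norm|].
    exact: measurable_maxr.
  by move=> w; rewrite ger0_norm ?le_max ?lexx ?orbT// ge_max ler_norm normr_ge0.
have im : itg (fun w => Num.max (- f w) 0).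
  apply: (@itg_le _ _ _ _ _ (fun w => `|f w|)); [|exact: itg_norm|].
    by apply: measurable_maxr => //; exact: measurableT_comp.
  by move=> w; rewrite ger0_norm ?le_max ?lexx ?orbT// ge_max -normrN ler_norm normr_ge0.
rewrite -meanB//; apply: eq_mean => w.
have [h|h] := leP 0 (f w); rewrite ?(max_idPl h) ?(max_idPr (ltW h)).
  by rewrite (max_idPr _) ?subr0// oppr_le0.
by rewrite (max_idPl _) ?sub0r ?opprK// oppr_ge0 ltW.
Qed.

(** The nonnegative case is applied to the positive and negative parts of [f], which commute with
    multiplication by a positive exponential. *)
Lemma gaussian_shift a (f : R -> R) : continuous f ->
  itg (fun w => f (Y w) * expR (a * Y w)) -> itg (fun w => f (a + Y w)) ->
  mean P (fun w => f (Y w) * expR (a * Y w)) =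
  expR (a ^+ 2 / 2) * mean P (fun w => f (a + Y w)).
Proof.
move=> cf i1 i2; rewrite mean_posneg// [in RHS]mean_posneg// mulrBr.
have E0 (x y : R) : Num.max (x * expR y) 0 = Num.max x 0 * expR y.
  by rewrite -{1}(mul0r (expR y)) maxr_pMl ?expR_ge0.
have cmax (g : R -> R) : continuous g -> continuous (fun x => Num.max (g x) 0).
  by move=> cg x; apply: continuous_max; [exact: cg|exact: cvg_cst].
rewrite -(@gaussian_shift_ge0 a (fun x => Num.max (f x) 0)); last 2 first.
- exact: cmax.
- by move=> x; rewrite le_max lexx orbT.
rewrite -(@gaussian_shift_ge0 a (fun x => Num.max (- f x) 0)); last 2 first.
- by apply: cmax => x; apply: cvgN; exact: cf.
- by move=> x; rewrite le_max lexx orbT.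
by congr (_ - _); apply: eq_mean => w; rewrite ?mulNr ?E0// -mulNr E0.
Qed.

(** Twice the hyperbolic cosine, a common bound for 1, [|y|] and [expR (x * y)] with [|x| < 1]; its
    cube is a combination of exponentials, hence integrable. *)
Let ch (y : R) : R := expR y + expR (- y).

Let ch_ge1 y : 1 <= ch y.
Proof.
rewrite /ch; have [y0|y0] := leP 0 y.
  have : 1 <= expR y by rewrite -expR0 ler_expR.
  by have := expR_ge0 (- y); lra.
have : 1 <= expR (- y) by rewrite -expR0 ler_expR oppr_ge0 ltW.
by have := expR_ge0 y; lra.
Qed.

Let norm_le_ch y : `|y| <= ch y.
Proof.
rewrite /ch ler_norml; apply/andP; split.
  have := expR_ge1Dx (- y); have := expR_ge0 y; lra.
have := expR_ge1Dx y; have := expR_ge0 (- y); lra.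
Qed.

Let expR_le_ch (x y : R) : -1 < x < 1 -> expR (x * y) <= ch y.
Proof.
move=> x1; rewrite /ch; have [y0|y0] := leP 0 y.
  have : expR (x * y) <= expR y by rewrite ler_expR ler_piMl//; lra.
  by have := expR_ge0 (- y); lra.
have : expR (x * y) <= expR (- y) by rewrite ler_expR; nra.
by have := expR_ge0 y; lra.
Qed.

Let ch3_itg : itg (fun w => ch (Y w) ^+ 3).
Proof.
have -> : (fun w => ch (Y w) ^+ 3) = (fun w => expR (3 * Y w) +
    (3 * expR (1 * Y w) + (3 * expR (- 1 * Y w) + expR (- 3 * Y w)))).
  apply/funext => w; rewrite /ch mul1r !mulNr mul1r.
  have -> : expR (3 * Y w) = expR (Y w) ^+ 3 by rewrite -expRM_natl.
  have -> : expR (- (3 * Y w)) = expR (- Y w) ^+ 3 by rewrite -expRM_natl mulrN.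
  have : expR (Y w) * expR (- Y w) = 1 by rewrite -expRD subrr expR0.
  set a := expR (Y w); set b := expR _ => ab.
  transitivity (a ^+ 3 + (3 * a * (a * b) + (3 * b * (a * b) + b ^+ 3))); first by ring.
  by rewrite ab !mulr1.
apply: itgD; first exact: gaussian_exp_itg.
apply: itgD; first by apply: itgZl; exact: gaussian_exp_itg.
by apply: itgD; [apply: itgZl|]; exact: gaussian_exp_itg.
Qed.

(** The derivative is dominated by [C * ch (Y w) ^+ 3], one factor for each of [g], [Y] and the
    exponential. *)
Lemma gaussian_exp_derive (g : R -> R) (C : R) : continuous g ->
  (forall y, `|g y| <= C * ch y) ->
  is_derive (0 : R) (1 : R) (fun a => mean P (fun w => g (Y w) * expR (a * Y w)))
    (mean P (fun w => g (Y w) * Y w)).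
Proof.
move=> cg gC; have C0 : 0 <= C.
  have := le_trans (normr_ge0 _) (gC 0); rewrite pmulr_lge0//.
  exact: lt_le_trans (ch_ge1 0).
have -> : (fun w => g (Y w) * Y w) = (fun w => g (Y w) * (Y w * expR (0 * Y w))).
  by apply/funext => w; rewrite mul0r expR0 mulr1.
have ch0 y : 0 <= ch y by exact: le_trans (ch_ge1 y).
apply: (@is_derive_mean _ _ _ P (fun a w => g (Y w) * expR (a * Y w))
  (fun a w => g (Y w) * (Y w * expR (a * Y w))) (fun w => C * ch (Y w) ^+ 3)).
- move=> x w _; apply: is_deriveZ.
  have dl : is_derive x 1 (fun x => x * Y w) (Y w).
    by apply: is_derive_eq; rewrite scaler0 add0r scaler1.
  rewrite mulrC; exact: (@is_derive1_comp _ expR (fun x => x * Y w)).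
- move=> x; rewrite sub0r add0r => x1.
  apply: (@itg_le _ _ _ _ _ (fun w => C * ch (Y w) ^+ 3)); [|exact: itgZl|].
    apply: measurable_funM; first exact: mcY.
    by apply: (@mcY (fun y => expR (x * y))); exact: cexp.
  move=> w; rewrite normrM [`|expR _|]ger0_norm ?expR_ge0//.
  apply: (@le_trans _ _ (C * ch (Y w) * ch (Y w))).
    by apply: ler_pM => //; exact: expR_le_ch.
  rewrite -mulrA ler_wpM2l// -expr2; exact: ler_weXn2l.
- exact: itgZl.
- move=> x w; rewrite sub0r add0r => x1.
  rewrite !normrM [`|expR _|]ger0_norm ?expR_ge0//.
  rewrite exprS expr2 [leRHS]mulrA; apply: ler_pM => //.
  by apply: ler_pM => //; exact: expR_le_ch.
Qed.

Lemma gaussian_sqr_itg : itg (fun w => Y w ^+ 2).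
Proof.
apply: (@itg_le _ _ _ _ _ (fun w => ch (Y w) ^+ 3)); [|exact: ch3_itg|].
  exact: measurable_funX.
move=> w; rewrite normrX; apply: (@le_trans _ _ (ch (Y w) ^+ 2)).
  by rewrite ler_pXn2r// nnegrE// (le_trans ler01).
exact: ler_weXn2l.
Qed.

Lemma gaussian_itg : itg Y.
Proof.
apply: (@itg_le _ _ _ _ _ (fun w => ch (Y w) ^+ 3)); [exact: mY|exact: ch3_itg|].
move=> w; apply: (@le_trans _ _ (ch (Y w))) => //.
by rewrite -[leLHS]expr1; exact: ler_weXn2l.
Qed.

Lemma gaussian_mgf a : mean P (fun w => expR (a * Y w)) = expR (a ^+ 2 / 2).
Proof.
have := @gaussian_shift_ge0 a (fun=> 1); rewrite mean_cst mulr1 => <- //.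
  by apply: eq_mean => w; rewrite mul1r.
by move=> x; exact: cvg_cst.
Qed.

Let is_derive_half_sqr : is_derive (0 : R) (1 : R) (fun a : R => expR (a ^+ 2 / 2)) 0.
Proof.
have dl : is_derive (0 : R) 1 (fun x : R => x ^+ 2 / 2) 0.
  by apply: is_derive_eq; rewrite !scaler0 !scale0r addr0 scaler0 addr0.
have := (@is_derive1_comp _ expR (fun x => x ^+ 2 / 2) 0 _ _ (is_derive_expR _) dl).
by rewrite mulr0.
Qed.

(** The derivative at 0 of [a -> E (expR (a * Y))] is computed twice: under the expectation, and on
    the closed form [expR (a ^+ 2 / 2)]. *)
Lemma gaussian_mean : mean P Y = 0.
Proof.
have := @gaussian_exp_derive (fun=> 1) 1.
have -> : (fun a => mean P (fun w => 1 * expR (a * Y w))) = (fun a => expR (a ^+ 2 / 2)).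
  by apply/funext => a; rewrite -gaussian_mgf; apply: eq_mean => w; rewrite mul1r.
under eq_mean do rewrite mul1r.
move=> H; suff : is_derive (0 : R) 1 (fun a : R => expR (a ^+ 2 / 2)) (mean P Y).
  by move=> [_ <-]; have [_ ->] := is_derive_half_sqr.
by apply: H => [x|y]; [exact: cvg_cst|rewrite normr1 mul1r].
Qed.

(** Same method with [g] the identity: the shift identity and the vanishing mean give
    [expR (a ^+ 2 / 2) * a], of derivative 1 at 0. *)
Lemma gaussian_second_moment : mean P (fun w => Y w ^+ 2) = 1.
Proof.
have := @gaussian_exp_derive (fun y => y) 1.
have itY a : itg (fun w => Y w * expR (a * Y w)).
  apply: (@itg_le _ _ _ _ _ (fun w => expR ((a + 1) * Y w) + expR ((a - 1) * Y w))).
  - by apply: measurable_funM => //; apply: (@mcY (fun y => expR (a * y))); exact: cexp.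
  - by apply: itgD; exact: gaussian_exp_itg.
  - move=> w; rewrite normrM [`|expR _|]ger0_norm ?expR_ge0//.
    rewrite mulrBl mulrDl !mul1r !expRD addrC -mulrDr mulrC ler_wpM2l ?expR_ge0//.
    by rewrite addrC; exact: norm_le_ch.
have -> : (fun a => mean P (fun w => Y w * expR (a * Y w))) = (fun a => expR (a ^+ 2 / 2) * a).
  apply/funext => a; rewrite (@gaussian_shift a id)//.
  - rewrite meanD ?mean_cst ?gaussian_mean ?addr0//; last exact: gaussian_itg.
    by apply: bmf_integrable; exact: bmf_cst.
  - by move=> x; exact: cvg_id.
  - by apply: itgD; [apply: bmf_integrable; exact: bmf_cst|exact: gaussian_itg].
have dd : is_derive (0 : R) 1 (fun a : R => expR (a ^+ 2 / 2) * a) 1.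
  have h := is_derive_half_sqr.
  apply: is_derive_eq; rewrite expr0n/= mul0r expR0 scaler0 addr0.
  by rewrite scaler1.
move=> H; suff : is_derive (0 : R) 1 (fun a : R => expR (a ^+ 2 / 2) * a)
    (mean P (fun w => Y w * Y w)).
  by move=> [_ <-]; have [_ ->] := dd.
by apply: H => [x|y]; [exact: cvg_id|rewrite mul1r].
Qed.

Let csin (t u : R) : continuous (fun y : R => sin (t * y + u)).
Proof.
move=> z; apply: (@continuous_comp _ _ _ (fun z => t * z + u) sin); last exact: continuous_sin.
by apply: cvgD; [apply: cvgM; [exact: cvg_cst|exact: cvg_id]|exact: cvg_cst].
Qed.

Let mlin (t u : R) : measurable_fun setT (fun w => t * Y w + u).
Proof. by apply: measurable_funD => //; exact: measurable_funM. Qed.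

(* Integration by parts, obtained by differentiating the shift identity
   [E (g(Y) e^(aY)) = e^(a^2/2) E (g(a + Y))] at [a = 0]. *)
Lemma gaussian_stein_sin t u :
  mean P (fun w => Y w * sin (t * Y w + u)) = t * mean P (fun w => cos (t * Y w + u)).
Proof.
have := @gaussian_exp_derive (fun y => sin (t * y + u)) 1.
pose S := mean P (fun w => sin (t * Y w + u)).
pose K := mean P (fun w => cos (t * Y w + u)).
have -> : (fun a => mean P (fun w => sin (t * Y w + u) * expR (a * Y w))) =
    (fun a => expR (a ^+ 2 / 2) * (sin (t * a) * K + cos (t * a) * S)).
  apply/funext => a; rewrite (@gaussian_shift a (fun y => sin (t * y + u)))//.
  - congr (_ * _); rewrite /S /K -!meanZl; last 2 first.
    + by apply: bmf_integrable; exact: bmf_sin.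
    + by apply: bmf_integrable; exact: bmf_cos.
    rewrite -meanD.
    + apply: eq_mean => w.
      by rewrite mulrDr -addrA sinD.
    + by apply: itgZl; apply: bmf_integrable; exact: bmf_cos.
    + by apply: itgZl; apply: bmf_integrable; exact: bmf_sin.
  - apply: (@itg_le _ _ _ _ _ (fun w => expR (a * Y w))); [|exact: gaussian_exp_itg|].
      apply: measurable_funM; first by have [] := @bmf_sin _ T R _ (mlin t u).
      by apply: (@mcY (fun y => expR (a * y))); exact: cexp.
    move=> w; rewrite normrM [`|expR _|]ger0_norm ?expR_ge0// ler_piMl ?expR_ge0//.
    by rewrite ler_norml sin_geN1 sin_le1.
  - apply: bmf_integrable; apply: bmf_sin; apply: measurable_funD => //.
    by apply: measurable_funM => //; exact: measurable_funD.
move=> H.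
have dd : is_derive (0 : R) 1
    (fun a : R => expR (a ^+ 2 / 2) * (sin (t * a) * K + cos (t * a) * S)) (t * K).
  have h := is_derive_half_sqr.
  have dl : is_derive (0 : R) 1 (fun a : R => t * a) t.
    by apply: is_derive_eq; rewrite ?scaler0 ?add0r ?addr0 scaler1.
  have ds : is_derive (0 : R) 1 (fun a : R => sin (t * a)) t.
    have := (@is_derive1_comp _ sin (fun a => t * a) 0 _ _ (is_derive_sin _) dl).
    by rewrite mulr0 cos0 mul1r.
  have dc : is_derive (0 : R) 1 (fun a : R => cos (t * a)) 0.
    have := (@is_derive1_comp _ cos (fun a => t * a) 0 _ _ (is_derive_cos _) dl).
    by rewrite mulr0 sin0 oppr0 mul0r.
  apply: is_derive_eq.
  rewrite !scaler0 !add0r !addr0 expr0n/= mul0r expR0.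
  by rewrite /GRing.scale/=; ring.
suff : is_derive (0 : R) 1
    (fun a : R => expR (a ^+ 2 / 2) * (sin (t * a) * K + cos (t * a) * S))
    (mean P (fun w => sin (t * Y w + u) * Y w)).
  move=> [_ h1]; have [_ h2] := dd; rewrite h2 in h1; rewrite -/K h1.
  by apply: eq_mean => w; rewrite mulrC.
apply: H => [x|y]; first exact: csin.
rewrite mul1r (le_trans _ (ch_ge1 y))//.
by rewrite ler_norml sin_geN1 sin_le1.
Qed.

Let is_derive_cos_mean t u : is_derive (t : R) (1 : R)
  (fun t => mean P (fun w => cos (t * Y w + u)))
  (mean P (fun w => - (Y w * sin (t * Y w + u)))).
Proof.
apply: (@is_derive_mean _ _ _ P (fun t w => cos (t * Y w + u))
  (fun t w => - (Y w * sin (t * Y w + u))) (fun w => `|Y w|)).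
- move=> x w _.
  have dl : is_derive x 1 (fun x => x * Y w + u) (Y w).
    by apply: is_derive_eq; rewrite scaler0 add0r scaler1 addr0.
  have := (@is_derive1_comp _ cos (fun x => x * Y w + u) x _ _ (is_derive_cos _) dl).
  by rewrite mulNr mulrC.
- by move=> x _; apply: bmf_integrable; exact: bmf_cos.
- by apply: itg_norm; exact: gaussian_itg.
- move=> x w _; rewrite normrN normrM ler_piMr//.
  by rewrite ler_norml sin_geN1 sin_le1.
Qed.

(** The Stein identity reads [k' t = - t * k t]; hence [k t * expR (t ^+ 2 / 2)] is constant, equal
    to [cos u] at [t = 0]. *)
Lemma gaussian_cos t u :
  mean P (fun w => cos (t * Y w + u)) = cos u * expR (- (t ^+ 2 / 2)).
Proof.
pose k t := mean P (fun w => cos (t * Y w + u)).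
have dk (x : R) : is_derive x (1 : R) (fun t => k t * expR (t ^+ 2 / 2)) 0.
  have h1 := is_derive_cos_mean x u.
  have dl : is_derive x 1 (fun x : R => x ^+ 2 / 2) x.
    by apply: is_derive_eq; rewrite !scaler0 add0r /GRing.scale/=; field.
  have h2 := (@is_derive1_comp _ expR (fun x => x ^+ 2 / 2) x _ _ (is_derive_expR _) dl).
  have E : mean P (fun w => - (Y w * sin (x * Y w + u))) = - (x * k x).
    rewrite -gaussian_stein_sin.
    rewrite -[RHS]mulN1r -meanZl; first by apply: eq_mean => w; rewrite mulN1r.
    apply: (@itg_le _ _ _ _ _ (fun w => `|Y w|)).
    - apply: measurable_funM => //; by have [] := @bmf_sin _ T R _ (mlin x u).
    - by apply: itg_norm; exact: gaussian_itg.
    - by move=> w; rewrite normrM ler_piMr// ler_norml sin_geN1 sin_le1.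
  rewrite E in h1.
  have [h3 h4] := is_deriveM h1 h2.
  apply: DeriveDef; first exact: h3.
  by rewrite [LHS]h4 /GRing.scale/= /k; ring.
have := is_derive_0_is_cst t 0 dk.
rewrite expr0n/= mul0r expR0 mulr1 /k.
under [in RHS]eq_mean do rewrite mul0r add0r.
by rewrite mean_cst => <-; rewrite -mulrA -expRD subrr expR0 mulr1.
Qed.

Section centered.
Variable X : T -> R.
Hypotheses (mX : measurable_fun setT X) (gX : gaussian P X).

Let itg_affine_sqr m s c : itg (fun w => (m + s * Y w + c) ^+ 2).
Proof.
have -> : (fun w => (m + s * Y w + c) ^+ 2) =
  (fun w => s ^+ 2 * Y w ^+ 2 + (2 * s * (m + c) * Y w + (m + c) ^+ 2)).
  by apply/funext => w; ring.
apply: itgD; first by apply: itgZl; exact: gaussian_sqr_itg.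
apply: itgD; first by apply: itgZl; exact: gaussian_itg.
by apply: bmf_integrable; exact: bmf_cst.
Qed.

Let mean_affine_sqr m s c :
  mean P (fun w => (m + s * Y w + c) ^+ 2) = s ^+ 2 + (m + c) ^+ 2.
Proof.
have -> : (fun w => (m + s * Y w + c) ^+ 2) =
  (fun w => s ^+ 2 * Y w ^+ 2 + (2 * s * (m + c) * Y w + (m + c) ^+ 2)).
  by apply/funext => w; ring.
have i1 := gaussian_sqr_itg; have i2 := gaussian_itg.
have i3 (k : R) : itg (fun=> k) by apply: bmf_integrable; exact: bmf_cst.
rewrite (meanD (itgZl _ i1) (itgD (itgZl _ i2) (i3 _))) (meanD (itgZl _ i2) (i3 _)).
by rewrite !meanZl// gaussian_mean gaussian_second_moment mean_cst; ring.
Qed.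

Let csqr (c : R) : continuous (fun x : R => (x + c) ^+ 2).
Proof.
move=> z; apply: (@continuous_comp _ _ _ (fun z => z + c) (fun z => z ^+ 2)).
  by apply: cvgD; [exact: cvg_id|exact: cvg_cst].
exact: exprn_continuous.
Qed.

(** The law identity is available for nonnegative test functions only, so the mean is not read on
    [X] itself but on the squares [(X + c) ^+ 2], at [c = 0] and [c = 1]. *)
Let sqr_law : exists m s : R,
  (forall f : R -> R, continuous f -> (forall x, 0 <= f x) ->
    (\int[P]_w (f (X w))%:E = \int[P]_w (f (m + s * Y w))%:E)%E) /\
  (forall c, itg (fun w => (X w + c) ^+ 2) /\
             mean P (fun w => (X w + c) ^+ 2) = s ^+ 2 + (m + c) ^+ 2).
Proof.
have [m [s E]] := gaussian_affine mX gX; exists m, s; split=> // c.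
have E2 := E (fun x => (x + c) ^+ 2) (@csqr c) (fun x => sqr_ge0 _).
split; last by rewrite -mean_affine_sqr /mean /Rintegral E2.
have mXc : measurable_fun setT (fun w => (X w + c) ^+ 2).
  by apply: measurable_funX; exact: measurable_funD.
apply/ge0_itgP => // [w|]; first exact: sqr_ge0.
rewrite E2; apply/ge0_itgP; [|by move=> w; exact: sqr_ge0|exact: itg_affine_sqr].
exact: (itg_measurable (itg_affine_sqr m s c)).
Qed.

Lemma gaussianL2 : itg (fun w => X w ^+ 2).
Proof.
have [m [s [_ /(_ 0)[h _]]]] := sqr_law.
by move: h; congr (P.-integrable _ (EFin \o _)); apply/funext => w; rewrite addr0.
Qed.

Let gaussianL1 : itg X.
Proof.
apply: (@itg_le _ _ _ _ _ (fun w => X w ^+ 2 + 1)) => //.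
  by apply: itgD; [exact: gaussianL2|apply: bmf_integrable; exact: bmf_cst].
move=> w; rewrite ler_norml; apply/andP; split; nra.
Qed.

Hypothesis X0 : mean P X = 0.

Let centered_law : exists s : R, s ^+ 2 = mean P (fun w => X w ^+ 2) /\
  (forall f : R -> R, continuous f -> (forall x, 0 <= f x) ->
    (\int[P]_w (f (X w))%:E = \int[P]_w (f (s * Y w))%:E)%E).
Proof.
have [m [s [E H]]] := sqr_law.
have [_] := H 0; have [_] := H 1.
under eq_mean do rewrite sqrrD mulr1 expr1n.
have i3 (k : R) : itg (fun=> k) by apply: bmf_integrable; exact: bmf_cst.
have i2 : itg (fun w => X w *+ 2).
  have := itgZl 2 gaussianL1; congr (P.-integrable _ (EFin \o _)).
  by apply/funext => w; rewrite mulr_natl.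
rewrite (meanD (itgD gaussianL2 i2) (i3 _)) (meanD gaussianL2 i2) mean_cst.
under [mean P (fun w => X w *+ 2)]eq_mean do rewrite -mulr_natl.
rewrite meanZl; last exact: gaussianL1.
under [X in _ -> X = _ -> _]eq_mean do rewrite addr0.
rewrite X0 => h1 h2; have m0 : m = 0 by lra.
exists s; split; first by rewrite h2 m0; ring.
by move=> f cf f0; rewrite E// m0; apply: eq_integral => w _; rewrite add0r.
Qed.

Lemma gaussian_charfun u : mean P (fun w => cos (X w + u)) =
  cos u * expR (- (mean P (fun w => X w ^+ 2) / 2)).
Proof.
have [s [<- E]] := centered_law; rewrite -gaussian_cos.
have i3 (k : R) : itg (fun=> k) by apply: bmf_integrable; exact: bmf_cst.
have icos (Z : T -> R) : measurable_fun setT Z -> itg (fun w => cos (Z w + u)).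
  by move=> mZ; apply: bmf_integrable; apply: bmf_cos; exact: measurable_funD.
(* Adding 1 makes the cosine a nonnegative test function. *)
apply: (addrI 1); rewrite -{1 2}(mean_cst P 1) -!meanD//.
- rewrite /mean /Rintegral; congr fine; apply: (E (fun x => 1 + cos (x + u))).
    move=> z; apply: cvgD; first exact: cvg_cst.
    apply: (@continuous_comp _ _ _ (fun z => z + u) cos); last exact: continuous_cos.
    by apply: cvgD; [exact: cvg_id|exact: cvg_cst].
  by move=> x; have := cos_geN1 (x + u); lra.
- by apply: (@icos (fun w => s * Y w)); exact: measurable_funM.
- exact: icos.
Qed.

Lemma gaussian_exp_mean a : itg (fun w => expR (a * X w)) /\
  mean P (fun w => expR (a * X w)) = expR (a ^+ 2 * mean P (fun w => X w ^+ 2) / 2).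
Proof.
have [s [<- E]] := centered_law.
have E2 := E (fun x => expR (a * x)) (@cexp a) (fun x => expR_ge0 _).
have I2 : (\int[P]_w (expR (a * (s * Y w)))%:E)%E = (expR (a ^+ 2 * s ^+ 2 / 2))%:E.
  rewrite -exprMn -gaussian_mgf meanE; last exact: gaussian_exp_itg.
  by apply: eq_integral => w _; rewrite mulrA.
rewrite I2 in E2; split; last by rewrite /mean /Rintegral E2.
apply/ge0_itgP => [|w|]; [|exact: expR_ge0|by rewrite E2 ltry].
apply: (@measurableT_comp _ _ _ _ _ _ expR) => //; exact: measurable_funM.
Qed.

(* Chernoff's bound, with the optimal exponent [t / V]. *)
Lemma gaussian_tail (V t : R) : mean P (fun w => X w ^+ 2) <= V -> 0 < V -> 0 <= t ->
  mean P (fun w => ind (t < X w)) <= expR (- (t ^+ 2 / (2 * V))).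
Proof.
move=> XV V0 t0; pose a := t / V; have a0 : 0 <= a by rewrite divr_ge0// ltW.
have [ia ma] := gaussian_exp_mean a.
apply: (@le_trans _ _ (mean P (fun w => expR (- (a * t)) * expR (a * X w)))).
  apply: le_mean.
  - by apply: bmf_integrable; exact: bmf_gt.
  - exact: itgZl.
  - move=> w; rewrite -expRD; have [tX|tX] := ltP t (X w); last exact: expR_ge0.
    by rewrite -[leLHS]expR0 ler_expR addrC subr_ge0 ler_wpM2l// ltW.
rewrite meanZl// ma -expRD ler_expR.
apply: (@le_trans _ _ (- (a * t) + a ^+ 2 * V / 2)).
  by rewrite lerD2l ler_pM2r ?invr_gt0// ler_wpM2l// sqr_ge0.
rewrite le_eqVlt; apply/orP; left; apply/eqP; rewrite /a.
by field; rewrite gt_eqF.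
Qed.

End centered.

End standard.
End gaussian_rv.

(** * Joint laws from trigonometric moments *)

Section threshold.
Context {R : realType}.
Implicit Types x y z : R.

Lemma bernoulli_ineq y n : -1 <= y -> 1 + n%:R * y <= (1 + y) ^+ n.
Proof.
move=> y1; elim: n => [|n IH]; first by rewrite mul0r addr0 expr0.
rewrite exprS; apply: (@le_trans _ _ ((1 + y) * (1 + n%:R * y))); last first.
  by apply: ler_wpM2l => //; lra.
rewrite -natr1; have : 0 <= n%:R * (y * y) by rewrite mulr_ge0// -expr2 sqr_ge0.
nra.
Qed.

(* The product of the two exponentiated quantities, [n 4^n x^(2n) = n (2x)^(2n)],
   tends to 0 if [2x < 1] and to infinity otherwise. *)
Definition cutoff n x := (1 - x ^+ (2 * n.+1)) ^+ (n.+1 * 4 ^ n.+1).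

Lemma cutoff_01 n x : 0 <= x <= 1 -> 0 <= cutoff n x <= 1.
Proof.
move=> /andP[x0 x1]; have xn : 0 <= x ^+ (2 * n.+1) <= 1.
  by rewrite exprn_ge0// exprn_ile1.
by rewrite exprn_ge0 ?exprn_ile1//; lra.
Qed.

Lemma cutoff_exponent n x :
  (n.+1 * 4 ^ n.+1)%:R * x ^+ (2 * n.+1) = n.+1%:R * ((2 * x) ^+ n.+1) ^+ 2.
Proof.
rewrite natrM -mulrA; congr (_ * _).
by rewrite natrX exprM -exprMn exprAC; congr (_ ^+ _); ring.
Qed.

Lemma cutoff_lt n x : 0 <= x -> 2 * x < 1 ->
  1 - (1 - 2 * x) ^- 2 * harmonic n <= cutoff n x.
Proof.
move=> x0 x1; set z := 2 * x; have z0 : 0 <= z by rewrite mulr_ge0.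
have z1 : 0 < 1 - z by rewrite /z subr_gt0.
have xn : x ^+ (2 * n.+1) <= 1 by rewrite exprn_ile1//; lra.
(* Bernoulli bounds [(2 - z) ^+ n.+1] from below by [n.+1 * (1 - z)], while [z * (2 - z) <= 1]. *)
have zn : z ^+ n.+1 * (n.+1%:R * (1 - z)) <= 1.
  apply: (@le_trans _ _ ((z * (1 + (1 - z))) ^+ n.+1)); last first.
    by rewrite exprn_ile1//; nra.
  rewrite [leRHS]exprMn; apply: ler_wpM2l; first exact: exprn_ge0.
  by apply: le_trans (bernoulli_ineq _ _); lra.
apply: le_trans (bernoulli_ineq _ _); last by rewrite lerN2.
rewrite mulrN cutoff_exponent -/z lerD2l lerN2 /harmonic/= -exprVn.
have n0 : 0 < n.+1%:R :> R by rewrite ltr0n.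
have {}zn : z ^+ n.+1 <= (n.+1%:R * (1 - z))^-1.
  by rewrite -[leRHS]div1r ler_pdivlMr// mulr_gt0.
apply: (@le_trans _ _ (n.+1%:R * ((n.+1%:R * (1 - z))^-1) ^+ 2)).
  rewrite ler_pM2l// ler_pXn2r// nnegrE ?exprn_ge0// invr_ge0 mulr_ge0//.
  exact: ltW.
by rewrite le_eqVlt; apply/orP; left; apply/eqP; field; rewrite !gt_eqF.
Qed.

(** As [(1 - y) * (1 + y) <= 1], Bernoulli gives [(1 - y) ^+ N <= 1 / (N y)]. The factor [n.+1] in
    the exponent of [cutoff] serves the boundary [2 * x = 1], where [4^n.+1 * x^(2 n.+1)] alone
    would stay equal to 1. *)
Lemma cutoff_ge n x : 1 <= 2 * x -> x <= 1 -> cutoff n x <= harmonic n.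
Proof.
move=> x0 x1; have y1 : x ^+ (2 * n.+1) <= 1 by rewrite exprn_ile1//; lra.
set y := x ^+ _ in y1 *; set N := (n.+1 * 4 ^ n.+1)%N.
have y0 : 0 <= y by rewrite exprn_ge0//; lra.
have Ny : n.+1%:R <= N%:R * y.
  by rewrite cutoff_exponent ler_peMr// !exprn_ege1.
rewrite /cutoff -/y -/N /harmonic/= -div1r ler_pdivlMr ?ltr0n//.
apply: (@le_trans _ _ ((1 - y) ^+ N * (1 + y) ^+ N)); last first.
  by rewrite -exprMn exprn_ile1//; nra.
apply: ler_wpM2l; first by rewrite exprn_ge0// subr_ge0.
by apply: le_trans (bernoulli_ineq _ _); lra.
Qed.

Lemma cutoff_cvg x : 0 <= x <= 1 ->
  cutoff n x @[n --> \oo] --> (ind (2 * x < 1) : R).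
Proof.
move=> x01; have [x1|x1] := ltP (2 * x) 1.
- apply: (@squeeze_cvgr _ _ _ _ (fun n => 1 - (1 - 2 * x) ^- 2 * harmonic n)
    (fun=> 1)).
  + apply: nearW => n; rewrite cutoff_lt//=; last by case/andP: x01.
    by have /andP[] := cutoff_01 n x01.
  + rewrite [X in _ --> X](_ : _ = 1 - (1 - 2 * x) ^- 2 * 0).
      apply: cvgB; first exact: cvg_cst.
      by apply: cvgM; [exact: cvg_cst|exact: cvg_harmonic].
    by rewrite mulr0 subr0.
  + exact: cvg_cst.
- apply: (@squeeze_cvgr _ _ _ _ (fun=> 0) (@harmonic R)).
  + apply: nearW => n; rewrite cutoff_ge//; last by case/andP: x01.
    by have /andP[->] := cutoff_01 n x01.
  + exact: cvg_cst.
  + exact: cvg_harmonic.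
Qed.

End threshold.

Lemma cos_mul_cos (R : realType) (a b : R) :
  cos a * cos b = 2^-1 * cos (a + b) + 2^-1 * cos (a - b).
Proof. by rewrite cosD cosB; field. Qed.

Section trig_transfer.
Context (R : realType) d1 (T1 : measurableType d1) (P1 : probability T1 R)
  d2 (T2 : measurableType d2) (P2 : probability T2 R).
Variables (V1 X1 : T1 -> R) (V2 X2 : T2 -> R).
Hypotheses (bV1 : bounded_measurable V1) (bV2 : bounded_measurable V2).
Hypotheses (mX1 : measurable_fun setT X1) (mX2 : measurable_fun setT X2).
Hypothesis trigE : forall a t,
  mean P1 (fun w => V1 w * cos (a * X1 w + t)) =
  mean P2 (fun w => V2 w * cos (a * X2 w + t)).

Let wave (b u x : R) := 2^-1 + 2^-1 * cos (b * x + u).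

Let wave01 b u x : 0 <= wave b u x <= 1.
Proof. by rewrite /wave; have := cos_le1 (b * x + u); have := cos_geN1 (b * x + u); lra. Qed.

Let mwave d (T : measurableType d) (X : T -> R) b u : measurable_fun setT X ->
  bounded_measurable (fun w => wave b u (X w)).
Proof.
move=> mX; apply: bmfD; first exact: bmf_cst.
apply: bmfM; first exact: bmf_cst.
apply: bmf_cos; apply: measurable_funD => //; exact: measurable_funM.
Qed.

(** The claim is general in [a] and [t] because one more factor [wave] produces cosines of frequency
    [a + b], [a - b] and phase [t + u], [t - u]. *)
Let waveX b u k a t :
  mean P1 (fun w => V1 w * cos (a * X1 w + t) * wave b u (X1 w) ^+ k) =
  mean P2 (fun w => V2 w * cos (a * X2 w + t) * wave b u (X2 w) ^+ k).
Proof.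
elim: k a t => [|k IH] a t.
  under eq_mean do rewrite expr0 mulr1.
  by under [in RHS]eq_mean do rewrite expr0 mulr1.
have step d (T : measurableType d) (P : probability T R) (V X : T -> R) :
    bounded_measurable V -> measurable_fun setT X ->
  mean P (fun w => V w * cos (a * X w + t) * wave b u (X w) ^+ k.+1) =
  2^-1 * mean P (fun w => V w * cos (a * X w + t) * wave b u (X w) ^+ k) +
  (4^-1 * mean P (fun w => V w * cos ((a + b) * X w + (t + u)) * wave b u (X w) ^+ k) +
  4^-1 * mean P (fun w => V w * cos ((a - b) * X w + (t - u)) * wave b u (X w) ^+ k)).
  move=> bV mX; have bm a' t' : P.-integrable setT (EFin \o
      (fun w => V w * cos (a' * X w + t') * wave b u (X w) ^+ k)).
    apply: bmf_integrable; apply: bmfM; last exact/bmfX/mwave.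
    by apply: bmfM => //; apply: bmf_cos; apply: measurable_funD => //; exact: measurable_funM.
  rewrite -!(meanZl _ (bm _ _)) -(meanD (itgZl _ (bm _ _)) (itgZl _ (bm _ _))).
  rewrite -(meanD (itgZl _ (bm _ _)) (itgD (itgZl _ (bm _ _)) (itgZl _ (bm _ _)))).
  apply: eq_mean => w; have -> : wave b u (X w) ^+ k.+1 =
    (2^-1 + 2^-1 * cos (b * X w + u)) * wave b u (X w) ^+ k by rewrite exprS.
  have -> : (a + b) * X w + (t + u) = (a * X w + t) + (b * X w + u) by ring.
  have -> : (a - b) * X w + (t - u) = (a * X w + t) - (b * X w + u) by ring.
  rewrite (cosD (a * X w + t)) (cosB (a * X w + t)).
  by field.
by rewrite !step// !IH.
Qed.

Let wave_poly b u (q : {poly R}) :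
  mean P1 (fun w => V1 w * q.[wave b u (X1 w)]) =
  mean P2 (fun w => V2 w * q.[wave b u (X2 w)]).
Proof.
have step d (T : measurableType d) (P : probability T R) (V X : T -> R) :
    bounded_measurable V -> measurable_fun setT X ->
  mean P (fun w => V w * q.[wave b u (X w)]) = \sum_(i < size q) q`_i *
    mean P (fun w => V w * cos (0 * X w + 0) * wave b u (X w) ^+ i).
  move=> bV mX.
  have bm i : P.-integrable setT (EFin \o
      (fun w => V w * cos (0 * X w + 0) * wave b u (X w) ^+ i)).
    apply: bmf_integrable; apply: bmfM; last exact/bmfX/mwave.
    by apply: bmfM => //; apply: bmf_cos; apply: measurable_funD => //; exact: measurable_funM.
  under [RHS]eq_bigr do rewrite -meanZl//.
  rewrite -mean_sum; last by move=> i; exact: itgZl.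
  apply: eq_mean => w; rewrite horner_coef mulr_sumr; apply: eq_bigr => i _.
  by rewrite mul0r addr0 cos0; ring.
by rewrite !step//; apply: eq_bigr => i _; rewrite waveX.
Qed.

Let wave_lt b u :
  mean P1 (fun w => V1 w * ind (cos (b * X1 w + u) < 0)) =
  mean P2 (fun w => V2 w * ind (cos (b * X2 w + u) < 0)).
Proof.
have cv d (T : measurableType d) (P : probability T R) (V X : T -> R) :
    bounded_measurable V -> measurable_fun setT X ->
  mean P (fun w => V w * cutoff n (wave b u (X w))) @[n --> \oo] -->
  mean P (fun w => V w * ind (cos (b * X w + u) < 0)).
  move=> [mV [M VM]] mX; apply: (@mean_cvg_bounded _ _ _ _ _ _ M).
  - move=> n; apply: measurable_funM => //; apply: measurable_funX.
    apply: measurable_funB => //; apply: measurable_funX.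
    by have [] := @mwave _ _ X b u mX.
  - move=> n w; rewrite normrM -[leRHS]mulr1; apply: ler_pM => //.
    by have /andP[? ?] := cutoff_01 n (wave01 b u (X w)); rewrite ger0_norm.
  - move=> w; apply: cvgM; first exact: cvg_cst.
    rewrite (_ : (cos (b * X w + u) < 0) = (2 * wave b u (X w) < 1)).
      exact: cutoff_cvg.
    by rewrite /wave; apply/idP/idP; lra.
have := cv _ _ P1 _ _ bV1 mX1; have := cv _ _ P2 _ _ bV2 mX2.
rewrite (_ : (fun n => mean P1 _) = (fun n => mean P2
   (fun w => V2 w * cutoff n (wave b u (X2 w))))).
  by move=> h1 h2; exact: (cvg_unique _ h2 h1).
apply/funext => n.
have := wave_poly b u ((1 - 'X^(2 * n.+1)) ^+ (n.+1 * 4 ^ n.+1)).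
under eq_mean do rewrite !hornerE.
by under [in RHS]eq_mean do rewrite !hornerE.
Qed.

Lemma trig_transfer s : mean P1 (fun w => V1 w * ind (X1 w <= s)) =
  mean P2 (fun w => V2 w * ind (X2 w <= s)).
Proof.
pose b (m : nat) : R := m.+1%:R^-1.
(* With this phase the cosine equals [sin (b (X - s - b))], which for a given [X] and [b] small
   enough is negative exactly when [X < s + b]. Raising the level by [b] makes [X = s] count as
   below [s] in the limit. *)
pose u (m : nat) : R := - (b m * (s + b m)) - pi / 2.
have b0 m : 0 < b m by rewrite invr_gt0 ltr0n.
have bcvg : b m @[m --> \oo] --> (0 : R) by exact: cvg_harmonic.
have cv d (T : measurableType d) (P : probability T R) (V X : T -> R) :
    bounded_measurable V -> measurable_fun setT X ->
  mean P (fun w => V w * ind (cos (b m * X w + u m) < 0)) @[m --> \oo] -->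
  mean P (fun w => V w * ind (X w <= s)).
  move=> [mV [M VM]] mX; apply: (@mean_cvg_bounded _ _ _ _ _ _ M).
  - move=> n; apply: measurable_funM => //; apply: measurable_boolR.
    apply: measurable_fun_ltr => //; have [] // := @bmf_cos _ T R (fun w => b n * X w + u n).
    by apply: measurable_funD => //; exact: measurable_funM.
  - move=> n w; rewrite normrM -[leRHS]mulr1; apply: ler_pM => //.
    by case: (_ < _); rewrite ?normr1 ?normr0.
  - move=> w; apply: cvgM; first exact: cvg_cst.
    apply: (@cvg_near_cst _ R^o).
    have E m : cos (b m * X w + u m) = sin (b m * (X w - s - b m)).
      by rewrite -cosBpihalf; congr cos; rewrite /u; ring.
    have pi0 : 0 < pi :> R by exact: pi_gt0.
    have bsmall (e : R) : 0 < e -> \forall m \near \oo, b m < e.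
      move=> e0; have := cvgr_lt (0 : R) bcvg e e0; exact.
    have [Xs|Xs] := leP (X w) s.
    + have := bsmall (pi / (s - X w + 1)) (divr_gt0 pi0 _).
      have sX : 0 < s - X w + 1 by lra.
      move=> /(_ sX); apply: filterS => m bm; rewrite E.
      suff : 0 < sin (b m * (s + b m - X w)).
        rewrite (_ : b m * (X w - s - b m) = - (b m * (s + b m - X w))); last by ring.
        by rewrite sinN oppr_lt0 => ->.
      have b1 : b m <= 1 by rewrite invf_le1 ?ler1n// ltr0n.
      apply: sin_gt0_pi; rewrite mulr_gt0//=; last by have := b0 m; lra.
      apply: (@le_lt_trans _ _ (b m * (s - X w + 1))); last by rewrite -ltr_pdivlMr.
      by rewrite ler_pM2l//; lra.
    + have Xs' : 0 < X w - s by rewrite subr_gt0.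
      have := bsmall _ (divr_gt0 pi0 Xs'); have := bsmall _ Xs'.
      apply: filterS2 => m bm1 bm2; rewrite E.
      suff : 0 < sin (b m * (X w - s - b m)).
        by move=> /ltW; rewrite leNgt => /negbTE ->.
      apply: sin_gt0_pi; rewrite mulr_gt0 ?subr_gt0//=.
      rewrite ltr_pdivlMr// in bm2; apply: le_lt_trans bm2.
      by rewrite ler_pM2l// gerBl ltW.
have := cv _ _ P1 _ _ bV1 mX1; have := cv _ _ P2 _ _ bV2 mX2.
rewrite (_ : (fun n => mean P1 _) = (fun n => mean P2
   (fun w => V2 w * ind (cos (b n * X2 w + u n) < 0)))).
  by move=> h1 h2; exact: (cvg_unique _ h2 h1).
by apply/funext => n; exact: wave_lt.
Qed.

End trig_transfer.

(** [S] selects the tested coordinates: in the event below, all coordinates of [Y] are tested but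
    only those of [Yhat] at which [eps] is 0. *)
Definition box (T : Type) (R : realType) (S : pred nat) (s : nat -> R)
    (X : nat -> T -> R) (m : nat) (w : T) : R :=
  \prod_(j < m) ind (S j ==> (X j w <= s j)).

Lemma box_bmf d (T : measurableType d) (R : realType) (S : pred nat)
    (s : nat -> R) (X : nat -> T -> R) m :
  (forall j, measurable_fun setT (X j)) -> bounded_measurable (box S s X m).
Proof.
move=> mX; apply: bmf_prod => j; case: (S j) => /=; last exact: bmf_cst.
exact: bmf_le.
Qed.

Lemma measurable_lincomb d (T : measurableType d) (R : realType)
    (X : nat -> T -> R) (c : nat -> R) m :
  (forall j, measurable_fun setT (X j)) ->
  measurable_fun setT (fun w => \sum_(j < m) c j * X j w).
Proof. by move=> mX; apply: measurable_sum => j; exact: measurable_funM. Qed.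

Section box_transfer.
Context (R : realType) d1 (T1 : measurableType d1) (P1 : probability T1 R)
  d2 (T2 : measurableType d2) (P2 : probability T2 R).
Variables (X1 : nat -> T1 -> R) (X2 : nat -> T2 -> R).
Hypotheses (mX1 : forall j, measurable_fun setT (X1 j))
  (mX2 : forall j, measurable_fun setT (X2 j)).
Variables (S : pred nat) (s : nat -> R).

(* One coordinate at a time: the indicator of [X m <= s m] is absorbed in the
   weight, the remaining coordinates being still tested by cosines. *)
Lemma box_transfer m (V1 : T1 -> R) (V2 : T2 -> R) :
  bounded_measurable V1 -> bounded_measurable V2 ->
  (forall (c : nat -> R) t, mean P1 (fun w => V1 w * cos (\sum_(j < m) c j * X1 j w + t)) =
               mean P2 (fun w => V2 w * cos (\sum_(j < m) c j * X2 j w + t))) ->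
  mean P1 (fun w => V1 w * box S s X1 m w) =
  mean P2 (fun w => V2 w * box S s X2 m w).
Proof.
elim: m V1 V2 => [|m IH] V1 V2 bV1 bV2 H.
  have := H (fun=> 0) 0.
  have E d (T : measurableType d) (P : probability T R) (X : nat -> T -> R) V :
      mean P (fun w => V w * cos (\sum_(j < 0) 0 * X j w + 0)) =
      mean P (fun w => V w * box S s X 0 w).
    by apply: eq_mean => w; rewrite big_ord0 addr0 cos0 /box big_ord0.
  by rewrite !E.
pose W d (T : measurableType d) (X : nat -> T -> R) (V : T -> R) w : R :=
  V w * ind (S m ==> (X m w <= s m)).
have boxS d (T : measurableType d) (P : probability T R) (X : nat -> T -> R) V :
    mean P (fun w => V w * box S s X m.+1 w) =
    mean P (fun w => W _ _ X V w * box S s X m w).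
  by apply: eq_mean => w; rewrite /box big_ord_recr/= /W mulrA mulrAC.
have bW d (T : measurableType d) (X : nat -> T -> R) (V : T -> R) :
    (forall j, measurable_fun setT (X j)) -> bounded_measurable V ->
    bounded_measurable (W _ _ X V).
  move=> mX bV; apply: bmfM => //; case: (S m) => /=; last exact: bmf_cst.
  exact: bmf_le.
rewrite !boxS; apply: IH; [exact: bW..|move=> c t].
have Wcos d (T : measurableType d) (P : probability T R) (X : nat -> T -> R) V :
    mean P (fun w => W _ _ X V w * cos (\sum_(j < m) c j * X j w + t)) =
    mean P (fun w => V w * cos (\sum_(j < m) c j * X j w + t) *
      ind (S m ==> (X m w <= s m))).
  by apply: eq_mean => w; rewrite /W mulrAC.
have lin a t' : mean P1 (fun w => V1 w *
      cos (\sum_(j < m) c j * X1 j w + a * X1 m w + t')) =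
    mean P2 (fun w => V2 w * cos (\sum_(j < m) c j * X2 j w + a * X2 m w + t')).
  have := H (fun j => if j == m then a else c j) t'.
  have E (T : Type) (X : nat -> T -> R) w :
      \sum_(j < m.+1) (if (j : nat) == m then a else c j) * X j w =
      \sum_(j < m) c j * X j w + a * X m w.
    rewrite big_ord_recr/= eqxx; congr (_ + _).
    by apply: eq_bigr => j _; rewrite (ltn_eqF (ltn_ord j)).
  under eq_mean do rewrite E.
  by under [X in _ = X -> _]eq_mean do rewrite E.
have bcos d (T : measurableType d) (X : nat -> T -> R) (V : T -> R) t' :
    (forall j, measurable_fun setT (X j)) -> bounded_measurable V ->
    bounded_measurable (fun w => V w * cos (\sum_(j < m) c j * X j w + t')).
  move=> mX bV; apply: bmfM => //; apply: bmf_cos; apply: measurable_funD => //.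
  exact: measurable_lincomb.
rewrite !Wcos; case: (S m) => /=; last first.
  under eq_mean do rewrite mulr1.
  under [RHS]eq_mean do rewrite mulr1.
  have := lin 0 t; under eq_mean do rewrite mul0r addr0.
  by under [X in _ = X -> _]eq_mean do rewrite mul0r addr0.
(* The cosine in the first [m] coordinates is made part of the weight; product-to-sum then merges it
   with the cosine testing [X m]. *)
apply: (@trig_transfer R _ _ P1 _ _ P2); [exact: bcos|exact: bcos|exact: mX1|exact: mX2|].
move=> a t'.
have step d (T : measurableType d) (P : probability T R) (X : nat -> T -> R)
    (V : T -> R) :
    (forall j, measurable_fun setT (X j)) -> bounded_measurable V ->
  mean P (fun w => V w * cos (\sum_(j < m) c j * X j w + t) * cos (a * X m w + t')) =
  2^-1 * mean P (fun w => V w * cos (\sum_(j < m) c j * X j w + a * X m w + (t + t'))) +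
  2^-1 * mean P (fun w => V w * cos (\sum_(j < m) c j * X j w + (- a) * X m w + (t - t'))).
  move=> mX bV; have bm a' t1 : P.-integrable setT (EFin \o
      (fun w => V w * cos (\sum_(j < m) c j * X j w + a' * X m w + t1))).
    apply: bmf_integrable; apply: bmfM => //; apply: bmf_cos.
    apply: measurable_funD => //; apply: measurable_funD; last exact: measurable_funM.
    exact: measurable_lincomb.
  rewrite -!(meanZl _ (bm _ _)) -(meanD (itgZl _ (bm _ _)) (itgZl _ (bm _ _))).
  apply: eq_mean => w; rewrite -mulrA cos_mul_cos.
  set A := \sum_(j < m) _.
  have -> : A + a * X m w + (t + t') = A + t + (a * X m w + t') by ring.
  have -> : A + - a * X m w + (t - t') = A + t - (a * X m w + t') by ring.
  by ring.
by rewrite !step// !lin.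
Qed.

End box_transfer.

(** * Quasi-independence of Gaussian boxes *)

Section mean_prod.
Context (R : realType) d1 (T1 : measurableType d1) (P1 : probability T1 R)
  d2 (T2 : measurableType d2) (P2 : probability T2 R).
Variable f : T1 * T2 -> R.
Hypothesis bf : bounded_measurable f.

Lemma section_bmf x : bounded_measurable (fun y => f (x, y)).
Proof.
case: bf => mf [M fM]; split; last by exists M.
by apply: measurableT_comp => //; exact: measurable_pair1.
Qed.

Let section_meanE x :
  (mean P2 (fun y => f (x, y)))%:E = (\int[P2]_y (f (x, y))%:E)%E.
Proof. by apply: meanE; apply: bmf_integrable; exact: section_bmf. Qed.

Lemma mean_section_bmf : bounded_measurable (fun x => mean P2 (fun y => f (x, y))).
Proof.
split.
  apply/measurable_EFinP.
  rewrite (_ : EFin \o _ = fun x => (\int[P2]_y (f (x, y))%:E)%E).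
    exact: (measurable_fubini_F (bmf_integrable (P1 \x P2)%E bf)).
  by apply/funext => x /=; rewrite section_meanE.
case: (bf) => mf [M fM]; exists M => x.
have i1 : P2.-integrable setT (EFin \o (fun y => f (x, y))).
  by apply: bmf_integrable; exact: section_bmf.
apply: le_trans (norm_mean i1) _; rewrite -[leRHS](mean_cst P2).
by apply: le_mean => //; [exact: itg_norm|apply: bmf_integrable; exact: bmf_cst].
Qed.

Lemma mean_prod :
  mean (P1 \x P2)%E f = mean P1 (fun x => mean P2 (fun y => f (x, y))).
Proof.
rewrite /mean [in LHS]/Rintegral -integral12_prod_meas1; last first.
  exact: (bmf_integrable (P1 \x P2)%E bf).
rewrite [in RHS]/Rintegral; congr fine; apply: eq_integral => x _.
exact: (esym (section_meanE x)).
Qed.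

End mean_prod.

(** A union bound: the two products differ, by at most 1, only if some tested factor differs. *)
Lemma prod_ind_dist (R : realType) n (a b : nat -> bool) (S' : pred nat) :
  `|\prod_(j < n) ind (S' j ==> a j) - \prod_(j < n) ind (S' j ==> b j)| <=
  \sum_(j < n | S' j) `|ind (a j) - ind (b j)| :> R.
Proof.
elim: n => [|n IH]; first by rewrite !big_ord0 subrr normr0.
rewrite [X in _ <= X]big_mkcond/= !big_ord_recr/= -big_mkcond/=.
have nn : 0 <= \sum_(j < n | S' j) `|ind (a j) - ind (b j)| :> R by exact: sumr_ge0.
have pi01 (c : nat -> bool) : 0 <= (\prod_(j < n) ind (S' j ==> c j) : R) <= 1.
  elim: (n) => [|m IHm]; first by rewrite big_ord0 ler01 lexx.
  by rewrite big_ord_recr/=; case: (_ ==> _); rewrite ?mulr1 ?mulr0 ?lexx ?ler01.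
have /andP[a0 a1] := pi01 a; have /andP[b0 b1] := pi01 b.
move: IH a0 a1 b0 b1; set A := \prod_(j < n) _; set B := \prod_(j < n) _.
move=> IH a0 a1 b0 b1; case: (S' n) => /=; last by rewrite !mulr1 addr0.
case: (a n); case: (b n); rewrite ?mulr1 ?mulr0 ?subrr ?normr0 ?addr0 ?subr0 ?sub0r ?normrN//=.
- by rewrite ger0_norm// normr1 (le_trans a1)// lerDr.
- by rewrite ger0_norm// normr1 (le_trans b1)// lerDr.
Qed.

Section quasi_independence.
Context d (T : measurableType d) (R : realType) (P : probability T R).
Variable Y : nat -> T -> R.
Hypotheses (mY : forall n, measurable_fun setT (Y n))
  (gY : jointly_gaussian P Y) (sY : forall n, standard_gaussian P (Y n)).
Local Notation itg f := (P.-integrable setT (EFin \o f)).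

Let lin (c : nat -> R) (n : nat) (w : T) := \sum_(i < n) c i * Y i w.

Let mlin c n : measurable_fun setT (lin c n).
Proof. exact: measurable_lincomb. Qed.

Let glin c n : gaussian P (lin c n).
Proof. exact: (gY (fun i : 'I_n => c i)). Qed.

Let itgY i : itg (Y i).
Proof. exact: gaussian_itg. Qed.

Let lin0 c n : mean P (lin c n) = 0.
Proof.
rewrite /lin mean_sum; last by move=> i; exact: itgZl.
by rewrite big1// => i _; rewrite meanZl// (@gaussian_mean _ _ _ P)// mulr0.
Qed.

Let lin_charfun c n t : mean P (fun w => cos (lin c n w + t)) =
  cos t * expR (- (mean P (fun w => lin c n w ^+ 2) / 2)).
Proof. exact: (gaussian_charfun (mY 0) (sY 0)). Qed.

Let itgM (f g : T -> R) : measurable_fun setT f -> measurable_fun setT g ->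
  itg (fun w => f w ^+ 2) -> itg (fun w => g w ^+ 2) -> itg (fun w => f w * g w).
Proof.
move=> mf mg f2 g2.
apply: (@itg_le _ _ _ _ _ (fun w => f w ^+ 2 + g w ^+ 2)).
- exact: measurable_funM.
- exact: itgD.
- move=> w; rewrite ler_norml; apply/andP.
  have := sqr_ge0 (f w + g w); have := sqr_ge0 (f w - g w).
  have := sqr_ge0 (f w); have := sqr_ge0 (g w); split; nra.
Qed.

Let lin2 c n : itg (fun w => lin c n w ^+ 2).
Proof. exact: (gaussianL2 (mY 0) (sY 0)). Qed.

Let Y2 k : itg (fun w => Y k w ^+ 2).
Proof. exact: gaussian_sqr_itg. Qed.

(** The covariance of [Y i] and [Y j], these being centered (see [corr_covariance]). *)
Definition corr i j : R := mean P (fun w => Y i w * Y j w).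

Let corrE c n k : mean P (fun w => lin c n w * Y k w) = \sum_(i < n) c i * corr k i.
Proof.
have i1 i : itg (fun w => Y k w * Y i w) by exact: itgM.
under eq_bigr do rewrite -meanZl//.
rewrite -mean_sum; last by move=> i; exact: itgZl.
apply: eq_mean => w; rewrite /lin mulr_suml; apply: eq_bigr => i _.
by rewrite -mulrA [Y k w * _]mulrC.
Qed.

(* The regression of [Y j] on [Y k], with [Y k] replaced by an independent copy. *)
Definition regress k j (y : R) (w : T) : R := Y j w - corr k j * Y k w + corr k j * y.

Let mregress k j : measurable_fun setT (fun z : T * T => regress k j (Y k z.1) z.2).
Proof.
apply: measurable_funD; first apply: measurable_funB.
- exact: measurableT_comp.
- by apply: measurable_funM => //; exact: measurableT_comp.
- by apply: measurable_funM => //; exact: measurableT_comp.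
Qed.

(** With [a = Cov (X, Y k)], the combination splits into [X - a * Y k], read on the second
    component, and [a * Y k], read on the first. On the product space the variances of the two add
    up to [E (X ^+ 2) - a ^+ 2 + a ^+ 2], that of [X], and the variance determines the cosine
    moments. *)
Let regress_charfun k c t :
  mean P (fun w => cos (lin c k.+1 w + t)) =
  mean (P \x P)%E (fun z => cos (\sum_(j < k.+1) c j * regress k j (Y k z.1) z.2 + t)).
Proof.
set X := lin c k.+1; pose a := mean P (fun w => X w * Y k w).
pose c' j := c j - (if j == k then a else 0).
have c'E w : lin c' k.+1 w = X w - a * Y k w.
  rewrite /lin /X /lin !big_ord_recr/= /c' eqxx mulrBl addrA; congr (_ + _ - _).
  by apply: eq_bigr => j _; rewrite (ltn_eqF (ltn_ord j)) subr0.
have sE z : \sum_(j < k.+1) c j * regress k j (Y k z.1) z.2 + t =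
    lin c' k.+1 z.2 + (a * Y k z.1 + t).
  rewrite c'E /X /lin /a corrE !mulr_suml -sumrB addrA; congr (_ + _).
  rewrite -big_split/=; apply: eq_bigr => j _; rewrite /regress; ring.
under [RHS]eq_mean do rewrite sE.
have mf : measurable_fun setT (fun z : T * T => lin c' k.+1 z.2 + (a * Y k z.1 + t)).
  apply: measurable_funD; first exact: measurableT_comp.
  by apply: measurable_funD => //; apply: measurable_funM => //; exact: measurableT_comp.
rewrite (mean_prod P P (bmf_cos mf)) /=.
under [RHS]eq_mean do rewrite lin_charfun.
set e := expR _.
have -> : mean P (fun w => cos (a * Y k w + t) * e) =
    e * mean P (fun w => cos (a * Y k w + t)).
  rewrite -meanZl; first by apply: eq_mean => w; rewrite mulrC.
  apply: bmf_integrable; apply: bmf_cos; apply: measurable_funD => //.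
  exact: measurable_funM.
rewrite (gaussian_cos (mY k) (sY k)) lin_charfun mulrCA; congr (_ * _).
rewrite /e -expRD; congr expR.
have -> : mean P (fun w => lin c' k.+1 w ^+ 2) = mean P (fun w => X w ^+ 2) - a ^+ 2.
  transitivity (mean P (fun w => X w ^+ 2 + (- (2 * a) * (X w * Y k w) + a ^+ 2 * Y k w ^+ 2))).
    by apply: eq_mean => w; rewrite c'E; ring.
  have i1 : itg (fun w => X w * Y k w) by apply: itgM => //; [exact: mlin|exact: lin2].
  rewrite (meanD (lin2 c k.+1) (itgD (itgZl _ i1) (itgZl _ (Y2 k)))).
  rewrite (meanD (itgZl _ i1) (itgZl _ (Y2 k))) !meanZl// -/a.
  by rewrite (gaussian_second_moment (mY k) (sY k)) -/X; ring.
by rewrite -/X; field.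
Qed.

Section one_step.
Variables (k : nat) (s : nat -> R) (u : R).

Definition cond_box (S : pred nat) (y : R) : R :=
  mean P (fun w => box S s (fun j => regress k j y) k w).

Let bbox S' : bounded_measurable
  (fun z : T * T => box S' s (fun j => regress k j (Y k z.1)) k z.2).
Proof.
apply: (@box_bmf _ _ _ S' s (fun j z => regress k j (Y k z.1) z.2) k).
exact: mregress.
Qed.

(* [cond_box S (Y k)] is the conditional probability of the box given [Y k]. *)
Lemma cond_boxE (b : bool) (S' : pred nat) :
  mean P (fun w => ind (b ==> (Y k w <= u)) * box S' s Y k w) =
  mean P (fun w => ind (b ==> (Y k w <= u)) * cond_box S' (Y k w)).
Proof.
(* The flag [b] serves both terms of a covariance: coordinate [k] is tested at level [u] when [b] is
   true, and left free otherwise. *)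
pose S1 j := if j == k then b else S' j; pose s1 j := if j == k then u else s j.
have boxE (T' : Type) (X : nat -> T' -> R) w : box S1 s1 X k.+1 w =
    ind (b ==> (X k w <= u)) * box S' s X k w.
  rewrite /box big_ord_recr/= /S1 /s1 eqxx mulrC; congr (_ * _).
  by apply: eq_bigr => j _; rewrite (ltn_eqF (ltn_ord j)).
have := @box_transfer R _ _ P _ _ (P \x P)%E Y (fun j z => regress k j (Y k z.1) z.2)
  mY (mregress k) S1 s1 k.+1 (fun=> 1) (fun=> 1) (@bmf_cst _ _ _ 1) (@bmf_cst _ _ _ 1).
have -> : mean P (fun w => 1 * box S1 s1 Y k.+1 w) =
    mean P (fun w => ind (b ==> (Y k w <= u)) * box S' s Y k w).
  by apply: eq_mean => w; rewrite mul1r boxE.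
move=> ->; last first.
  move=> c t; under eq_mean do rewrite mul1r.
  under [RHS]eq_mean do rewrite mul1r.
  exact: regress_charfun.
have rE z : regress k k (Y k z.1) z.2 = Y k z.1.
  have -> : regress k k (Y k z.1) z.2 = Y k z.2 - corr k k * Y k z.2 + corr k k * Y k z.1.
    by [].
  have -> : corr k k = 1.
    rewrite -(gaussian_second_moment (mY k) (sY k)); exact: eq_mean.
  by ring.
transitivity (mean (P \x P)%E (fun z => ind (b ==> (Y k z.1 <= u)) *
   box S' s (fun j => regress k j (Y k z.1)) k z.2)).
  by apply: eq_mean => z; rewrite mul1r boxE rE.
rewrite mean_prod; last first.
  apply: bmfM; last exact: bbox.
  by case: (b) => /=; [apply: bmf_le; exact: measurableT_comp|exact: bmf_cst].
apply: eq_mean => w /=; rewrite meanZl//.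
exact: bmf_integrable (section_bmf (bbox S') w).
Qed.

Let p := mean P (fun w => ind (Y k w <= u)).

Let bp : bounded_measurable (fun w => ind (Y k w <= u) - p).
Proof. by apply: bmfB; [exact: bmf_le|exact: bmf_cst]. Qed.

Let p01 : 0 <= p <= 1.
Proof.
apply/andP; split; first by apply: mean_ge0.
rewrite -[leRHS](mean_cst P); apply: le_mean.
- by apply: bmf_integrable; exact: bmf_le.
- by apply: bmf_integrable; exact: bmf_cst.
- by move=> w; rewrite lern1 leq_b1.
Qed.

Let bcond S' : bounded_measurable (fun w => cond_box S' (Y k w)).
Proof. exact: (@mean_section_bmf R _ _ P _ _ P _ (bbox S')). Qed.

(* The constant [cond_box S' u] is free to insert, as [ind (Y k <= u) - p] is
   centered; with it the covariance is bounded factor by factor. *)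
Lemma cov_boxE S' :
  mean P (fun w => ind (Y k w <= u) * box S' s Y k w) - p * mean P (box S' s Y k) =
  mean P (fun w => (ind (Y k w <= u) - p) * (cond_box S' (Y k w) - cond_box S' u)).
Proof.
have := cond_boxE true S'; under eq_mean do rewrite implyTb.
under [X in _ = X -> _]eq_mean do rewrite implyTb.
move=> ->.
have := cond_boxE false S'; under eq_mean do rewrite implyFb mul1r.
under [X in _ = X -> _]eq_mean do rewrite implyFb mul1r.
move=> ->.
have i1 : itg (fun w => ind (Y k w <= u) * cond_box S' (Y k w)).
  by apply: bmf_integrable; apply: bmfM; [exact: bmf_le|exact: bcond].
have i2 : itg (fun w => cond_box S' (Y k w)) by exact: bmf_integrable.
have i3 : itg (fun w => ind (Y k w <= u) - p) by exact: bmf_integrable.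
have -> : mean P (fun w => (ind (Y k w <= u) - p) * (cond_box S' (Y k w) - cond_box S' u)) =
  mean P (fun w => (ind (Y k w <= u) * cond_box S' (Y k w) -
    p * cond_box S' (Y k w)) - cond_box S' u * (ind (Y k w <= u) - p)).
  by apply: eq_mean => w; ring.
rewrite meanB; [|exact: (integrableB measurableT i1 (itgZl p i2))|exact: itgZl].
rewrite (meanB i1 (itgZl p i2)) !meanZl// meanB; last 2 first.
- by apply: bmf_integrable; exact: bmf_le.
- by apply: bmf_integrable; exact: bmf_cst.
by rewrite mean_cst -/p subrr mulr0 subr0.
Qed.

Let mregress1 j y : measurable_fun setT (regress k j y).
Proof.
apply: measurable_funD => //; apply: measurable_funB => //; exact: measurable_funM.
Qed.

Definition cond_le j (y : R) : R := mean P (fun w => ind (regress k j y w <= s j)).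

Lemma cond_le_bmf j : bounded_measurable (fun w => cond_le j (Y k w)).
Proof.
have b : bounded_measurable
    (fun z : T * T => ind (regress k j (Y k z.1) z.2 <= s j) : R) by exact: bmf_le.
exact: (@mean_section_bmf R _ _ P _ _ P _ b).
Qed.

(** [regress k j] is affine in [y] with slope [corr k j], the same for all [w]. The events at [y]
    and [z] are therefore nested, and the mean distance of their indicators is the distance of their
    probabilities. *)
Lemma cond_le_mono j y z : y <= z ->
  (if 0 <= corr k j then cond_le j z <= cond_le j y else cond_le j y <= cond_le j z) /\
  mean P (fun w => `|ind (regress k j z w <= s j) - ind (regress k j y w <= s j)|) =
  `|cond_le j z - cond_le j y|.
Proof.
move=> yz.
have b1 x : bounded_measurable (fun w => ind (regress k j x w <= s j) : R) by exact: bmf_le.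
have i1 x := bmf_integrable P (b1 x).
have main x1 x2 : (forall w, regress k j x1 w <= regress k j x2 w) ->
    cond_le j x2 <= cond_le j x1 /\
    mean P (fun w => `|ind (regress k j x1 w <= s j) - ind (regress k j x2 w <= s j)|) =
    `|cond_le j x1 - cond_le j x2|.
  move=> x12.
  have ind12 w : ind (regress k j x2 w <= s j) <= ind (regress k j x1 w <= s j) :> R.
    rewrite ler_nat; case: leP => // h; first by rewrite (le_trans (x12 w) h).
  have le12 : cond_le j x2 <= cond_le j x1 by exact: le_mean.
  split=> //; rewrite ger0_norm ?subr_ge0// /cond_le -meanB//.
  by apply: eq_mean => w; rewrite ger0_norm// subr_ge0.
have [r0|r0] := leP 0 (corr k j).
  have [|h1 h2] := main y z; first by move=> w; rewrite /regress lerD2l ler_wpM2l.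
  by split=> //; rewrite distrC -h2; apply: eq_mean => w; rewrite distrC.
by apply: main => w; rewrite /regress lerD2l ler_wnM2l// ltW.
Qed.

(** Union bound over the coordinates, followed by the exact distances of [cond_le_mono]. *)
Lemma cond_box_dist S' y z : `|cond_box S' z - cond_box S' y| <=
  \sum_(j < k | S' j) `|cond_le j z - cond_le j y|.
Proof.
wlog yz : y z / y <= z.
  move=> H; have [|/ltW zy] := leP y z; first exact: H.
  rewrite distrC (le_trans (H _ _ zy))//.
  by apply: ler_sum => j _; rewrite distrC.
have ib x : itg (box S' s (fun j => regress k j x) k).
  by apply: bmf_integrable; exact: box_bmf.
have b1 j x : bounded_measurable (fun w => ind (regress k j x w <= s j) : R) by exact: bmf_le.
have i1 (j : 'I_k) : itg (fun w => `|ind (regress k j z w <= s j) - ind (regress k j y w <= s j)|).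
  by apply: itg_norm; apply: bmf_integrable; apply: bmfB.
rewrite /cond_box -meanB//.
have iB : itg (fun w => box S' s (fun j => regress k j z) k w -
   box S' s (fun j => regress k j y) k w).
  exact: (integrableB measurableT (ib z) (ib y)).
apply: le_trans (norm_mean iB) _.
under eq_bigr do rewrite -(cond_le_mono _ yz).2.
rewrite -mean_sum//; apply: le_mean; [exact: itg_norm|exact: itg_sum|].
by move=> w; exact: (prod_ind_dist _ _ (fun j => regress k j z w <= s j)
  (fun j => regress k j y w <= s j)).
Qed.

Definition cov_le j : R :=
  mean P (fun w => ind (Y k w <= u) * ind (Y j w <= s j)) -
  mean P (fun w => ind (Y k w <= u)) * mean P (fun w => ind (Y j w <= s j)).

(* No loss in taking absolute values: [cond_le j] is monotone, so that the two
   factors of the covariance have a constant relative sign. *)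
Lemma cov_leE (j : 'I_k) : `|cov_le j| =
  mean P (fun w => `|ind (Y k w <= u) - p| * `|cond_le j (Y k w) - cond_le j u|).
Proof.
have box1 (X : nat -> T -> R) w : box (pred1 (j : nat)) s X k w = ind (X j w <= s j).
  rewrite /box (bigD1 j)//= eqxx/= big1 ?mulr1// => i ij.
  by rewrite (negbTE (ij : (i : nat) != j)).
have cbE y : cond_box (pred1 (j : nat)) y = cond_le j y.
  by apply: eq_mean => w; rewrite box1.
have -> : cov_le j = mean P (fun w => (ind (Y k w <= u) - p) *
    (cond_le j (Y k w) - cond_le j u)).
  rewrite /cov_le -/p; under [RHS]eq_mean do rewrite -!cbE.
  rewrite -cov_boxE; congr (_ - p * _); apply: eq_mean => w; by rewrite box1.
have /andP[p0 p1] := p01.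
have bc := cond_le_bmf j.
have ii : itg (fun w => (ind (Y k w <= u) - p) * (cond_le j (Y k w) - cond_le j u)).
  apply: bmf_integrable; apply: bmfM => //; apply: bmfB => //; exact: bmf_cst.
under [RHS]eq_mean do rewrite -normrM.
have [r0|r0] := leP 0 (corr k j).
- have sgn w : 0 <= (ind (Y k w <= u) - p) * (cond_le j (Y k w) - cond_le j u).
    have [Yu|/ltW Yu] := leP (Y k w) u.
      have [] := cond_le_mono j Yu; rewrite r0 => h _.
      by apply: mulr_ge0; rewrite subr_ge0.
    have [] := cond_le_mono j Yu; rewrite r0 => h _.
    by apply: mulr_le0; rewrite subr_le0.
  rewrite ger0_norm; last by apply: mean_ge0.
  by apply: eq_mean => w; rewrite ger0_norm.
- have sgn w : (ind (Y k w <= u) - p) * (cond_le j (Y k w) - cond_le j u) <= 0.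
    have [Yu|/ltW Yu] := leP (Y k w) u.
      have [] := cond_le_mono j Yu; rewrite leNgt r0/= => h _.
      by apply: mulr_ge0_le0; rewrite ?subr_ge0 ?subr_le0.
    have [] := cond_le_mono j Yu; rewrite leNgt r0/= => h _.
    by apply: mulr_le0_ge0; rewrite ?subr_ge0 ?subr_le0.
  rewrite ler0_norm; last first.
    rewrite -oppr_ge0 -mulN1r -meanZl//; apply: mean_ge0 => w.
    by rewrite mulN1r oppr_ge0.
  rewrite -mulN1r -meanZl//; apply: eq_mean => w.
  by rewrite ler0_norm// mulN1r.
Qed.

(** The distance of the conditional box probabilities splits over the coordinates inside the
    expectation, and [cov_leE] integrates each term back to a covariance, without constant. *)
Lemma cov_box_le S' :
  `|mean P (fun w => ind (Y k w <= u) * box S' s Y k w) - p * mean P (box S' s Y k)| <=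
  \sum_(j < k | S' j) `|cov_le j|.
Proof.
rewrite cov_boxE.
have bc : bounded_measurable (fun w => cond_box S' (Y k w) - cond_box S' u).
  by apply: bmfB => //; exact: bmf_cst.
have ii : itg (fun w => (ind (Y k w <= u) - p) * (cond_box S' (Y k w) - cond_box S' u)).
  by apply: bmf_integrable; exact: bmfM.
apply: le_trans (norm_mean ii) _; under eq_bigr do rewrite cov_leE.
have bj (j : 'I_k) : itg (fun w => `|ind (Y k w <= u) - p| * `|cond_le j (Y k w) - cond_le j u|).
  have b1 : bounded_measurable (fun w => (ind (Y k w <= u) - p) * (cond_le j (Y k w) - cond_le j u)).
    by apply: bmfM => //; apply: bmfB; [exact: cond_le_bmf|exact: bmf_cst].
  have := itg_norm (bmf_integrable P b1).
  by congr (P.-integrable _ (EFin \o _)); apply/funext => w; rewrite normrM.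
rewrite -mean_sum//; apply: le_mean; [exact: itg_norm|exact: itg_sum|].
move=> w; rewrite normrM -mulr_sumr; apply: ler_wpM2l => //.
exact: cond_box_dist.
Qed.

End one_step.

(** Detaching the last coordinate costs its covariances with the earlier ones; the error already
    made is multiplied by a probability, hence does not grow. *)
Theorem quasi_independence (S : pred nat) (s : nat -> R) n :
  `|mean P (box S s Y n) - \prod_(k < n | S k) mean P (fun w => ind (Y k w <= s k))| <=
  \sum_(k < n | S k) \sum_(j < k | S j) `|cov_le k s (s k) j|.
Proof.
elim: n => [|n IH].
  rewrite !big_ord0 (_ : mean P _ = 1) ?subrr ?normr0//.
  by rewrite -[RHS](mean_cst P); apply: eq_mean => w; rewrite /box big_ord0.
rewrite [X in `|_ - X|]big_mkcond [X in _ <= X]big_mkcond/= !big_ord_recr/= -!big_mkcond/=.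
have boxS : mean P (box S s Y n.+1) =
    mean P (fun w => ind (S n ==> (Y n w <= s n)) * box S s Y n w).
  by apply: eq_mean => w; rewrite /box big_ord_recr/= mulrC.
rewrite boxS; case: (S n) => /=; last first.
  by rewrite mulr1 addr0; under eq_mean do rewrite mul1r; exact: IH.
have := cov_box_le n s (s n) S; set p := mean P (fun w => ind (Y n w <= s n)).
have p01 : 0 <= p <= 1.
  apply/andP; split; first by apply: mean_ge0.
  rewrite -[leRHS](mean_cst P); apply: le_mean.
  - by apply: bmf_integrable; exact: bmf_le.
  - by apply: bmf_integrable; exact: bmf_cst.
  - by move=> w; rewrite lern1 leq_b1.
move=> H; set A := mean P _ in H *; set B := \prod_(_ < _ | _) _ in IH *.
have -> : A - B * p = (A - p * mean P (box S s Y n)) + p * (mean P (box S s Y n) - B).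
  by ring.
apply: le_trans (ler_normD _ _) _; rewrite addrC; apply: lerD => //.
case/andP: p01 => p0 p1; rewrite normrM (ger0_norm p0).
by apply: le_trans IH; rewrite ler_piMl.
Qed.

End quasi_independence.

(** * Mills' ratio and the thresholds *)

Section mills.
Context {R : realType}.
Local Notation mu := (@lebesgue_measure R).
Local Notation phi := (normal_pdf (0 : R) 1).

Lemma std_normal_pdfE (x : R) :
  phi x = (Num.sqrt (2 * pi))^-1 * expR (- (x ^+ 2 / 2)).
Proof.
rewrite normal_pdfE ?oner_eq0// /normal_peak /normal_fun expr1n mul1r subr0.
by rewrite -[pi *+ 2]mulr_natl mulNr.
Qed.

Lemma is_derive_std_normal_pdf (x : R) : is_derive x (1 : R) phi (- x * phi x).
Proof.
rewrite (_ : normal_pdf 0 1 = fun x => (Num.sqrt (2 * pi))^-1 * expR (- (x ^+ 2 / 2))); last first.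
  by apply/funext => y; rewrite std_normal_pdfE.
have dl : is_derive x 1 (fun x : R => - (x ^+ 2 / 2)) (- x).
  by apply: is_derive_eq; rewrite !scaler0 add0r /GRing.scale/=; field.
have h := (@is_derive1_comp _ expR (fun x => - (x ^+ 2 / 2)) x _ _ (is_derive_expR _) dl).
have [h3 h4] := is_deriveZ (Num.sqrt (2 * pi))^-1 h.
apply: DeriveDef; first exact: h3.
by rewrite [LHS]h4 /GRing.scale/=; ring.
Qed.

(** The exact derivative of [- phi x / x]. On [[u, +oo[] it lies between [phi] and
    [(1 + u^-2) * phi], so its integral [phi u / u] yields both Mills bounds. *)
Let dens (x : R) := phi x * (1 + x ^- 2).
Let prim (x : R) := - (phi x / x).

Let cphi : continuous phi.
Proof. by apply: continuous_normal_pdf; rewrite oner_eq0. Qed.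

Let phi0 x : 0 <= phi x. Proof. exact: normal_pdf_ge0. Qed.

Let is_derive_prim (x : R) : 0 < x -> is_derive x (1 : R) prim (dens x).
Proof.
move=> x0; have xN0 : x != 0 by rewrite gt_eqF.
have h := is_derive_std_normal_pdf x.
have hi : is_derive x 1 (fun y : R => y^-1) (- x ^- 2).
  apply: DeriveDef; first by apply: derivableV => //; exact: derivable_id.
  by rewrite deriveV// derive_id /GRing.scale/= mulr1.
have [h3 h4] := is_deriveN (is_deriveM h hi).
apply: DeriveDef; first exact: h3.
by rewrite [LHS]h4 /GRing.scale/= /dens; field.
Qed.

Let prim_cvg0 : prim x @[x --> +oo] --> (0 : R).
Proof.
rewrite -[X in _ --> X]oppr0; apply: cvgN.
have pk : 0 < normal_peak (1 : R) by apply: normal_peak_gt0; rewrite oner_eq0.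
apply/cvgrPdist_le => e e0; near=> x.
have x0 : 0 < x by near: x; exact: nbhs_pinfty_gt.
rewrite sub0r normrN ger0_norm; last by rewrite divr_ge0// ltW.
rewrite ler_pdivrMr//; apply: le_trans (normal_pdf_ub 0 x (oner_neq0 _)) _.
rewrite mulrC -ler_pdivrMr//; near: x; apply: nbhs_pinfty_ge; exact: num_real.
Unshelve. all: by end_near. Qed.

Let cdens (x : R) : 0 < x -> {for x, continuous dens}.
Proof.
move=> x0; apply: cvgM; first exact: cphi.
apply: cvgD; first exact: cvg_cst.
apply: cvgV; first by rewrite expf_neq0// gt_eqF.
exact: exprn_continuous.
Qed.

Let integral_dens (u : R) : 0 < u ->
  (\int[mu]_(x in `[u, +oo[) (dens x)%:E = (phi u / u)%:E)%E.
Proof.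
move=> u0; rewrite (@ge0_continuous_FTC2y _ dens prim u 0).
- by rewrite sub0e /prim -EFinN opprK.
- move=> x ux; have x0 : 0 < x by exact: lt_le_trans ux.
  by rewrite /dens mulr_ge0// addr_ge0// invr_ge0 sqr_ge0.
- apply: continuous_in_subspaceT => x; rewrite inE/= in_itv/= andbT => ux.
  by apply: cdens; exact: lt_le_trans ux.
- exact: prim_cvg0.
- by move=> x ux; have [] := is_derive_prim (lt_trans u0 ux).
- apply: cvg_at_right_filter; apply: cvgN; apply: cvgM; first exact: cphi.
  by apply: cvgV; [rewrite gt_eqF|exact: cvg_id].
- move=> x; rewrite in_itv/= andbT => ux.
  by rewrite derive1E; have [_ ->] := is_derive_prim (lt_trans u0 ux).
Qed.

Lemma mills_ratio d (T : measurableType d) (P : probability T R) (Y : T -> R) (u : R) :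
  measurable_fun setT Y -> standard_gaussian P Y -> 0 < u ->
  mean P (fun w => ind (u < Y w)) <= phi u / u <=
  (1 + u ^- 2) * mean P (fun w => ind (u < Y w)).
Proof.
move=> mY sY u0.
have mphi : measurable_fun [set: R] phi by exact: measurable_normal_pdf.
have mdens : measurable_fun `[u, +oo[%classic dens.
  apply: subspace_continuous_measurable_fun => //.
  apply: continuous_in_subspaceT => x; rewrite inE/= in_itv/= andbT => ux.
  by apply: cdens; exact: lt_le_trans ux.
have tailE : (mean P (fun w => ind (u < Y w)))%:E = (\int[mu]_(x in `[u, +oo[) (phi x)%:E)%E.
  rewrite -pr_mean; last by exact: measurable_fun_ltr.
  have -> : [set w | u < Y w] = Y @^-1` `]u, +oo[.
    by apply/seteqP; split=> w /=; rewrite in_itv/= andbT.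
  rewrite sY// /normal_prob integral_itv_obnd_cbnd//.
  by apply/measurable_EFinP; exact: measurable_funTS.
apply/andP; split; rewrite -lee_fin.
- rewrite tailE -integral_dens//; apply: ge0_le_integral => //.
  + by move=> x _; rewrite lee_fin.
  + by apply/measurable_EFinP; exact: measurable_funTS.
  + exact/measurable_EFinP.
  + by move=> x _; rewrite lee_fin /dens ler_peMr// lerDl invr_ge0 sqr_ge0.
- rewrite [X in (_ <= X)%E]EFinM tailE -integral_dens// -ge0_integralZl//; last 3 first.
  + by apply/measurable_EFinP; exact: measurable_funTS.
  + by move=> x _; rewrite lee_fin.
  + by rewrite lee_fin addr_ge0// invr_ge0 sqr_ge0.
  apply: ge0_le_integral => //.
  + by move=> x _; rewrite lee_fin /dens mulr_ge0// addr_ge0// invr_ge0 sqr_ge0.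
  + exact/measurable_EFinP.
  + by apply/measurable_EFinP; apply: measurable_funTS; exact: measurable_funM.
  + move=> x; rewrite /= in_itv/= andbT => ux; rewrite -EFinM lee_fin /dens mulrC.
    apply: ler_wpM2r => //; rewrite lerD2l lef_pV2 ?posrE ?exprn_gt0//.
      by rewrite ler_pXn2r ?nnegrE// ?ltW// (lt_le_trans u0).
    exact: lt_le_trans ux.
Qed.

End mills.

Section thresholds.
Context {R : realType}.
Implicit Types x : R.

Definition threshold (n : nat) (x : R) : R := (norm_a R n)^-1 * x + norm_b R n.

Lemma ln_nat_cvgy : ln n%:R @[n --> \oo] --> (+oo : set_system R).
Proof.
apply/cvgryPge => A; have := @cvgr_idn R; move/cvgryPge => /(_ (expR A)).
apply: filterS => n nA; rewrite -(expRK A) ler_ln ?posrE ?expR_gt0//.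
exact: lt_le_trans (expR_gt0 _) nA.
Qed.

Lemma cvg_inv0 (u : nat -> R) : u n @[n --> \oo] --> (+oo : set_system R) ->
  (u n)^-1 @[n --> \oo] --> (0 : R).
Proof.
move=> uy; have u0 : \forall n \near \oo, 0 < u n by move/cvgryPgt : uy; apply.
by apply/(gtr0_cvgV0 u0).
Qed.

Lemma sqrt_cvgy (u : nat -> R) : u n @[n --> \oo] --> (+oo : set_system R) ->
  Num.sqrt (u n) @[n --> \oo] --> (+oo : set_system R).
Proof.
move=> uy; apply/cvgryPge => A; move/cvgryPge : uy => /(_ (A ^+ 2)).
apply: filterS => n Au; have u0 := le_trans (sqr_ge0 A) Au.
by move: Au; rewrite -ler_sqrt// sqrtr_sqr; apply: le_trans; exact: ler_norm.
Qed.

Lemma norm_a_cvgy : norm_a R n @[n --> \oo] --> (+oo : set_system R).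
Proof.
apply: sqrt_cvgy; apply/cvgryPge => A; have := ln_nat_cvgy; move/cvgryPge => /(_ (A / 2)).
by apply: filterS => n; rewrite ler_pdivrMr// mulrC.
Qed.

Lemma norm_a_sqr n : (0 < n)%N -> norm_a R n ^+ 2 = 2 * ln n%:R.
Proof. by move=> n0; rewrite sqr_sqrtr// mulr_ge0// ln_ge0// ler1n. Qed.

(* The deviation [c_n] in [threshold n x = a_n + c_n / a_n]. *)
Let dev (n : nat) x : R := x - (ln (ln n%:R) + ln (4 * pi)) / 2.

Let thresholdE n x : threshold n x = norm_a R n + dev n x / norm_a R n.
Proof.
rewrite /threshold /norm_b /dev; set a := norm_a R n; rewrite invfM; ring.
Qed.

(** From [ln q <= q - 1] for the fourth root [q] of [L]. The fourth root is small enough: [norm_a]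
    has the order of the square root of [L = ln n], so [ln L / norm_a] tends to 0. *)
Let ln_le_sqrt (L : R) : 1 <= L -> 0 <= ln L <= 4 * Num.sqrt (Num.sqrt L).
Proof.
move=> L1; rewrite ln_ge0//=; set q := Num.sqrt _.
have L0 : 0 < L by exact: lt_le_trans L1.
have q0 : 0 < q by rewrite !sqrtr_gt0.
have -> : L = q ^+ 4.
  by rewrite -(sqr_sqrtr (ltW L0)) -(sqr_sqrtr (sqrtr_ge0 L)) -exprM.
rewrite lnXn// -[X in X <= _]mulr_natl ler_wpM2l//.
have := @le_ln1Dx R (q - 1); have -> : 1 + (q - 1) = q by ring.
by move=> h; apply: le_trans (h _) _; lra.
Qed.

Let dev_div_cvg0 x : dev n x / norm_a R n @[n --> \oo] --> (0 : R).
Proof.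
pose q n : R := Num.sqrt (Num.sqrt (ln n%:R)).
have qy : q n @[n --> \oo] --> (+oo : set_system R).
  by do 2 apply: sqrt_cvgy; exact: ln_nat_cvgy.
pose C : R := `|x| + `|ln (4 * pi)|.
have qi := cvg_inv0 qy.
have ub : 2 * (q n)^-1 + C * ((q n)^-1 * (q n)^-1) @[n --> \oo] --> (0 : R).
  have -> : nbhs (0 : R) = nbhs (2 * 0 + C * (0 * 0) : R) by rewrite !mulr0 addr0.
  apply: cvgD; apply: cvgM => //; try exact: cvg_cst.
  exact: cvgM.
apply/cvgr0Pnorm_lt => e e0.
have h1 : \forall n \near \oo, 2 * (q n)^-1 + C * ((q n)^-1 * (q n)^-1) < e.
  exact: (cvgr_lt (0 : R) ub).
have h2 : \forall n \near \oo, 1 <= ln n%:R :> R.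
  by have := ln_nat_cvgy; move/cvgryPge; apply.
near=> n.
have L1 : 1 <= ln n%:R :> R by near: n.
have ube : 2 * (q n)^-1 + C * ((q n)^-1 * (q n)^-1) < e by near: n.
apply: le_lt_trans ube.
have L0 : 0 < ln n%:R :> R by exact: lt_le_trans L1.
have q0 : 0 < q n by rewrite !sqrtr_gt0.
have q2 : q n ^+ 2 = Num.sqrt (ln n%:R) by rewrite sqr_sqrtr ?sqrtr_ge0.
have aq : q n ^+ 2 <= norm_a R n.
  by rewrite q2 ler_sqrt//; lra.
have a0 : 0 < norm_a R n by rewrite (lt_le_trans _ aq)// exprn_gt0.
rewrite normrM normfV (gtr0_norm a0) ler_pdivrMr//.
apply: (@le_trans _ _ ((2 * (q n)^-1 + C * ((q n)^-1 * (q n)^-1)) * q n ^+ 2)); last first.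
  have qi0 : 0 <= (q n)^-1 by rewrite invr_ge0 ltW.
  rewrite ler_wpM2l//; apply: addr_ge0; first exact: mulr_ge0.
  by apply: mulr_ge0; [exact: addr_ge0|exact: mulr_ge0].
have -> : (2 * (q n)^-1 + C * ((q n)^-1 * (q n)^-1)) * q n ^+ 2 = 2 * q n + C.
  by field; rewrite gt_eqF.
have /andP[l0 l1] := ln_le_sqrt L1; rewrite -/(q n) in l1.
rewrite /dev /C; apply: le_trans (ler_normB _ _) _.
have -> : 2 * q n + (`|x| + `|ln (4 * pi)|) = `|x| + (2 * q n + `|ln (4 * pi)|) by ring.
rewrite lerD2l normrM normfV [`|2|]ger0_norm// ler_pdivrMr//.
apply: le_trans (ler_normD _ _) _; rewrite (ger0_norm l0).
have := normr_ge0 (ln (4 * pi) : R); lra.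
Unshelve. all: by end_near. Qed.

Lemma threshold_ratio x : threshold n x / norm_a R n @[n --> \oo] --> (1 : R).
Proof.
have ai := cvg_inv0 norm_a_cvgy.
have h : 1 + dev n x / norm_a R n * (norm_a R n)^-1 @[n --> \oo] --> (1 : R).
  have -> : nbhs (1 : R) = nbhs (1 + 0 * 0 : R) by rewrite mulr0 addr0.
  apply: cvgD; first exact: cvg_cst.
  by apply: cvgM => //; exact: dev_div_cvg0.
apply: cvg_trans h; apply: near_eq_cvg.
have a0 : \forall n \near \oo, 0 < norm_a R n.
  by have := norm_a_cvgy; move/cvgryPgt; apply.
by apply: filterS a0 => n a0; rewrite /= thresholdE; field; rewrite gt_eqF.
Qed.

Lemma threshold_cvgy x : threshold n x @[n --> \oo] --> (+oo : set_system R).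
Proof.
have h := @threshold_ratio x.
apply/cvgryPge => A.
have a0 : \forall n \near \oo, Num.max 1 (2 * A) <= norm_a R n.
  by have := norm_a_cvgy; move/cvgryPge; apply.
have h2 : \forall n \near \oo, 2^-1 < threshold n x / norm_a R n.
  by apply: (cvgr_gt (1 : R) h); lra.
apply: filterS2 a0 h2 => n; rewrite ge_max => /andP[a1 a2].
have a0 : 0 < norm_a R n by exact: lt_le_trans a1.
by rewrite ltr_pdivlMr//; lra.
Qed.

(** This explains [norm_b]. In the square of [a + c / a], the term [a ^+ 2 / 2 = ln n] cancels the
    factor [n], the cross term gives [expR (- c) = expR (- x) * (a * sqrt (2 pi))], which cancels
    the constant of the density and, up to a ratio tending to 1, the division by the threshold; the
    term in [(c / a) ^+ 2] vanishes. *)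
Lemma density_threshold x : n%:R * (normal_pdf 0 1 (threshold n x) / threshold n x)
  @[n --> \oo] --> expR (- x).
Proof.
have h : expR (- x) * ((threshold n x / norm_a R n)^-1 *
    expR (- (dev n x / norm_a R n * (dev n x / norm_a R n) / 2))) @[n --> \oo] --> expR (- x).
  have -> : nbhs (expR (- x)) = nbhs (expR (- x) * (1^-1 * expR (- (0 * 0 / 2)))).
    by rewrite !mul0r oppr0 expR0 invr1 !mulr1.
  apply: cvgM; first exact: cvg_cst.
  apply: cvgM; first by apply: cvgV => //; exact: threshold_ratio.
  apply: continuous_cvg; first exact: continuous_expR.
  apply: cvgN; apply: cvgM; last exact: cvg_cst.
  by apply: cvgM; exact: dev_div_cvg0.
apply: cvg_trans h; apply: near_eq_cvg.
have L1 : \forall n \near \oo, 1 <= ln n%:R :> R.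
  by have := ln_nat_cvgy; move/cvgryPge; apply.
have T1 : \forall n \near \oo, 0 < threshold n x.
  by have := @threshold_cvgy x; move/cvgryPgt; apply.
apply: filterS2 L1 T1 => n L1 T1.
have L0 : 0 < ln n%:R :> R by exact: lt_le_trans L1.
have n0 : 0 < n%:R :> R.
  by rewrite ltr0n lt0n; apply: contraTneq L0 => ->; rewrite ln0// ltxx.
set a := norm_a R n; set t := threshold n x; set c := dev n x.
have a2 : a ^+ 2 = 2 * ln n%:R by apply: norm_a_sqr; rewrite -(ltr0n R).
have a0 : 0 < a by rewrite sqrtr_gt0 mulr_gt0.
have tE : t = a + c / a by exact: thresholdE.
have pi0 : 0 < pi :> R by exact: pi_gt0.
have s2 : 0 < Num.sqrt (2 * pi) :> R by rewrite sqrtr_gt0 mulr_gt0.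
have -> : normal_pdf 0 1 t = (Num.sqrt (2 * pi))^-1 *
    (expR (- ln n%:R) * (expR (- c) * expR (- (c / a * (c / a) / 2)))).
  rewrite std_normal_pdfE -!expRD; congr (_ * expR _).
  have -> : ln n%:R = a ^+ 2 / 2 by rewrite a2; field.
  by rewrite tE; field; rewrite gt_eqF.
have -> : expR (- ln n%:R) = n%:R^-1 :> R by rewrite expRN lnK ?posrE.
have -> : expR (- c) = expR (- x) * (a * Num.sqrt (2 * pi)).
  rewrite /c /dev opprB addrC expRD; congr (_ * _).
  rewrite -lnM ?posrE ?mulr_gt0//.
  have -> : a * Num.sqrt (2 * pi) = Num.sqrt (ln n%:R * (4 * pi)).
    rewrite /a /norm_a -sqrtrM; first by congr Num.sqrt; ring.
    by rewrite mulr_ge0// ltW.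
  set z := ln n%:R * (4 * pi); have z0 : 0 < z by rewrite !mulr_gt0.
  apply: (@pexpIrn _ 2); rewrite ?nnegrE ?expR_ge0 ?sqrtr_ge0//.
  rewrite sqr_sqrtr ?ltW// -expRM_natl mulrC divfK//; exact: lnK.
by field; rewrite !gt_eqF.
Qed.

Lemma tail_threshold d (T : measurableType d) (P : probability T R) (Y : T -> R) x :
  measurable_fun setT Y -> standard_gaussian P Y ->
  n%:R * mean P (fun w => ind (threshold n x < Y w)) @[n --> \oo] --> expR (- x).
Proof.
move=> mY sY; have h := @density_threshold x.
have ti := cvg_inv0 (@threshold_cvgy x).
have h2 : n%:R * (normal_pdf 0 1 (threshold n x) / threshold n x) *
    (1 + (threshold n x)^-1 * (threshold n x)^-1)^-1 @[n --> \oo] --> expR (- x).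
  have -> : nbhs (expR (- x)) = nbhs (expR (- x) * (1 + 0 * 0)^-1).
    by rewrite mulr0 addr0 invr1 mulr1.
  apply: cvgM => //; apply: cvgV; first by rewrite mulr0 addr0 oner_neq0.
  by apply: cvgD; [exact: cvg_cst|exact: cvgM].
apply: squeeze_cvgr h2 h.
have T1 : \forall n \near \oo, 0 < threshold n x.
  by have := @threshold_cvgy x; move/cvgryPgt; apply.
apply: filterS T1 => n t0; have /andP[m1 m2] := mills_ratio mY sY t0.
rewrite -mulrA !ler_wpM2l//= ler_pdivrMr; last first.
  by rewrite ltr_pwDl// mulr_ge0// invr_ge0 ltW.
by rewrite [leRHS]mulrC -invfM -expr2.
Qed.

End thresholds.

(** * Covariances of exceedances *)

(** Read on the law and not on a variable, so that the tails of all the [Y k] are syntactically the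
    same number. *)
Definition normal_tail (R : realType) (t : R) : R :=
  fine (normal_prob (0 : R) 1 `]t, +oo[%classic).

Section pair_bounds.
Context d (T : measurableType d) (R : realType) (P : probability T R).

Lemma mean_gt (X : T -> R) (t : R) : measurable_fun setT X -> standard_gaussian P X ->
  mean P (fun w => ind (t < X w)) = normal_tail t.
Proof.
move=> mX sX; rewrite /normal_tail -sX//.
have -> : X @^-1` `]t, +oo[%classic = [set w | t < X w].
  by apply/seteqP; split=> w /=; rewrite in_itv/= andbT.
by rewrite pr_mean//; exact: measurable_fun_ltr.
Qed.

Lemma mean_le (X : T -> R) (t : R) : measurable_fun setT X -> standard_gaussian P X ->
  mean P (fun w => ind (X w <= t)) = 1 - normal_tail t.
Proof.
move=> mX sX; rewrite -(mean_gt t mX sX) -{2}(mean_cst P 1) -meanB.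
- by apply: eq_mean => w; case: leP; rewrite ?subr0 ?subrr.
- by apply: bmf_integrable; exact: bmf_cst.
- by apply: bmf_integrable; exact: bmf_gt.
Qed.

Lemma normal_tail01 (X : T -> R) (t : R) : measurable_fun setT X -> standard_gaussian P X ->
  0 <= normal_tail t <= 1.
Proof.
move=> mX sX; rewrite -(mean_gt t mX sX) mean_ge0//= -[leRHS](mean_cst P).
apply: le_mean; [exact/bmf_integrable/bmf_gt|exact/bmf_integrable/bmf_cst|].
by move=> w; rewrite lern1 leq_b1.
Qed.

Lemma le_normal_tail (X : T -> R) (t t' : R) : measurable_fun setT X -> standard_gaussian P X ->
  t <= t' -> normal_tail t' <= normal_tail t.
Proof.
move=> mX sX tt'; rewrite -!(mean_gt _ mX sX); apply: le_mean.
- exact/bmf_integrable/bmf_gt.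
- exact/bmf_integrable/bmf_gt.
- by move=> w; rewrite ler_nat; case: ltP => // h; rewrite (le_lt_trans tt' h).
Qed.

Lemma normal_two_sided (X : T -> R) (t : R) : measurable_fun setT X ->
  standard_gaussian P X -> gaussian P X -> gaussian P (fun w => - X w) -> 0 <= t ->
  mean P (fun w => ind (t < `|X w|)) <= 2 * expR (- (t ^+ 2 / 2)).
Proof.
move=> mX sX gX gN t0.
have mN : measurable_fun setT (fun w => - X w) by exact: measurableT_comp.
have iX := gaussian_itg mX sX.
have X2 := gaussian_second_moment mX sX.
have := @gaussian_tail _ _ _ _ _ mX sX _ mX gX (gaussian_mean mX sX) 1 t.
have := @gaussian_tail _ _ _ _ _ mX sX _ mN gN _ 1 t.
rewrite mulr1 => h1 h2.
have {}h1 : mean P (fun w => ind (t < - X w)) <= expR (- (t ^+ 2 / 2)).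
  apply: h1 => //.
  - under eq_mean do rewrite -mulN1r.
    by rewrite meanZl// (gaussian_mean mX sX) mulr0.
  - by under eq_mean do rewrite sqrrN; rewrite X2.
have {}h2 : mean P (fun w => ind (t < X w)) <= expR (- (t ^+ 2 / 2)).
  by apply: h2; rewrite ?X2.
rewrite mulr_natl mulr2n; apply: le_trans _ (lerD h2 h1).
have i1 : P.-integrable setT (EFin \o (fun w => ind (t < X w))).
  exact/bmf_integrable/bmf_gt.
have i2 : P.-integrable setT (EFin \o (fun w => ind (t < - X w))).
  by apply/bmf_integrable; exact: (@bmf_gt _ _ _ (fun w => - X w)).
rewrite -meanD//; apply: le_mean => //.
- by apply/bmf_integrable; apply: (@bmf_gt _ _ _ (fun w => `|X w|)); exact: measurableT_comp.
- exact: itgD.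
- move=> w; rewrite -natrD ler_nat; case: (ltrP t `|X w|) => //.
  rewrite ltr_normr => /orP[] -> //; by rewrite addnC.
Qed.

Variable Y : nat -> T -> R.
Hypotheses (mY : forall n, measurable_fun setT (Y n))
  (gY : jointly_gaussian P Y) (sY : forall n, standard_gaussian P (Y n)).

Let bm_le k u : bounded_measurable (fun w => ind (Y k w <= u) : R).
Proof. exact: bmf_le. Qed.

Let bm_gt k u : bounded_measurable (fun w => ind (u < Y k w) : R).
Proof. exact: bmf_gt. Qed.

(** Complementing both events preserves the covariance; exceedances being rare, each term of this
    form is small by itself. *)
Lemma cov_leE_gt k j s u : cov_le P Y k s u j =
  mean P (fun w => ind (u < Y k w) * ind (s j < Y j w)) -
  normal_tail u * normal_tail (s j).
Proof.
rewrite /cov_le !mean_le//.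
have -> : mean P (fun w => ind (Y k w <= u) * ind (Y j w <= s j)) =
  mean P (fun w => (1 - ind (u < Y k w)) + (ind (u < Y k w) * ind (s j < Y j w) - ind (s j < Y j w))).
  by apply: eq_mean => w; case: (leP (Y k w) u); case: (leP (Y j w) (s j)) => _ _ /=; ring.
have i1 : P.-integrable setT (EFin \o (fun=> 1 : R)) by exact/bmf_integrable/bmf_cst.
have ig k' u' := bmf_integrable P (bm_gt k' u').
have igg : P.-integrable setT (EFin \o (fun w => ind (u < Y k w) * ind (s j < Y j w) : R)).
  by apply: bmf_integrable; exact: bmfM.
rewrite (meanD (integrableB measurableT i1 (ig k u)) (integrableB measurableT igg (ig j (s j)))).
rewrite (meanB i1 (ig _ _)) (meanB igg (ig _ _)) mean_cst !mean_gt//; ring.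
Qed.

(** No cancellation between the two terms is sought: at short lags the only information is that the
    correlation is bounded away from 1. The tail bound divides by the variance, so [V] is a positive
    upper bound of [2 + 2 * corr P Y k j], which may itself be 0. *)
Lemma cov_near k (j : 'I_k) (s : nat -> R) u (V t : R) : 0 <= t -> 2 * t <= u + s j ->
  0 < V -> 2 + 2 * corr P Y k j <= V ->
  `|cov_le P Y k s u j| <= expR (- (2 * t ^+ 2 / V)) + normal_tail u * normal_tail (s j).
Proof.
move=> t0 tuv V0 rV; rewrite cov_leE_gt.
have nt (u' : R) : 0 <= normal_tail u' by have /andP[] := normal_tail01 u' (mY 0) (sY 0).
apply: le_trans (ler_normB _ _) _; rewrite [`|_ * _|]ger0_norm; last first.
  by apply: mulr_ge0; exact: nt.
rewrite lerD2r ger0_norm; last by apply: mean_ge0 => w; rewrite mulr_ge0.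
pose c i : R := ind (i == j :> nat) + ind (i == k).
pose X w := Y j w + Y k w.
have XE : (fun w => \sum_(i < k.+1) c i * Y i w) = X.
  apply/funext => w; rewrite big_ord_recr/= /c eqxx [k == _]gtn_eqF ?ltn_ord// add0r mul1r.
  congr (_ + _); rewrite (bigD1 j)//= eqxx ltn_eqF ?ltn_ord// addr0 mul1r.
  rewrite big1 ?addr0// => i ij; rewrite (negbTE (ij : (i : nat) != j)).
  by rewrite ltn_eqF ?ltn_ord// addr0 mul0r.
have gX : gaussian P X by rewrite -XE; exact: (gY (fun i : 'I_k.+1 => c i)).
have mX : measurable_fun setT X by exact: measurable_funD.
have iY i : P.-integrable setT (EFin \o Y i) by exact: (gaussian_itg (mY i) (sY i)).
have X0 : mean P X = 0.
  by rewrite /X meanD// !(gaussian_mean (mY _) (sY _)) addr0.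
have X2 : mean P (fun w => X w ^+ 2) = 2 + 2 * corr P Y k j.
  have -> : mean P (fun w => X w ^+ 2) =
      mean P (fun w => Y j w ^+ 2 + (2 * (Y k w * Y j w) + Y k w ^+ 2)).
    by apply: eq_mean => w; rewrite /X; ring.
  have i2 i : P.-integrable setT (EFin \o (fun w => Y i w ^+ 2)).
    exact: (gaussian_sqr_itg (mY i) (sY i)).
  have i3 : P.-integrable setT (EFin \o (fun w => Y k w * Y j w)).
    apply: (@itg_le _ _ _ _ _ (fun w => Y k w ^+ 2 + Y j w ^+ 2)).
    - exact: measurable_funM.
    - exact: itgD.
    - move=> w; rewrite ler_norml; apply/andP.
      have := sqr_ge0 (Y k w + Y j w); have := sqr_ge0 (Y k w - Y j w).
      have := sqr_ge0 (Y k w); have := sqr_ge0 (Y j w); split; nra.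
  rewrite (meanD (i2 j) (itgD (itgZl 2 i3) (i2 k))) (meanD (itgZl 2 i3) (i2 k)).
  by rewrite meanZl// !(gaussian_second_moment (mY _) (sY _)) -/(corr P Y k j); ring.
have := @gaussian_tail _ _ _ _ _ (mY 0) (sY 0) _ mX gX X0 V (2 * t).
rewrite X2 => /(_ rV V0) h; apply: le_trans (le_trans _ (h _)) _.
- apply: le_mean.
  + by apply: bmf_integrable; exact: bmfM.
  + by apply: bmf_integrable; exact: bmf_gt.
  + move=> w; rewrite -natrM mulnb ler_nat.
    case: andP => // -[h1 h2]; rewrite (_ : _ < _)// /X; apply: le_lt_trans tuv _.
    by rewrite addrC ltrD.
- by rewrite mulr_ge0.
- by rewrite ler_expR lerN2 le_eqVlt; apply/orP; left; apply/eqP; field; rewrite gt_eqF.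
Qed.

(* Given [Y k], which exceeds [2 u] with negligible probability, the threshold
   of [Y j] is moved by at most [h]. *)
Lemma cov_far k (j : 'I_k) (s : nat -> R) (u h : R) : 0 <= u -> 4 * `|corr P Y k j| * u <= h ->
  `|cov_le P Y k s u j| <=
  2 * normal_tail u * (normal_tail (s j - h) - normal_tail (s j + h) +
     4 * expR (- (2 * u ^+ 2))) + 2 * expR (- (2 * u ^+ 2)).
Proof.
move=> u0 uh; rewrite cov_leE// mean_le// ; set q := normal_tail u; set r := corr P Y k j in uh *.
have /andP[q0 q1] : 0 <= q <= 1 by exact: (normal_tail01 u (mY k) (sY k)).
pose e0 := mean P (fun w => ind (2 * u < `|Y k w|)) : R.
have mN : measurable_fun setT (fun w => `|Y k w|) by exact: measurableT_comp.
have bN : bounded_measurable (fun w => ind (2 * u < `|Y k w|) : R) by exact: bmf_gt.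
have iN := bmf_integrable P bN.
have e0le : e0 <= 2 * expR (- (2 * u ^+ 2)).
  apply: le_trans (normal_two_sided (mY k) (sY k) _ _ _) _.
  - have -> : Y k = (fun w => \sum_(i < k.+1) ind (i == ord_max) * Y i w).
      apply/funext => w; rewrite (bigD1 ord_max)//= eqxx mul1r big1 ?addr0// => i /negbTE ->.
      by rewrite mul0r.
    exact: (gY (fun i : 'I_k.+1 => ind (i == ord_max))).
  - have -> : (fun w => - Y k w) = (fun w => \sum_(i < k.+1) - ind (i == ord_max) * Y i w).
      apply/funext => w; rewrite (bigD1 ord_max)//= eqxx mulN1r big1 ?addr0// => i /negbTE ->.
      by rewrite mulNr mul0r oppr0.
    exact: (gY (fun i : 'I_k.+1 => - ind (i == ord_max))).
  - by rewrite mulr_ge0.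
  - rewrite ler_wpM2l// ler_expR lerN2 le_eqVlt; apply/orP; left; apply/eqP.
    by field.
have e00 : 0 <= e0 by apply: mean_ge0.
have b1 y : bounded_measurable (fun w => ind (regress P Y k j y w <= s j) : R).
  apply: bmf_le; apply: measurable_funD => //; apply: measurable_funB => //.
  exact: measurable_funM.
have i1 y := bmf_integrable P (b1 y).
(* Origin of the constant 4: [y] and [Y k] are both at most [2 * u] in absolute value, except on an
   event of probability [e0] for [Y k], so that [r * (y - Y k)] is at most [4 * |r| * u]. *)
have bound y : `|y| <= 2 * u -> 1 - normal_tail (s j - h) - e0 <= cond_le P Y k s j y <=
    1 - normal_tail (s j + h) + e0.
  move=> y2; rewrite -!(mean_le _ (mY j) (sY j)).
  have key w : `|Y k w| <= 2 * u -> `|regress P Y k j y w - Y j w| <= h.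
    move=> yk; rewrite /regress -/r.
    have -> : Y j w - r * Y k w + r * y - Y j w = r * (y - Y k w) by ring.
    rewrite normrM; apply: le_trans uh; have -> : 4 * `|r| * u = `|r| * (4 * u) by ring.
    rewrite ler_wpM2l//.
    by apply: le_trans (ler_normB _ _) _; lra.
  apply/andP; split.
  - rewrite -meanB; [|exact/bmf_integrable/bm_le|exact: iN].
    apply: le_mean; [|exact: i1|].
      by apply: bmf_integrable; exact: bmfB.
    move=> w; have [yk|yk] := leP `|Y k w| (2 * u); last first.
      by rewrite lerBlDr -natrD ler_nat addn1; case: (Y j w <= _).
    have := key w yk; rewrite subr0 ler_nat ler_norml => /andP[k1 k2].
    by case: (leP (Y j w)) => //= h1; case: leP => // h2; lra.
  - rewrite -meanD; [|exact/bmf_integrable/bm_le|exact: iN].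
    apply: le_mean; [exact: i1| |].
      by apply: bmf_integrable; exact: bmfD.
    move=> w; have [yk|yk] := leP `|Y k w| (2 * u); last first.
      by rewrite -natrD ler_nat addn1; case: (regress _ _ _ _ _ _ <= _).
    have := key w yk; rewrite addr0 ler_nat ler_norml => /andP[k1 k2].
    by case: leP => //= h1; case: leP => // h2; lra.
set D := normal_tail (s j - h) - normal_tail (s j + h).
have D0 : 0 <= D.
  rewrite subr_ge0; apply: (le_normal_tail (mY 0) (sY 0)).
  have : 0 <= 4 * `|r| * u by rewrite !mulr_ge0.
  by lra.
have cl01 y : 0 <= cond_le P Y k s j y <= 1.
  rewrite mean_ge0//= -[leRHS](mean_cst P); apply: le_mean => //.
    exact/bmf_integrable/bmf_cst.
  by move=> w; rewrite lern1 leq_b1.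
have dist w : `|cond_le P Y k s j (Y k w) - cond_le P Y k s j u| <=
    D + 2 * e0 + ind (2 * u < `|Y k w|).
  have [yk|yk] := leP `|Y k w| (2 * u); last first.
    have /andP[? ?] := cl01 (Y k w); have /andP[? ?] := cl01 u.
    by rewrite ler_norml/=; lra.
  have /andP[c1 c2] := bound _ yk.
  have /andP[c3 c4] : 1 - normal_tail (s j - h) - e0 <= cond_le P Y k s j u <=
    1 - normal_tail (s j + h) + e0 by apply: bound; rewrite ger0_norm; lra.
  by rewrite addr0 ler_norml /D; lra.
have ind_abs w : `|ind (Y k w <= u) - (1 - q)| =
    q * ind (Y k w <= u) + (1 - q) * ind (u < Y k w) :> R.
  case: leP => _ /=; rewrite ?mulr0 ?mulr1 ?addr0 ?add0r.
    by rewrite opprB addrCA subrr addr0 ger0_norm.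
  by rewrite normrN ger0_norm// subr_ge0.
(* [A] is the distance of the indicator to its mean. Its expectation [2 * q * (1 - q)] is what
   supplies the factor [normal_tail u]. *)
pose A w : R := q * ind (Y k w <= u) + (1 - q) * ind (u < Y k w).
have A01 w : 0 <= A w <= 1 by rewrite /A; case: leP => _ /=; lra.
have bA : bounded_measurable A.
  by apply: bmfD; apply: bmfM => //; exact: bmf_cst.
have mA : mean P A = 2 * q * (1 - q).
  rewrite /A meanD; [|exact/itgZl/bmf_integrable|exact/itgZl/bmf_integrable].
  rewrite !meanZl; [|exact/bmf_integrable|exact/bmf_integrable].
  by rewrite mean_le// mean_gt// -/q; ring.
apply: (@le_trans _ _ (mean P (fun w => (D + 2 * e0) * A w + ind (2 * u < `|Y k w|)))).
  apply: le_mean.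
  - have b2 : bounded_measurable (fun w => (ind (Y k w <= u) - (1 - q)) *
        (cond_le P Y k s j (Y k w) - cond_le P Y k s j u)).
      apply: bmfM; first by apply: bmfB => //; exact: bmf_cst.
      by apply: bmfB; [exact: cond_le_bmf|exact: bmf_cst].
    have := itg_norm (bmf_integrable P b2).
    by congr (P.-integrable _ (EFin \o _)); apply/funext => w; rewrite normrM.
  - by apply: itgD => //; apply: itgZl; exact: bmf_integrable.
  - move=> w; rewrite ind_abs -/(A w); have /andP[A0 A1] := A01 w.
    apply: (@le_trans _ _ (A w * (D + 2 * e0 + ind (2 * u < `|Y k w|)))).
      by rewrite ler_wpM2l.
    rewrite mulrDr mulrC lerD2l ler_piMl//.
rewrite meanD//; last by apply: itgZl; exact: bmf_integrable.
rewrite meanZl ?mA; last exact: bmf_integrable.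
rewrite -/e0; apply: lerD => //.
apply: (@le_trans _ _ ((D + 2 * e0) * (2 * q))).
  rewrite ler_wpM2l; [nra| |]; nra.
by rewrite mulrC ler_wpM2l; lra.
Qed.

End pair_bounds.

(** * Correlations of the stationary sequence stay away from 1 *)

Section correlation.
Context d (T : measurableType d) (R : realType) (P : probability T R).
Variable Y : nat -> T -> R.
Hypotheses (mY : forall n, measurable_fun setT (Y n))
  (sY : forall n, standard_gaussian P (Y n)).
Variable rho : nat -> R.
Hypotheses (rhoE : forall k j, corr P Y k (k + j) = rho j)
  (rho_cvg0 : rho n @[n --> \oo] --> (0 : R)).

Let Y2 k : P.-integrable setT (EFin \o (fun w => Y k w ^+ 2)).
Proof. exact: (gaussian_sqr_itg (mY k) (sY k)). Qed.

Lemma corr_itg k j : P.-integrable setT (EFin \o (fun w => Y k w * Y j w)).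
Proof.
apply: (@itg_le _ _ _ _ _ (fun w => Y k w ^+ 2 + Y j w ^+ 2)).
- exact: measurable_funM.
- exact: itgD.
- move=> w; rewrite ler_norml; apply/andP.
  have := sqr_ge0 (Y k w + Y j w); have := sqr_ge0 (Y k w - Y j w).
  have := sqr_ge0 (Y k w); have := sqr_ge0 (Y j w); split; nra.
Qed.

Let dif2 k j w := (Y k w - Y j w) ^+ 2.

Let dif2E k j : dif2 k j = (fun w => Y k w ^+ 2 + (-2 * (Y k w * Y j w) + Y j w ^+ 2)).
Proof. by apply/funext => w; rewrite /dif2; ring. Qed.

Let dif2_itg k j : P.-integrable setT (EFin \o dif2 k j).
Proof. by rewrite dif2E; apply: itgD => //; apply: itgD => //; apply: itgZl; exact: corr_itg. Qed.

Let mean_dif2 k j : mean P (dif2 k j) = 2 - 2 * corr P Y k j.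
Proof.
rewrite dif2E (meanD (Y2 k) (itgD (itgZl _ (corr_itg k j)) (Y2 j))).
rewrite (meanD (itgZl _ (corr_itg k j)) (Y2 j)) (meanZl _ (corr_itg k j)).
by rewrite !(gaussian_second_moment (mY _) (sY _)) -/(corr P Y k j); ring.
Qed.

Lemma mean_sqrB k j : mean P (fun w => (Y k w - Y j w) ^+ 2) = 2 - 2 * corr P Y k j.
Proof. exact: mean_dif2. Qed.

Lemma rho_le1 l : rho l <= 1.
Proof.
have : 0 <= mean P (dif2 0 (0 + l)) by apply: mean_ge0 => w; exact: sqr_ge0.
by rewrite mean_dif2 rhoE; lra.
Qed.

(* If [rho l = 1] then [Y 0 = Y l = Y (2 l) = ...] almost surely, so that
   [rho] does not vanish at infinity. *)
Lemma rho_lt1 l : (0 < l)%N -> rho l < 1.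
Proof.
move=> l0; rewrite lt_neqAle rho_le1 andbT; apply/eqP => rl.
have main m : mean P (dif2 0 (m * l)) = 0.
  elim: m => [|m IH]; first by
    rewrite mul0n -[RHS](mean_cst P); apply: eq_mean => w; rewrite /dif2 subrr expr0n.
  have h : mean P (dif2 (m * l) (m * l + l)) = 0 by rewrite mean_dif2 rhoE rl; ring.
  apply/eqP; rewrite eq_le; apply/andP; split; last first.
    by apply: mean_ge0 => w; exact: sqr_ge0.
  apply: (@le_trans _ _ (mean P (fun w => 2 * dif2 0 (m * l) w + 2 * dif2 (m * l) (m * l + l) w))).
    apply: le_mean => //; first by apply: itgD; exact: itgZl.
    move=> w; rewrite /dif2 mulSn addnC.
    have := sqr_ge0 ((Y 0%N w - Y (m * l)%N w) - (Y (m * l)%N w - Y (m * l + l)%N w)); nra.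
  by rewrite meanD; [|exact: itgZl..]; rewrite !meanZl// IH h !mulr0 addr0.
have r1 m : rho (m * l) = 1.
  by have := main m; rewrite mean_dif2 -[(m * l)%N]add0n rhoE; lra.
have h2 : \forall n \near \oo, rho n < 2^-1 by apply: (cvgr_lt (0 : R) rho_cvg0); lra.
(* The multiple [N * l] is a lag beyond [N] at which [rho] would be both 1 and less than one
   half. *)
have [N _ HN] := h2.
have := HN (N * l)%N; rewrite /= r1 leq_pmulr// => /(_ isT); lra.
Qed.

(** Beyond some lag [rho] is below one half, and the finitely many smaller positive lags each give a
    value below 1. *)
Lemma rho_sup : exists2 D : R, 0 <= D < 1 & forall l, (0 < l)%N -> rho l <= D.
Proof.
have h2 : \forall n \near \oo, rho n < 2^-1 by apply: (cvgr_lt (0 : R) rho_cvg0); lra.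
have [N _ HN] := h2.
have [D D01 HD] : exists2 D : R, 0 <= D < 1 & forall l, (0 < l < N)%N -> rho l <= D.
  elim: (N) => [|M [D D01 IH]]; first by exists 0; [rewrite lexx ltr01|case].
  have [M0|M0] := posnP M; first by exists 0; [rewrite lexx ltr01|move=> l; rewrite M0; case: l].
  exists (Num.max D (rho M)).
    by rewrite le_max gt_max rho_lt1//; case/andP: D01 => -> ->.
  move=> l /andP[l0]; rewrite ltnS leq_eqVlt => /orP[/eqP ->|lM].
    by rewrite le_max lexx orbT.
  by rewrite le_max IH// l0.
exists (Num.max D 2^-1).
  by rewrite le_max gt_max; case/andP: D01 => -> -> /=; lra.
move=> l l0; rewrite le_max; have [lN|Nl] := ltnP l N; first by rewrite HD// l0.
by rewrite orbC ltW// HN.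
Qed.

End correlation.

Lemma count_lags (R : realType) (A : R) k : 0 <= A ->
  \sum_(j < k) ind ((k - j)%:R <= A) <= A :> R.
Proof.
move=> A0; rewrite (reindex_inj rev_ord_inj)/=.
have E : \sum_(j < k) ((((k - (k - j.+1))%N)%:R <= A)%R%:R : R) =
         \sum_(j < k) ((j.+1%:R <= A)%R%:R : R).
  by apply: eq_bigr => j _; rewrite subKn.
rewrite E.
(* The extra bound by [k] carries the induction: when the last index counts, the sum is at most
   [m + 1], which is at most [A]. *)
suff : \sum_(j < k) ((j.+1%:R <= A)%R%:R : R) <= Num.min A k%:R.
  by rewrite le_min => /andP[].
elim: (k) => [|m IH]; first by rewrite big_ord0 le_min A0 lexx.
rewrite big_ord_recr/=; move: IH; rewrite !le_min => /andP[h1 h2].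
have [h|h] := leP m.+1%:R A; last by rewrite addr0 h1 (le_trans h2)// ler_nat.
have {}h2 : \sum_(j < m) ((j.+1%:R <= A)%R%:R : R) + 1 <= m.+1%:R by rewrite -natr1 lerD2r.
by rewrite h2 (le_trans h2 h).
Qed.

(** * The sum of the covariances over all pairs below [n] *)

Section cov_sum.
Context d (T : measurableType d) (R : realType) (P : probability T R).
Variable Y : nat -> T -> R.
Hypotheses (mY : forall n, measurable_fun setT (Y n))
  (gY : jointly_gaussian P Y) (sY : forall n, standard_gaussian P (Y n)).
Variable rho : nat -> R.
Hypothesis rhoE : forall k j, corr P Y k (k + j) = rho j.

Let scaled_tail (n : nat) (z : R) : R := n%:R * normal_tail (threshold n z).

Lemma threshold_le n (x y : R) : x <= y -> threshold n x <= threshold n y.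
Proof. by move=> xy; rewrite lerD2r ler_wpM2l// invr_ge0 sqrtr_ge0. Qed.

(** [n ^ 2] times the bound of [cov_far] at [h = eta / a_n], the exponentials being replaced by
    [n ^ -3]. Moving a threshold by [eta / a_n] moves its argument by [eta], and each tail takes one
    factor [n], so that the limit is visible. Both [x] and [y] occur because [s j] may be either
    threshold. *)
Let far_bound (n : nat) (x y eta : R) : R :=
  2 * scaled_tail n (Num.min x y) *
    ((scaled_tail n (x - eta) - scaled_tail n (x + eta)) +
     (scaled_tail n (y - eta) - scaled_tail n (y + eta)) + 4 * (n%:R^-1 * n%:R^-1)) +
  2 * n%:R^-1.

(** [n * n^al] pairs, each contributing at most [n^-(1 + 2 al)] by Chernoff plus a product of two
    tails. *)
Let near_bound (n : nat) (x y al : R) : R :=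
  expR (- (al * ln n%:R)) +
  scaled_tail n (Num.min x y) * scaled_tail n (Num.min x y) *
    expR (- ((1 - al) * ln n%:R)).

Let corr_lag k (j : 'I_k) : corr P Y k j = rho (k - j).
Proof.
rewrite -(rhoE j) subnKC; last exact: ltnW.
by apply: eq_mean => w; rewrite mulrC.
Qed.

Lemma cov_sum_le n (x y D al eta : R) (S : pred nat) (s : nat -> R) :
  (0 < n)%N -> 0 < ln n%:R :> R ->
  0 <= D < 1 -> al = (1 - D) / 8 -> (forall l, (0 < l)%N -> rho l <= D) ->
  0 < threshold n (Num.min x y) ->
  (1 - al) * norm_a R n ^+ 2 <= threshold n (Num.min x y) ^+ 2 ->
  threshold n (Num.max x y) <= 2 * norm_a R n -> 0 < eta ->
  (forall l, expR (al * ln n%:R) < l%:R -> `|rho l| * ln n%:R <= eta / 16) ->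
  (forall k, s k = threshold n x \/ s k = threshold n y) ->
  \sum_(k < n | S k) \sum_(j < k | S j) `|cov_le P Y k s (s k) j| <=
  far_bound n x y eta + near_bound n x y al.
Proof.
move=> n0 L0 D01 alE rhoD t0 ta hia eta0 far sE.
set t := threshold n (Num.min x y) in t0 ta *; set a := norm_a R n in ta hia.
set L := ln n%:R in L0 far *.
have nR0 : 0 < n%:R :> R by rewrite ltr0n.
have nN0 : n%:R != 0 :> R by rewrite gt_eqF.
have a2 : a ^+ 2 = 2 * L by exact: norm_a_sqr.
have a0 : 0 < a by rewrite sqrtr_gt0 mulr_gt0.
have eL : expR L = n%:R by exact: lnK.
pose i : R := n%:R^-1; have i0 : 0 < i by rewrite invr_gt0.
have ni : n%:R * i = 1 by rewrite mulfV.
pose tau : R := normal_tail t.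
have nt z : 0 <= normal_tail z :> R by have /andP[] := normal_tail01 z (mY 0) (sY 0).
have tailW u v : u <= v -> normal_tail v <= normal_tail u :> R := le_normal_tail (mY 0) (sY 0).
have ts k : t <= s k.
  by have [] := sE k => ->; apply: threshold_le; rewrite ge_min lexx ?orbT.
have sa k : s k <= 2 * a.
  by apply: le_trans hia; have [] := sE k => ->; apply: threshold_le; rewrite le_max lexx ?orbT.
have tail_s k : normal_tail (s k) <= tau by exact: tailW.
have h0 : 0 <= eta / a by rewrite divr_ge0// ltW.
pose dz z : R := normal_tail (threshold n (z - eta)) - normal_tail (threshold n (z + eta)).
have dz0 z : 0 <= dz z.
  by rewrite subr_ge0; apply: tailW; apply: threshold_le; lra.
have diff k : normal_tail (s k - eta / a) - normal_tail (s k + eta / a) <= dz x + dz y.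
  have E z : threshold n z - eta / a = threshold n (z - eta) by rewrite /threshold -/a; ring.
  have E' z : threshold n z + eta / a = threshold n (z + eta) by rewrite /threshold -/a; ring.
  by have [] := sE k => ->; rewrite E E' -/(dz _) ?lerDl ?lerDr.
(* As [al <= 1/8], [s k ^ 2] is at least [(7/4) * L] and the exponent at least [3.5 * L]. The power
   3 is enough against [n ^ 2] pairs. *)
have exp_s k : expR (- (2 * s k ^+ 2)) <= i ^+ 3.
  have -> : i ^+ 3 = expR (- (3 * L)).
    by rewrite /i exprVn expRN expRM_natl eL.
  rewrite ler_expR lerN2.
  have st : 0 < s k by exact: lt_le_trans (ts k).
  have : t ^+ 2 <= s k ^+ 2 by rewrite ler_pXn2r ?nnegrE ?(ltW t0) ?(ltW st).
  by rewrite a2 in ta; case/andP: D01 => ? ?; rewrite alE in ta; nra.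
pose BF : R := 2 * tau * (dz x + dz y + 4 * i ^+ 3) + 2 * i ^+ 3.
pose BN : R := expR (- ((1 + 2 * al) * L)) + tau * tau.
have BF0 : 0 <= BF.
  have i3 : 0 <= i ^+ 3 by rewrite exprn_ge0// ltW.
  have tau0 : 0 <= tau by exact: nt.
  apply: addr_ge0; last exact: mulr_ge0.
  apply: mulr_ge0; first exact: mulr_ge0.
  by apply: addr_ge0; [exact: addr_ge0|exact: mulr_ge0].
have BN0 : 0 <= BN by apply: addr_ge0; [exact: expR_ge0|apply: mulr_ge0; exact: nt].
have pair k (j : 'I_k) : `|cov_le P Y k s (s k) j| <=
    BF + ind ((k - j)%:R <= expR (al * L)) * BN.
  have lag0 : (0 < k - j)%N by rewrite subn_gt0.
  have [near|/far lf] := leP ((k - j)%:R) (expR (al * L)).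
  - rewrite mul1r; apply: le_trans (_ : BN <= _); last by rewrite lerDr.
    have /andP[D0 D1] := D01.
    apply: le_trans (@cov_near _ _ _ _ _ mY gY sY k j s (s k) (2 + 2 * D) t _ _ _ _) _.
    + exact: ltW.
    + by have := ts k; have := ts j; lra.
    + by lra.
    + by rewrite corr_lag; have := rhoD _ lag0; lra.
    + apply: lerD; last by apply: ler_pM.
      rewrite ler_expR lerN2 ler_pdivlMr; last by lra.
      (* This is where [al = (1 - D) / 8] comes from: the Chernoff exponent [2 * t ^ 2 / V] must
         reach [(1 + 2 * al) * L] to beat the number of near pairs. The slack is
         [(1 - D) * (2 - D) / 2]. *)
      have key : (1 + 2 * al) * (2 + 2 * D) <= 4 * (1 - al) by rewrite alE; nra.
      apply: (@le_trans _ _ (4 * (1 - al) * L)); last by rewrite a2 in ta; lra.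
      by rewrite mulrAC ler_wpM2r// ltW.
  - rewrite mul0r addr0.
    apply: le_trans (@cov_far _ _ _ _ _ mY gY sY k j s (s k) (eta / a) _ _) _.
    + by rewrite ltW// (lt_le_trans t0).
    + rewrite corr_lag ler_pdivlMr//.
      apply: (@le_trans _ _ (4 * `|rho (k - j)| * (2 * a) * a)).
        by rewrite ler_pM2r// ler_wpM2l// mulr_ge0.
      (* Origin of [eta / 16]: the level is at most [2 * a], and [a ^ 2 = 2 * L]. *)
      have -> : 4 * `|rho (k - j)| * (2 * a) * a = 16 * (`|rho (k - j)| * L).
        by rewrite (_ : L = a ^+ 2 / 2); [field|rewrite a2; field].
      by rewrite mulrC -ler_pdivlMr.
    + have e0 := expR_ge0 (- (2 * s k ^+ 2)); have := exp_s k => es.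
      apply: lerD; last by rewrite ler_wpM2l.
      apply: ler_pM => //; first by rewrite mulr_ge0.
      * rewrite addr_ge0 ?mulr_ge0// subr_ge0; apply: tailW; lra.
      * by rewrite ler_wpM2l.
      * by apply: lerD => //; rewrite ler_wpM2l.
apply: (@le_trans _ _ (\sum_(k < n) (n%:R * BF + expR (al * L) * BN))).
  rewrite big_mkcond/=; apply: ler_sum => k _.
  have pos : 0 <= n%:R * BF + expR (al * L) * BN.
    by rewrite addr_ge0// mulr_ge0 ?expR_ge0.
  case: (S k) => //; apply: (@le_trans _ _ (\sum_(j < k)
     (BF + ind ((k - j)%:R <= expR (al * L)) * BN))).
    rewrite big_mkcond/=; apply: ler_sum => j _; case: (S j) => //.
    by rewrite addr_ge0// mulr_ge0.
  rewrite big_split/= sumr_const card_ord -mulr_suml -[BF *+ k]mulr_natl; apply: lerD.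
    by rewrite ler_wpM2r// ler_nat ltnW.
  by rewrite ler_wpM2r// count_lags// expR_ge0.
rewrite sumr_const card_ord -[leLHS]mulr_natl mulrDr; apply: lerD.
- rewrite le_eqVlt; apply/orP; left; apply/eqP.
  rewrite /BF /far_bound /scaled_tail -/t -/tau /dz -/i /i; field.
  by rewrite nN0.
- rewrite le_eqVlt; apply/orP; left; apply/eqP.
  rewrite /BN /near_bound /scaled_tail -/t -/tau.
  have -> : expR (- ((1 + 2 * al) * L)) = i * expR (- (al * L)) * expR (- (al * L)).
    by rewrite /i -eL -expRN -!expRD; congr expR; ring.
  have -> : expR (- ((1 - al) * L)) = i * expR (al * L).
    by rewrite /i -eL -expRN -!expRD; congr expR; ring.
  have : expR (al * L) * expR (- (al * L)) = 1 by rewrite -expRD subrr expR0.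
  move: (expR (al * L)) (expR (- (al * L))) => A B AB.
  transitivity ((n%:R * i) * (A * B) * B + n%:R * A * (tau * tau)); first by ring.
  transitivity (B + (n%:R * i) * n%:R * A * (tau * tau)); last by ring.
  by rewrite ni AB; ring.
Qed.

Hypothesis rho_ln : rho n * ln n%:R @[n --> \oo] --> (0 : R).

Let ln_large (A : R) : \forall n \near \oo, A <= ln n%:R.
Proof. by have := @ln_nat_cvgy R; move/cvgryPge; apply. Qed.

Lemma rho_cvg0 : rho n @[n --> \oo] --> (0 : R).
Proof.
apply/cvgr0Pnorm_lt => e e0.
have h : \forall n \near \oo, `|rho n * ln n%:R| < e.
  by move/cvgr0Pnorm_lt : rho_ln; apply.
apply: filterS2 (ln_large 1) h => n L1; apply: le_lt_trans.
by rewrite normrM ler_peMr// (le_trans L1)// ler_norm.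
Qed.

Let scaled_tail_cvg z : scaled_tail n z @[n --> \oo] --> expR (- z).
Proof.
have := @tail_threshold R _ _ P (Y 0) z (mY 0) (sY 0).
rewrite (_ : (fun n => _) = (fun n => scaled_tail n z))//.
by apply/funext => n; rewrite mean_gt.
Qed.

Let inv_cvg0 : (n%:R^-1 : R) @[n --> \oo] --> (0 : R).
Proof. by apply: cvg_inv0; exact: cvgr_idn. Qed.

Let exp_cvg0 (b : R) : 0 < b -> expR (- (b * ln n%:R)) @[n --> \oo] --> (0 : R).
Proof.
move=> b0; apply/cvgr0Pnorm_lt => e e0.
apply: filterS (ln_large ((1 - ln e) / b)) => n Ln.
rewrite ger0_norm ?expR_ge0// -[ltRHS](lnK (x := e)) ?posrE// ltr_expR.
by move: Ln; rewrite ler_pdivrMr// mulrC; lra.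
Qed.

Let near_bound_cvg0 x y al : 0 < al < 1 -> near_bound n x y al @[n --> \oo] --> (0 : R).
Proof.
move=> /andP[al0 al1]; set m := Num.min x y.
have -> : nbhs (0 : R) = nbhs (0 + expR (- m) * expR (- m) * 0 : R) by rewrite mulr0 addr0.
apply: cvgD; first exact: exp_cvg0.
apply: cvgM; last by apply: exp_cvg0; lra.
by apply: cvgM; exact: scaled_tail_cvg.
Qed.

(** The limit in [n] is taken at fixed [eta]; it is a multiple of the increments of
    [z -> expR (- z)] over windows of radius [eta], made small by choosing [eta] among the
    [harmonic N]. *)
Let far_bound_small x y e : 0 < e -> exists2 eta : R, 0 < eta &
  \forall n \near \oo, far_bound n x y eta < e.
Proof.
move=> e0; set m := Num.min x y.
pose lim eta : R := 2 * expR (- m) * ((expR (- (x - eta)) - expR (- (x + eta))) +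
     (expR (- (y - eta)) - expR (- (y + eta))) + 4 * (0 * 0)) + 2 * 0.
have lim_cvg eta : far_bound n x y eta @[n --> \oo] --> lim eta.
  apply: cvgD; last by apply: cvgM; [exact: cvg_cst|exact: inv_cvg0].
  apply: cvgM; first by apply: cvgM; [exact: cvg_cst|exact: scaled_tail_cvg].
  apply: cvgD; last first.
    by apply: cvgM; [exact: cvg_cst|apply: cvgM; exact: inv_cvg0].
  by apply: cvgD; apply: cvgB; exact: scaled_tail_cvg.
have lim0 : lim (harmonic n) @[n --> \oo] --> (0 : R).
  have h : (@harmonic R) n @[n --> \oo] --> (0 : R) by exact: cvg_harmonic.
  have hexp (z : R) : expR (- (z - harmonic n)) - expR (- (z + harmonic n))
      @[n --> \oo] --> (0 : R).
    have -> : nbhs (0 : R) = nbhs (expR (- (z - 0)) - expR (- (z + 0)) : R).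
      by rewrite subr0 addr0 subrr.
    apply: cvgB; apply: continuous_cvg; try exact: continuous_expR.
      by apply: cvgN; apply: cvgB => //; exact: cvg_cst.
    by apply: cvgN; apply: cvgD => //; exact: cvg_cst.
  have -> : nbhs (0 : R) = nbhs (2 * expR (- m) * (0 + 0 + 4 * (0 * 0)) + 2 * 0 : R).
    by rewrite !mulr0 !addr0 mulr0.
  apply: cvgD; last exact: cvg_cst.
  apply: cvgM; first exact: cvg_cst.
  apply: cvgD; last exact: cvg_cst.
  by apply: cvgD; exact: hexp.
have [N _ HN] : \forall n \near \oo, lim (harmonic n) < e by exact: (cvgr_lt (0 : R) lim0).
exists (harmonic N); first by rewrite invr_gt0 ltr0n.
by apply: (cvgr_lt _ (lim_cvg (harmonic N))); exact: (HN N (leqnn N)).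
Qed.

(** One rank [n] must serve all [S] and [s] at once: the bound is used for each of the [2 ^ n]
    patterns, and both depend on the pattern. *)
Theorem cov_sum_small (x y e : R) : 0 < e ->
  \forall n \near \oo, forall (S : pred nat) (s : nat -> R),
  (forall k, s k = threshold n x \/ s k = threshold n y) ->
  \sum_(k < n | S k) \sum_(j < k | S j) `|cov_le P Y k s (s k) j| <= e.
Proof.
move=> e0; have [D D01 rhoD] := rho_sup mY sY rhoE rho_cvg0.
pose al : R := (1 - D) / 8; have al01 : 0 < al < 1 by rewrite /al; lra.
have al0 : 0 < al by case/andP: al01.
have e2 : 0 < e / 2 by rewrite divr_gt0.
have [eta eta0 hfar] := far_bound_small x y e2.
have hnear : \forall n \near \oo, near_bound n x y al < e / 2.
  exact: (cvgr_lt (0 : R) (near_bound_cvg0 x y al01)).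
have h1 : \forall n \near \oo, 0 < threshold n (Num.min x y).
  by have := threshold_cvgy (Num.min x y); move/cvgryPgt; apply.
have h2 : \forall n \near \oo, (1 - al) <
    threshold n (Num.min x y) / norm_a R n * (threshold n (Num.min x y) / norm_a R n).
  have h : threshold n (Num.min x y) / norm_a R n * (threshold n (Num.min x y) / norm_a R n)
      @[n --> \oo] --> (1 * 1 : R).
    by apply: cvgM; exact: threshold_ratio.
  by apply: (cvgr_gt _ h); lra.
have h3 : \forall n \near \oo, threshold n (Num.max x y) / norm_a R n < 2.
  by apply: (cvgr_lt _ (threshold_ratio (Num.max x y))); lra.
(* The factor [al] compensates [ln l >= al * ln n] for lags beyond [n^al]: the hypothesis on [rho]
   is at scale [ln l], the bound needed at scale [ln n]. *)
have h4 : \forall n \near \oo, `|rho n * ln n%:R| < al * eta / 16.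
  by move/cvgr0Pnorm_lt : rho_ln; apply; rewrite divr_gt0// mulr_gt0.
have [N0 _ HN0] := h4.
have h5 : \forall n \near \oo, N0%:R <= expR (al * ln n%:R).
  apply: filterS (ln_large (N0%:R / al)) => n; rewrite ler_pdivrMr// mulrC => h.
  by apply: le_trans h _; apply: le_trans (expR_ge1Dx _); lra.
near=> n => S s sE.
have L1 : 1 <= ln n%:R :> R by near: n; exact: ln_large.
have L0 : 0 < ln n%:R :> R by exact: lt_le_trans L1.
have n0 : (0 < n)%N.
  by rewrite lt0n; apply: contraTneq L0 => ->; rewrite ln0// ltxx.
have a0 : 0 < norm_a R n by rewrite sqrtr_gt0 mulr_gt0.
have aN0 : norm_a R n != 0 by rewrite gt_eqF.
apply: le_trans (@cov_sum_le n x y D al eta S s n0 L0 D01 erefl rhoD _ _ _ eta0 _ sE) _.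
- by near: n.
- have : 1 - al < threshold n (Num.min x y) / norm_a R n * (threshold n (Num.min x y) / norm_a R n).
    by near: n.
  have -> : threshold n (Num.min x y) / norm_a R n * (threshold n (Num.min x y) / norm_a R n) =
    threshold n (Num.min x y) ^+ 2 / norm_a R n ^+ 2 by field.
  by rewrite ltr_pdivlMr ?exprn_gt0// => /ltW.
- rewrite -ler_pdivrMr// ltW//; near: n; exact: h3.
- move=> l ll; have Nl : (N0 <= l)%N.
    rewrite -(ler_nat R) (le_trans _ (ltW ll))//; near: n; exact: h5.
  have := HN0 l Nl; rewrite /= normrM => hl.
  have Ll : al * ln n%:R <= ln l%:R.
    rewrite -[leLHS]expRK ler_ln ?posrE ?expR_gt0//; first exact: ltW.
    exact: lt_trans (expR_gt0 _) ll.
  have {}Ll : al * ln n%:R <= `|ln l%:R| by rewrite (le_trans Ll)// ler_norm.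
  have : `|rho l| * (al * ln n%:R) <= al * eta / 16.
    by rewrite (le_trans _ (ltW hl))// ler_wpM2l.
  by rewrite mulrCA -mulrA ler_pM2l.
- have : far_bound n x y eta < e / 2 by near: n.
  have : near_bound n x y al < e / 2 by near: n.
  by lra.
Unshelve. all: by end_near. Qed.

End cov_sum.

(** * Independence of the patterns and of the two sequences *)

(* [T] with the sigma-algebra [sigma_gen X], so that membership in [sigma_gen X]
   is proved as measurability of a function on [gen_type]. *)
Section generated.
Context (T : pointedType) d' (T' : measurableType d') (X : nat -> T -> T').

Definition gen_type :=
  g_sigma_algebraType (\bigcup_n preimage_set_system setT (X n) measurable).

Lemma gen_type_measurable (n : nat) : measurable_fun [set: gen_type] (X n : gen_type -> T').
Proof.
move=> _ B mB; rewrite setTI; apply: sub_sigma_algebra; exists n => //.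
by exists B => //; rewrite setTI.
Qed.

End generated.

(** The boolean form of [box], whose truth set can be placed in a generated sigma-algebra. *)
Definition boxb (T : Type) (R : realType) (S : pred nat) (s : nat -> R)
    (X : nat -> T -> R) (n : nat) (w : T) : bool :=
  [forall j : 'I_n, S j ==> (X j w <= s j)].

Definition patb (T : Type) (eps : nat -> T -> bool) (n : nat)
    (e : {ffun 'I_n -> bool}) (w : T) : bool :=
  [forall j : 'I_n, eps j w == e j].

Lemma measurable_forall d (T : measurableType d) n (a : 'I_n -> T -> bool) :
  (forall i, measurable_fun setT (a i)) ->
  measurable_fun setT (fun w => [forall i, a i w]).
Proof.
move=> ma.
have -> : (fun w => [forall i, a i w]) = (fun w => \big[andb/true]_(i < n) a i w).
  by apply/funext => w; rewrite big_andE.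
elim: n a ma => [|n IH] a ma.
  by under eq_fun do rewrite big_ord0; exact: measurable_cst.
under eq_fun do rewrite big_ord_recl.
by apply: measurable_and => //; exact: IH.
Qed.

Lemma boxE (T : Type) (R : realType) (S : pred nat) (s : nat -> R)
    (X : nat -> T -> R) (n : nat) (w : T) : box S s X n w = ind (boxb S s X n w).
Proof.
rewrite /boxb -big_andE big_mkcond/= /box; elim: n => [|n IH]; first by rewrite !big_ord0.
by rewrite !big_ord_recr/= IH -natrM mulnb; case: (S n).
Qed.

Lemma measurable_boxb d (T : measurableType d) (R : realType) (S : pred nat) (s : nat -> R)
    (X : nat -> T -> R) (n : nat) : (forall j, measurable_fun setT (X j)) ->
  measurable_fun setT (boxb S s X n).
Proof.
move=> mX; apply: measurable_forall => i; case: (S i) => //=.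
exact: measurable_fun_ler.
Qed.

Lemma measurable_patb d (T : measurableType d) (eps : nat -> T -> bool) (n : nat)
    (e : {ffun 'I_n -> bool}) : (forall j, measurable_fun setT (eps j)) ->
  measurable_fun setT (patb eps e).
Proof.
move=> me; apply: measurable_forall => i; case: (e i).
  by under eq_fun do rewrite eqb_id; exact: me.
under eq_fun do rewrite eqbF_neg.
by apply: measurableT_comp => //; exact: me.
Qed.

Lemma measurable_bool_set d (T : measurableType d) (b : T -> bool) :
  measurable_fun setT b -> measurable [set w | b w].
Proof.
by move=> mb; rewrite -[X in measurable X]setTI; exact: (mb measurableT [set true]).
Qed.

Section independence.
Context d (T : measurableType d) (R : realType) (P : probability T R).
Variables (Y Yhat : nat -> {RV P >-> R}) (eps : nat -> {RV P >-> bool}).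
Hypotheses (Y_standard : forall n, standard_gaussian P (Y n)) (Y_stationary : stationary P Y)
  (eps_Y_indep : indep_sigma P (sigma_gen eps) (sigma_gen Y))
  (Yhat_copy : same_law P Yhat Y)
  (Yhat_indep : indep_sigma P (sigma_gen Yhat) <<s sigma_gen Y `|` sigma_gen eps >>).

Let mYn n : measurable_fun setT (Y n). Proof. exact: measurable_funPT. Qed.

(** Equality of laws passes directly to nonnegative functions, so it is used on the square of
    [Y k - Y (k + j)]; [mean_sqrB] recovers the correlation from it. *)
Lemma stationary_corr k j : corr P Y k (k + j) = corr P Y 0 (0 + j).
Proof.
pose f (u : nat -> R) := u 0%N - u j; pose c n (u : nat -> R) := u n.
(* [gen_type c] is the path space with the sigma-algebra of its coordinates, on which [f] is
   measurable. *)
have law (B : set R) : measurable B ->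
    P ((fun w => Y k w - Y (k + j)%N w) @^-1` B) = P ((fun w => Y 0%N w - Y j w) @^-1` B).
  move=> mB; have mf : measurable_fun [set: @gen_type (nat -> R) _ R c] f.
    by apply: measurable_funB; exact: (@gen_type_measurable (nat -> R) _ R c).
  have := @Y_stationary k (f @^-1` B).
  rewrite /f/=; under [in X in (_ -> X) -> _]eq_set do rewrite addn0.
  by apply; have := mf measurableT B mB; rewrite setTI.
have mf k' j' : measurable_fun setT (fun w => Y k' w - Y j' w) by exact: measurable_funB.
have : mean P (fun w => (Y k w - Y (k + j)%N w) ^+ 2) = mean P (fun w => (Y 0%N w - Y j w) ^+ 2).
  have msq : measurable_fun [set: R] (fun x : R => (x ^+ 2)%:E).
    by apply/measurable_EFinP; exact: measurable_funX.
  have sq0 (x : R) : (0 <= (x ^+ 2)%:E)%E by rewrite lee_fin sqr_ge0.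
  pose nu := distribution P (Y 0%N \- Y j).
  rewrite /mean /Rintegral; congr fine.
  rewrite (@ge0_integral_law _ _ _ P _ _ _ nu (fun x => (x ^+ 2)%:E) (mf k (k + j)%N))//.
  by rewrite (@ge0_integral_law _ _ _ P _ _ _ nu (fun x => (x ^+ 2)%:E) (mf 0%N j))//.
have ms := @mean_sqrB _ _ _ P (fun n => Y n) mYn Y_standard.
by rewrite (ms k (k + j)%N) (ms 0%N j) add0n; lra.
Qed.

Lemma copy_box (S : pred nat) (s : nat -> R) n :
  mean P (box S s Yhat n) = mean P (box S s Y n).
Proof.
pose c n (u : nat -> R) := u n; pose f (u : nat -> R) := boxb S s c n u.
have mf : measurable_fun [set: @gen_type (nat -> R) _ R c] f.
  by apply: measurable_boxb => j; exact: (@gen_type_measurable (nat -> R) _ R c).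
have := Yhat_copy (measurable_bool_set mf).
rewrite /f/= [X in P X = _ -> _](_ : _ = [set w | boxb S s Yhat n w])//.
rewrite [X in _ = P X -> _](_ : _ = [set w | boxb S s Y n w])//.
rewrite !pr_mean => [[]||]; [|exact: measurable_boxb|exact: measurable_boxb].
by rewrite -!(eq_mean _ (fun w => boxE S s _ n w)).
Qed.

Lemma indep_mean n (e : {ffun 'I_n -> bool}) S s S' s' :
  mean P (fun w => ind (patb eps e w) * (box S s Y n w * box S' s' Yhat n w)) =
  mean P (fun w => ind (patb eps e w)) * (mean P (box S s Y n) * mean P (box S' s' Yhat n)).
Proof.
have mY' : measurable_fun setT (boxb S s Y n) by exact: measurable_boxb.
have mh : measurable_fun setT (boxb S' s' Yhat n).
  by apply: measurable_boxb => j; exact: measurable_funPT.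
have me : measurable_fun setT (patb eps e).
  by apply: measurable_patb => j; exact: measurable_funPT.
have gY : sigma_gen Y [set w | boxb S s Y n w].
  apply: (@measurable_bool_set _ (gen_type Y)).
  by apply: (@measurable_boxb _ (gen_type Y)) => j; exact: gen_type_measurable.
have gh : sigma_gen Yhat [set w | boxb S' s' Yhat n w].
  apply: (@measurable_bool_set _ (gen_type Yhat)).
  by apply: (@measurable_boxb _ (gen_type Yhat)) => j; exact: gen_type_measurable.
have ge : sigma_gen eps [set w | patb eps e w].
  apply: (@measurable_bool_set _ (gen_type eps)).
  by apply: (@measurable_patb _ (gen_type eps)) => j; exact: gen_type_measurable.
have gYe : <<s sigma_gen Y `|` sigma_gen eps >>
    ([set w | patb eps e w] `&` [set w | boxb S s Y n w]).
  apply: (@measurableI _ (g_sigma_algebraType (sigma_gen Y `|` sigma_gen eps))).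
    by apply: sub_sigma_algebra; right.
  by apply: sub_sigma_algebra; left.
have h1 := Yhat_indep gh gYe; rewrite (eps_Y_indep ge gY) in h1.
have mbool (b1 b2 : T -> bool) : measurable_fun setT b1 -> measurable_fun setT b2 ->
  measurable_fun setT (fun w => b1 w && b2 w) by move=> ? ?; exact: measurable_and.
have E : [set w | boxb S' s' Yhat n w] `&` ([set w | patb eps e w] `&` [set w | boxb S s Y n w]) =
    [set w | boxb S' s' Yhat n w && (patb eps e w && boxb S s Y n w)].
  by apply/seteqP; split => w /= => [[-> [-> ->]]|/andP[-> /andP[-> ->]]].
rewrite E !pr_mean// in h1; last first.
  by apply: (mbool) => //; exact: mbool.
move: h1; rewrite -!EFinM => -[h1].
transitivity (mean P (fun w => ind (boxb S' s' Yhat n w && (patb eps e w && boxb S s Y n w)) : R)).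
  by apply: eq_mean => w; rewrite !boxE -!mulnb !natrM; ring.
rewrite h1 -(eq_mean P (fun w => boxE S s Y n w)) -(eq_mean P (fun w => boxE S' s' Yhat n w)).
ring.
Qed.

End independence.

(** * Thinned maxima *)

Section poisson_limit.
Context {R : realType}.
Implicit Types (t a b : R) (n N : nat).

Lemma dist_expRN a b : 0 <= a -> 0 <= b -> `|expR (- a) - expR (- b)| <= `|a - b|.
Proof.
wlog ab : a b / a <= b.
  move=> H a0 b0; have [|/ltW] := leP a b => ab; first exact: H.
  by rewrite distrC [leRHS]distrC; exact: H.
move=> a0 b0; rewrite ger0_norm ?subr_ge0 ?ler_expR ?lerN2// ler0_norm ?subr_le0// opprB.
have -> : expR (- a) - expR (- b) = expR (- a) * (1 - expR (- (b - a))).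
  by rewrite mulrBr mulr1 -expRD; congr (_ - expR _); ring.
have := expR_ge1Dx (- (b - a)); have : expR (- a) <= 1 by rewrite -expR0 ler_expR oppr_le0.
have : 0 < expR (- a) := expR_gt0 _; move: (expR (- a)) (expR (- (b - a))) => p q.
have := subr_ge0 a b; rewrite ab => ba p0 p1 q1.
have [?|?] := leP q 1; last by nra.
nra.
Qed.

(** From [expR (- t) <= 1 / (1 + t)], whose distance to [1 - t] is [t ^ 2 / (1 + t)]. *)
Lemma dist_expRN1 t : 0 <= t -> `|1 - t - expR (- t)| <= t ^+ 2.
Proof.
move=> t0; rewrite ler0_norm; last by rewrite subr_le0 expR_ge1Dx.
have h := expR_ge1Dx t; have := expRN t; have := expR_gt0 t.
move: (expR t) (expR (- t)) h => p q h p0 E.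
have pq : q * p = 1 by rewrite E mulVf// gt_eqF.
have q0 : 0 < q by rewrite E invr_gt0.
have : q * (1 + t) <= q * p by rewrite ler_pM2l.
rewrite pq.
nra.
Qed.

Lemma dist_expr (p q : R) N : 0 <= p <= 1 -> 0 <= q <= 1 ->
  `|p ^+ N - q ^+ N| <= N%:R * `|p - q|.
Proof.
move=> /andP[p0 p1] /andP[q0 q1]; elim: N => [|N IH]; first by rewrite !expr0 subrr normr0 mul0r.
have -> : p ^+ N.+1 - q ^+ N.+1 = p * (p ^+ N - q ^+ N) + (p - q) * q ^+ N by rewrite !exprS; ring.
rewrite (le_trans (ler_normD _ _))// !normrM (ger0_norm p0) -natr1 mulrDl mul1r lerD//.
  by rewrite (le_trans _ IH)// ler_piMl.
by rewrite ler_piMr// ger0_norm ?exprn_ge0// exprn_ile1.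
Qed.

(* [(1 - t)^N] is close to [e^(-N t)], and [N t = (N / n) (n t)]. *)
Lemma dist_pow_expR t tau n N : 0 <= t <= 1 -> 0 <= tau -> (0 < n)%N -> (N <= n)%N ->
  `|(1 - t) ^+ N - expR (- (N%:R / n%:R * tau))| <=
  (n%:R * t) ^+ 2 * n%:R^-1 + `|n%:R * t - tau|.
Proof.
move=> /andP[t0 t1] tau0 n0 Nn.
have nR : 0 < n%:R :> R by rewrite ltr0n.
have NnR : N%:R <= n%:R :> R by rewrite ler_nat.
have h1 : `|(1 - t) ^+ N - expR (- t) ^+ N| <= (n%:R * t) ^+ 2 * n%:R^-1.
  apply: (le_trans (dist_expr _ _ _)).
  - by apply/andP; split; lra.
  - by rewrite expR_ge0 -[leRHS]expR0 ler_expR oppr_le0.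
  - have -> : (n%:R * t) ^+ 2 * n%:R^-1 = n%:R * t ^+ 2 by field; rewrite gt_eqF.
    by apply: ler_pM => //; exact: dist_expRN1.
have h2 : `|expR (- t) ^+ N - expR (- (N%:R / n%:R * tau))| <= `|n%:R * t - tau|.
  rewrite -expRM_natl mulrN; apply: (le_trans (dist_expRN _ _)).
  - by rewrite mulr_ge0.
  - by rewrite mulr_ge0// divr_ge0// ltW.
  have -> : N%:R * t - N%:R / n%:R * tau = N%:R / n%:R * (n%:R * t - tau).
    by field; rewrite gt_eqF.
  by rewrite normrM ler_piMl// ger0_norm ?divr_ge0// ler_pdivrMr ?mul1r.
rewrite (le_trans _ (lerD h1 h2))// (le_trans _ (ler_normD _ _))//.
by rewrite addrA subrK.
Qed.

Lemma pow_error_cvg0 (t : nat -> R) tau : n%:R * t n @[n --> \oo] --> tau ->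
  (n%:R * t n) ^+ 2 * n%:R^-1 + `|n%:R * t n - tau| @[n --> \oo] --> (0 : R).
Proof.
move=> h; rewrite -[X in _ --> X]addr0; apply: cvgD.
  rewrite -(mulr0 (tau ^+ 2)); apply: cvgM; last exact: (cvg_inv0 (@cvgr_idn R)).
  by rewrite expr2; under eq_fun do rewrite expr2; exact: cvgM.
rewrite -(@normr0 R R) -(subrr tau); apply: cvg_norm; apply: cvgB => //; exact: cvg_cst.
Qed.

End poisson_limit.

(** Clipping projects onto [[0, 1]], hence does not move away from a point [k] of that interval. *)
Lemma dist_clip (R : realType) (k l : R) : 0 <= k <= 1 ->
  `|Num.max 0 (Num.min 1 l) - k| <= `|l - k|.
Proof.
move=> /andP[k0 k1]; have := ler_norm (l - k); have := ler_norm (k - l); rewrite distrC => h1 h2.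
by rewrite ler_norml; case: (leP 1 l) => l1; [case: (leP 0 (1 : R))|case: (leP 0 l)] => l0;
  apply/andP; split; lra.
Qed.

(** * The event as a sum over the patterns of the thinning sequence *)

Section decomposition.
Context (T : Type) (R : realType).
Implicit Types (X Y : nat -> T -> R) (w : T).

Lemma run_max_le X n w t : (0 < n)%N ->
  (run_max X n w <= t) = [forall i : 'I_n, X i w <= t].
Proof.
move=> n0; apply/bigmax_leP/forallP => [[_ H] i|H]; first exact: H.
by split=> [|i _]; [exact: (H (Ordinal n0))|exact: H].
Qed.

(** Patterns are finite functions in order to be summed over, whereas [box] takes predicates and
    levels on [nat]; the value is [false] from [n] on. *)
Definition extend n (e : {ffun 'I_n -> bool}) (k : nat) : bool := oapp e false (insub k).

Lemma extendE n (e : {ffun 'I_n -> bool}) (i : 'I_n) : extend e i = e i.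
Proof. by rewrite /extend valK. Qed.

Definition mixed_level u v n (e : {ffun 'I_n -> bool}) (k : nat) : R :=
  if extend e k then Num.min u v else v.

Lemma patbE (eps : nat -> T -> bool) n (e : {ffun 'I_n -> bool}) w :
  patb eps e w = (e == [ffun i : 'I_n => eps i w]).
Proof.
apply/forallP/eqP => [H|-> i]; last by rewrite ffunE.
by apply/ffunP => i; rewrite ffunE (eqP (H i)).
Qed.

(* The sum has a single nonzero term, the actual pattern of [eps] at [w]. *)
Lemma event_split (eps : nat -> T -> bool) X Xhat n u v w :
  ind [forall i : 'I_n, (mixed_seq eps X Xhat i w <= u) && (X i w <= v)] =
  \sum_(e : {ffun 'I_n -> bool}) ind (patb eps e w) *
    (box predT (mixed_level u v e) X n w *
     box (fun k => ~~ extend e k) (fun=> u) Xhat n w) :> R.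
Proof.
rewrite (bigD1 [ffun i : 'I_n => eps i w])//= big1 ?addr0; last first.
  by move=> e ee0; rewrite patbE (negbTE ee0) mul0r.
rewrite patbE eqxx mul1r !boxE -natrM mulnb; congr (_%:R); congr nat_of_bool.
rewrite /boxb; apply/forallP/andP => [H|[/forallP H1 /forallP H2] i].
  split; apply/forallP => i; have := H i; rewrite /mixed_level/mixed_seq extendE ffunE.
    by case: (eps i w) => /andP[] //=; rewrite mul1r subrr mul0r addr0 le_min => -> ->.
  by case: (eps i w) => //=; rewrite mul0r subr0 mul1r add0r => /andP[].
have := H1 i; have := H2 i; rewrite /mixed_level/mixed_seq extendE ffunE/=.
case: (eps i w) => /=; first by rewrite mul1r subrr mul0r addr0 le_min => _.
by rewrite mul0r subr0 mul1r add0r => -> ->.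
Qed.

(** Turns a sum over patterns back into an expectation; with [F] constant, it says that the patterns
    form a partition. *)
Lemma pattern_sum (eps : nat -> T -> bool) n (F : (nat -> bool) -> R) w :
  (forall e e' : nat -> bool, (forall i : 'I_n, e i = e' i) -> F e = F e') ->
  \sum_(e : {ffun 'I_n -> bool}) ind (patb eps e w) * F (extend e) = F (eps ^~ w).
Proof.
move=> F_eq; rewrite (bigD1 [ffun i : 'I_n => eps i w])//= big1 ?addr0; last first.
  by move=> e ee0; rewrite patbE (negbTE ee0) mul0r.
by rewrite patbE eqxx mul1r; apply: F_eq => i; rewrite extendE ffunE.
Qed.

End decomposition.

(** * From the boxes to the limit *)

Section assembly.
Context d (T : measurableType d) (R : realType) (P : probability T R).
Variables (Y Yhat : nat -> {RV P >-> R}) (eps : nat -> {RV P >-> bool}).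
Hypotheses (Y_gaussian : jointly_gaussian P Y)
  (Y_standard : forall n, standard_gaussian P (Y n)) (Y_stationary : stationary P Y)
  (eps_Y_indep : indep_sigma P (sigma_gen eps) (sigma_gen Y))
  (Yhat_copy : same_law P Yhat Y)
  (Yhat_indep : indep_sigma P (sigma_gen Yhat) <<s sigma_gen Y `|` sigma_gen eps >>).
Local Notation itg f := (P.-integrable setT (EFin \o f)).
Local Notation Phi t := (1 - normal_tail t).

Let mYn n : measurable_fun setT (Y n). Proof. exact: measurable_funPT. Qed.
Let meps n : measurable_fun setT (eps n). Proof. exact: measurable_funPT. Qed.

Let Phi01 (t : R) : 0 <= Phi t <= 1.
Proof. by have := normal_tail01 t (mYn 0) (Y_standard 0); lra. Qed.

Let pat_bmf n (e : {ffun 'I_n -> bool}) :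
  bounded_measurable (fun w => ind (patb (fun n => eps n) e w) : R).
Proof. by apply: bmf_bool; apply: measurable_patb => j; exact: meps. Qed.

Let pat_mean n : \sum_(e : {ffun 'I_n -> bool})
  mean P (fun w => ind (patb (fun n => eps n) e w)) = 1.
Proof.
rewrite -mean_sum; last by move=> e; apply: bmf_integrable; exact: pat_bmf.
transitivity (mean P (fun=> 1)); last exact: mean_cst.
apply: eq_mean => w; have := @pattern_sum T R (fun n => eps n) n (fun=> 1) w (fun _ _ _ => erefl).
by move=> E; rewrite -[RHS]E; apply: eq_bigr => e _; rewrite mulr1.
Qed.

Let if_bmf k (c : R) : bounded_measurable (fun w => if eps k w then 1 else c).
Proof.
have -> : (fun w => if eps k w then 1 else c) = (fun w => c + (1 - c) * ind (eps k w)).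
  by apply/funext => w; case: (eps k w); rewrite ?mulr1 ?mulr0; ring.
by apply: bmfD; [exact: bmf_cst|apply: bmfM; [exact: bmf_cst|exact: bmf_bool]].
Qed.

Let box01 (X : nat -> T -> R) S s n : (forall n, measurable_fun setT (X n)) ->
  0 <= mean P (box S s X n) <= 1.
Proof.
move=> mX; have b w : 0 <= box S s X n w <= 1 by rewrite boxE; case: boxb; rewrite ?lexx ?ler01.
have ib : itg (box S s X n) by apply: bmf_integrable; exact: box_bmf.
rewrite mean_ge0 => [|w]; last by have /andP[] := b w.
rewrite -[leRHS](mean_cst P) le_mean// => [|w]; last by have /andP[] := b w.
by apply: bmf_integrable; exact: bmf_cst.
Qed.

Let prod_level (u v : R) n (e : nat -> bool) :
  (\prod_(k < n) Phi (if e k then Num.min u v else v)) * (\prod_(k < n | ~~ e k) Phi u) =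
  Phi (Num.min u v) ^+ n * \prod_(k < n) (if e k then 1 else Phi (Num.max u v)).
Proof.
rewrite [X in _ * X = _]big_mkcond -big_split/=.
have -> : Phi (Num.min u v) ^+ n = \prod_(k < n) Phi (Num.min u v).
  by rewrite prodr_const card_ord.
rewrite -big_split/=; apply: eq_bigr => k _; case: (e k) => //=.
by have [_|_] := leP u v; rewrite // mulrC.
Qed.

(** For each pattern there are two boxes to factorize, one for [Y] and one for [Yhat], each at cost
    [delta]; the pattern probabilities sum to 1, so averaging preserves the bound. *)
Lemma event_mean_dist u v n delta :
  (forall (S : pred nat) (s : nat -> R), (forall k, s k = u \/ s k = v) ->
    \sum_(k < n | S k) \sum_(j < k | S j) `|cov_le P Y k s (s k) j| <= delta) ->
  `|mean P (fun w => ind [forall i : 'I_n, (mixed_seq eps Y Yhat i w <= u) && (Y i w <= v)]) -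
    Phi (Num.min u v) ^+ n *
    mean P (fun w => \prod_(k < n) (if eps k w then 1 else Phi (Num.max u v)))| <= 2 * delta.
Proof.
move=> Hcov.
pose p e := mean P (fun w => ind (@patb T (fun n => eps n) n e w)) : R.
pose G (e : nat -> bool) := Phi (Num.min u v) ^+ n *
  \prod_(k < n) (if e k then 1 else Phi (Num.max u v)).
pose qY e := mean P (box predT (@mixed_level R u v n e) Y n).
pose qH e := mean P (box (fun k => ~~ @extend n e k) (fun=> u) Yhat n).
have itgpat (e : {ffun 'I_n -> bool}) f : bounded_measurable f -> 
    itg (fun w => ind (patb (fun n => eps n) e w) * f w).
  by move=> bf; apply: bmf_integrable; exact: bmfM.
have E1 : mean P (fun w => ind [forall i : 'I_n, (mixed_seq eps Y Yhat i w <= u) && (Y i w <= v)]) =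
    \sum_e p e * (qY e * qH e).
  under eq_mean do rewrite event_split.
  rewrite mean_sum; last by move=> e; apply: itgpat; apply: bmfM; exact: box_bmf.
  by apply: eq_bigr => e _; exact: (indep_mean eps_Y_indep Yhat_indep).
have E2 : Phi (Num.min u v) ^+ n *
    mean P (fun w => \prod_(k < n) (if eps k w then 1 else Phi (Num.max u v))) =
    \sum_e p e * G (extend e).
  rewrite -meanZl; last first.
    by apply: bmf_integrable; apply: bmf_prod => i; exact: if_bmf.
  transitivity (mean P (fun w => \sum_(e : {ffun 'I_n -> bool})
    ind (patb (fun n => eps n) e w) * G (extend e))).
    apply: eq_mean => w; rewrite pattern_sum// => e e' ee'.
    by rewrite /G; congr (_ * _); apply: eq_bigr => i _; rewrite ee'.
  rewrite mean_sum; last by move=> e; apply: itgpat; exact: bmf_cst.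
  apply: eq_bigr => e _; rewrite mulrC -(meanZl _ (bmf_integrable P (pat_bmf e))).
  by apply: eq_mean => w; rewrite mulrC.
rewrite E1 E2 -sumrB.
have p0 e : 0 <= p e by apply: mean_ge0.
apply: (@le_trans _ _ (\sum_e p e * (2 * delta))); last by rewrite -mulr_suml pat_mean mul1r.
rewrite (le_trans (ler_norm_sum _ _ _))//; apply: ler_sum => e _.
rewrite -mulrBr normrM ger0_norm// ler_wpM2l// /G -prod_level.
have lvl k : mixed_level u v e k = u \/ mixed_level u v e k = v.
  by rewrite /mixed_level; case: ifP => _; [case: leP => _; [left|right]|right].
have hY := quasi_independence mYn Y_gaussian Y_standard predT (mixed_level u v e) n.
(* Applied to [Y]; [copy_box] then carries the bound over to [Yhat], which is known through its
   law. *)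
have hH := quasi_independence mYn Y_gaussian Y_standard (fun k => ~~ extend e k) (fun=> u) n.
have {}hY := le_trans hY (Hcov predT _ lvl).
have {}hH := le_trans hH (Hcov (fun k => ~~ extend e k) _ (fun=> or_introl erefl)).
rewrite -(copy_box Yhat_copy) in hH.
have PhiE k t : mean P (fun w => ind (Y k w <= t)) = Phi t by exact: mean_le.
move: hY hH; rewrite (eq_bigr _ (fun (k : 'I_n) _ => PhiE k (mixed_level u v e k))).
rewrite (eq_bigr _ (fun (k : 'I_n) _ => PhiE k u)) -/(qY e) -/(qH e).
have /andP[qY0 qY1] : 0 <= qY e <= 1 by exact: box01.
pose a := \prod_(k < n) Phi (mixed_level u v e k); pose b := \prod_(k < n | ~~ extend e k) Phi u.
have /andP[b0 b1] : 0 <= b <= 1.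
  have /andP[u0 u1] := Phi01 u.
  by rewrite /b prodr_const exprn_ge0//= exprn_ile1.
rewrite -/a -/b => hY hH; change (`|qY e * qH e - a * b| <= 2 * delta).
have -> : qY e * qH e - a * b = qY e * (qH e - b) + (qY e - a) * b by ring.
rewrite (le_trans (ler_normD _ _))// !normrM (ger0_norm qY0) (ger0_norm b0).
have := normr_ge0 (qH e - b); have := normr_ge0 (qY e - a); nra.
Qed.

Lemma thinned_product (t tau : R) n w : 0 <= t <= 1 -> 0 <= tau -> (0 < n)%N ->
  `|\prod_(k < n) (if eps k w then 1 else 1 - t) -
    expR (- ((1 - n%:R^-1 * \sum_(k < n) ind (eps k w)) * tau))| <=
  (n%:R * t) ^+ 2 * n%:R^-1 + `|n%:R * t - tau|.
Proof.
move=> t01 tau0 n0; pose N := #|[pred k : 'I_n | ~~ eps k w]|.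
have -> : \prod_(k < n) (if eps k w then 1 else 1 - t) = (1 - t) ^+ N.
  rewrite /N -prodr_const [RHS]big_mkcond/=; apply: eq_bigr => k _.
  by rewrite inE; case: (eps k w).
have -> : 1 - n%:R^-1 * \sum_(k < n) ind (eps k w) = N%:R / n%:R :> R.
  have -> : N%:R = \sum_(k < n) ind (~~ eps k w) :> R.
    rewrite /N -sum1_card natr_sum [LHS]big_mkcond/=; apply: eq_bigr => k _.
    by rewrite inE; case: (eps k w).
  have : \sum_(k < n) ind (~~ eps k w) + \sum_(k < n) ind (eps k w) = n%:R :> R.
    rewrite -big_split/= -[n in RHS]card_ord -sum1_card natr_sum; apply: eq_bigr => k _.
    by case: (eps k w); rewrite ?addr0 ?add0r.
  move: (\sum_(k < n) _) (\sum_(k < n) _) => a b ab.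
  have -> : b = n%:R - a by rewrite -ab addrK.
  by field; rewrite pnatr_eq0 -lt0n.
apply: dist_pow_expR => //; rewrite /N -[leqRHS]card_ord; exact: max_card.
Qed.

Section mixture_limit.
Variable lambda : {RV P >-> R}.
Hypotheses (eps_mean : cvg_in_probability P
       (fun n w => n%:R^-1 * \sum_(k < n) (eps k w)%:R) lambda)
    (lambda01 : {ae P, forall w, 0 <= lambda w <= 1}).

(* [lambda] lies in [0, 1] only almost surely. *)
Let clip w := Num.max 0 (Num.min 1 (lambda w)).

Let clip01 w : 0 <= clip w <= 1.
Proof. by rewrite /clip le_max lexx/= ge_max ler01/= ge_min lexx. Qed.

Let mclip : measurable_fun setT clip.
Proof.
apply: measurable_maxr; first exact: measurable_cst.
by apply: measurable_minr; [exact: measurable_cst|exact: measurable_funPT].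
Qed.

Let mix_bmf (tau : R) (f : T -> R) : measurable_fun setT f -> 0 <= tau -> (forall w, f w <= 1) ->
  bounded_measurable (fun w => expR (- ((1 - f w) * tau))).
Proof.
move=> mf tau0 f1; split.
  apply: (@measurableT_comp _ _ _ _ _ _ expR) => //.
  by apply: measurableT_comp => //; apply: measurable_funM => //; exact: measurable_funB.
exists 1 => w; rewrite ger0_norm ?expR_ge0// -[leRHS]expR0 ler_expR oppr_le0 mulr_ge0//.
by rewrite subr_ge0.
Qed.

Lemma mixture_mean (tau : R) : 0 <= tau ->
  'E_P[(fun w => expR (- ((1 - lambda w) * tau)))]%E =
  (mean P (fun w => expR (- ((1 - clip w) * tau))))%:E.
Proof.
move=> tau0; rewrite unlock meanE; last first.
  by apply: bmf_integrable; apply: mix_bmf => // w; have /andP[] := clip01 w.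
apply: ae_eq_integral => //.
- apply/measurable_EFinP; apply: (@measurableT_comp _ _ _ _ _ _ expR) => //.
  by apply: measurableT_comp => //; apply: measurable_funM => //; exact: measurable_funB.
- apply/measurable_EFinP.
  by have [] := mix_bmf mclip tau0 (fun w => proj2 (andP (clip01 w))).
apply: filterS lambda01 => w /andP[l0 l1] _.
by rewrite /clip (min_idPr l1) (max_idPr l0).
Qed.

Let kappa n w : R := n%:R^-1 * \sum_(k < n) ind (eps k w).

Let kappa01 n w : 0 <= kappa n w <= 1.
Proof.
rewrite /kappa mulr_ge0 ?sumr_ge0//=; case: n => [|n]; first by rewrite big_ord0 mulr0.
rewrite ler_pdivrMl ?ltr0n// mulr1 -[n.+1 in leRHS]card_ord -sum1_card natr_sum ler_sum// => k _.
by case: (eps k w).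
Qed.

Let mkappa n : measurable_fun setT (kappa n).
Proof.
have [] : bounded_measurable (kappa n) by
  apply: bmfM; [exact: bmf_cst|apply: bmf_sum => k; exact: bmf_bool].
by [].
Qed.

Lemma mixture_cvg (tau : R) (t : nat -> R) : (forall n, 0 <= t n <= 1) -> 0 <= tau ->
  n%:R * t n @[n --> \oo] --> tau ->
  mean P (fun w => \prod_(k < n) (if eps k w then 1 else 1 - t n)) @[n --> \oo] -->
  mean P (fun w => expR (- ((1 - clip w) * tau))).
Proof.
move=> t01 tau0 ht; apply/cvgrPdist_le => e e0.
(* Three errors add up: [e1] from the Poisson approximation, [tau * e1] from replacing the empirical
   mean by the clipped [lambda] where they are close, and [e1] for the probability that they are
   not. *)
pose e1 := e / (tau + 2); have e10 : 0 < e1 by rewrite divr_gt0//; lra.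
have ee1 : e = tau * e1 + e1 + e1 by rewrite /e1; field; rewrite gt_eqF//; lra.
have H1 : \forall n \near \oo, (n%:R * t n) ^+ 2 * n%:R^-1 + `|n%:R * t n - tau| <= e1.
  by apply: (cvgr_le (0 : R) (pow_error_cvg0 ht)).
have H2 : \forall n \near \oo, mean P (fun w => ind (e1 <= `|kappa n w - lambda w|)) <= e1.
  have h := eps_mean e10.
  have mk n : measurable_fun setT (fun w => e1 <= `|kappa n w - lambda w|).
    by apply: measurable_fun_ler => //; apply: measurableT_comp => //; exact: measurable_funB.
  have {}h : (mean P (fun w => ind (e1 <= `|kappa n w - lambda w|)))%:E @[n --> \oo] --> 0%E.
    have E : (fun n => (mean P (fun w => ind (e1 <= `|kappa n w - lambda w|)))%:E) =
        (fun n => P [set w | e1 <= `|kappa n w - lambda w|]).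
      by apply/funext => n; rewrite (pr_mean P (mk n)).
    by rewrite E; exact: h.
  by move/fine_cvgP : h => [_ h]; apply: (cvgr_le (0 : R) h).
near=> n.
have n0 : (0 < n)%N by near: n; exact: nbhs_infty_gt.
pose f w := expR (- ((1 - kappa n w) * tau)).
have bf : bounded_measurable f by apply: mix_bmf => // w; have /andP[] := kappa01 n w.
have bg : bounded_measurable (fun w => expR (- ((1 - clip w) * tau))).
  by apply: mix_bmf => // w; have /andP[] := clip01 w.
have bp : bounded_measurable (fun w => \prod_(k < n) (if eps k w then 1 else 1 - t n)).
  by apply: bmf_prod => i; exact: if_bmf.
have mk : measurable_fun setT (fun w => e1 <= `|kappa n w - lambda w|).
  by apply: measurable_fun_ler => //; apply: measurableT_comp => //; exact: measurable_funB.
rewrite ee1 distrC -meanB; [|exact: bmf_integrable|exact: bmf_integrable].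
rewrite (le_trans (norm_mean (bmf_integrable P (bmfB bp bg))))//.
apply: (@le_trans _ _ (mean P (fun w => (tau * e1 + e1) + ind (e1 <= `|kappa n w - lambda w|)))).
  apply: le_mean.
  - exact/itg_norm/bmf_integrable/bmfB.
  - by apply: bmf_integrable; apply: bmfD; [exact: bmf_cst|exact: bmf_bool].
  move=> w.
  have h1 := thinned_product w (t01 n) tau0 n0.
  have {}h1 : `|\prod_(k < n) (if eps k w then 1 else 1 - t n) - f w| <= e1.
    by rewrite (le_trans h1)//; near: n.
  have h2 : `|f w - expR (- ((1 - clip w) * tau))| <= tau * e1 + ind (e1 <= `|kappa n w - lambda w|).
    have /andP[k0 k1] := kappa01 n w; have /andP[c0 c1] := clip01 w.
    have k0' : 0 <= (1 - kappa n w) * tau by rewrite mulr_ge0// subr_ge0.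
    have c0' : 0 <= (1 - clip w) * tau by rewrite mulr_ge0// subr_ge0.
    have [E|E] := leP e1 `|kappa n w - lambda w|.
      have /andP[f0 f1] : 0 <= f w <= 1.
        by rewrite expR_ge0 -[leRHS]expR0 ler_expR oppr_le0.
      have /andP[g0 g1] : 0 <= expR (- ((1 - clip w) * tau)) <= 1.
        by rewrite expR_ge0 -[leRHS]expR0 ler_expR oppr_le0.
      have : 0 <= tau * e1 by rewrite mulr_ge0// ltW.
      rewrite [true%:R]mulr1n ler_norml; move: (f w) (expR _) f0 f1 g0 g1 => p q *.
      by apply/andP; split; lra.
    rewrite addr0 (le_trans (dist_expRN k0' c0'))//.
    have -> : (1 - kappa n w) * tau - (1 - clip w) * tau = tau * (clip w - kappa n w) by ring.
    rewrite normrM ger0_norm// ler_wpM2l// (le_trans _ (ltW E))//.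
    by rewrite [leRHS]distrC; exact: dist_clip.
  have -> : \prod_(k < n) (if eps k w then 1 else 1 - t n) - expR (- ((1 - clip w) * tau)) =
    (\prod_(k < n) (if eps k w then 1 else 1 - t n) - f w) + (f w - expR (- ((1 - clip w) * tau))).
    by ring.
  by rewrite (le_trans (ler_normD _ _))//; lra.
rewrite meanD ?mean_cst; first by rewrite lerD2l; near: n.
- by apply: bmf_integrable; exact: bmf_cst.
- by apply: bmf_integrable; exact: bmf_bool.
Unshelve. all: by end_near.
Qed.

End mixture_limit.

Lemma corr_covariance n : covariance P (Y 0%N) (Y n) = (corr P Y 0 (0 + n))%:E.
Proof.
have m0 k : fine ('E_P[Y k])%E = 0.
  by rewrite unlock; exact: (@gaussian_mean _ _ _ P (Y k)).
rewrite unlock !m0 unlock add0n /corr meanE; last exact: (corr_itg mYn Y_standard).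
by apply: eq_integral => w _; rewrite !fctE/= !subr0.
Qed.

Lemma threshold_min n (x y : R) :
  Num.min (threshold n x) (threshold n y) = threshold n (Num.min x y).
Proof.
have [/threshold_le xy|/ltW/threshold_le xy] := leP x y; first exact/min_idPl.
exact/min_idPr.
Qed.

Lemma threshold_max n (x y : R) :
  Num.max (threshold n x) (threshold n y) = threshold n (Num.max x y).
Proof.
have [/threshold_le xy|/ltW/threshold_le xy] := leP x y; first exact/max_idPr.
exact/max_idPl.
Qed.

Lemma tail_cvg (z : R) : n%:R * normal_tail (threshold n z) @[n --> \oo] --> expR (- z).
Proof.
have := @tail_threshold R _ _ P (Y 0%N) z (mYn 0) (Y_standard 0).
by under eq_cvg do rewrite (mean_gt _ (mYn 0) (Y_standard 0)).
Qed.

Lemma max_law_cvg (z : R) : Phi (threshold n z) ^+ n @[n --> \oo] --> expR (- expR (- z)).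
Proof.
have h := pow_error_cvg0 (@tail_cvg z).
apply/cvgrPdist_le => e e0; near=> n.
have n0 : (0 < n)%N by near: n; exact: nbhs_infty_gt.
have := dist_pow_expR (normal_tail01 (threshold n z) (mYn 0) (Y_standard 0))
  (expR_ge0 (- z)) n0 (leqnn n).
rewrite divff ?pnatr_eq0 -?lt0n// mul1r distrC => /le_trans; apply; near: n.
exact: (cvgr_le (0 : R) h).
Unshelve. all: by end_near.
Qed.

Hypothesis Y_cov : (covariance P (Y 0%N) (Y n) * (ln n%:R)%:E)%E @[n --> \oo] --> 0%E.

Lemma mean_event_dist_cvg0 (x y e : R) : 0 < e -> \forall n \near \oo,
  `|mean P (fun w => ind [forall i : 'I_n, (mixed_seq eps Y Yhat i w <= threshold n x) &&
      (Y i w <= threshold n y)]) -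
    Phi (threshold n (Num.min x y)) ^+ n *
    mean P (fun w => \prod_(k < n) (if eps k w then 1 else Phi (threshold n (Num.max x y))))| <= e.
Proof.
move=> e0.
have rho_ln : corr P Y 0 (0 + n) * ln n%:R @[n --> \oo] --> (0 : R).
  move: Y_cov; under eq_cvg do rewrite corr_covariance -EFinM.
  by move/fine_cvgP => [_].
have e2 : 0 < e / 2 by lra.
have := cov_sum_small mYn Y_gaussian Y_standard (stationary_corr Y_standard Y_stationary) rho_ln x y e2.
apply: filterS => n Hn; have := event_mean_dist Hn.
rewrite threshold_min threshold_max => /le_trans; apply; lra.
Qed.

End assembly.

Theorem theorem2p2 (d : measure_display) (T : measurableType d) (R : realType)
    (P : probability T R)
    (Y Yhat : nat -> {RV P >-> R}) (eps : nat -> {RV P >-> bool})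
    (lambda : {RV P >-> R})
    (Y_gaussian : jointly_gaussian P Y)
    (Y_standard : forall n, standard_gaussian P (Y n))
    (Y_stationary : stationary P Y)
    (Y_cov : (covariance P (Y 0%N) (Y n) * (ln n%:R)%:E)%E @[n --> \oo] --> 0%E)
    (eps_Y_indep : indep_sigma P (sigma_gen eps) (sigma_gen Y))
    (eps_mean : cvg_in_probability P
       (fun n w => n%:R^-1 * \sum_(k < n) (eps k w)%:R) lambda)
    (lambda01 : {ae P, forall w, 0 <= lambda w <= 1})
    (Yhat_copy : same_law P Yhat Y)
    (Yhat_indep : indep_sigma P (sigma_gen Yhat)
       <<s sigma_gen Y `|` sigma_gen eps >>)
    (x y : R) :
  P [set w | run_max (mixed_seq eps Y Yhat) n w
               <= (norm_a R n)^-1 * x + norm_b R n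
             /\ run_max Y n w <= (norm_a R n)^-1 * y + norm_b R n]
    @[n --> \oo] -->
  ((expR (- expR (- Num.min x y)))%:E
     * 'E_P[(fun w => expR (- ((1 - lambda w) * expR (- Num.max x y))))])%E.
Proof.
have mYn n : measurable_fun setT (Y n) by exact: measurable_funPT.
rewrite (mixture_mean lambda01 (expR_ge0 _)) -EFinM; set c := _ * mean P _.
have tail01 n : 0 <= normal_tail (threshold n (Num.max x y)) <= 1.
  exact: normal_tail01 (mYn 0%N) (Y_standard 0%N).
have L1 := @max_law_cvg _ _ _ P Y Y_standard (Num.min x y).
have L2 := mixture_cvg eps_mean tail01 (expR_ge0 _) (@tail_cvg _ _ _ P Y Y_standard (Num.max x y)).
have D := mean_event_dist_cvg0 Y_gaussian Y_standard Y_stationary eps_Y_indep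
  Yhat_copy Yhat_indep Y_cov x y.
pose A n w := [forall i : 'I_n, (mixed_seq eps Y Yhat i w <= threshold n x) &&
  (Y i w <= threshold n y)].
pose G n := (1 - normal_tail (threshold n (Num.min x y))) ^+ n *
  mean P (fun w => \prod_(k < n) (if eps k w then 1 else 1 - normal_tail (threshold n (Num.max x y)))).
have {D} D : mean P (fun w => ind (A n w)) - G n @[n --> \oo] --> (0 : R).
  by apply/cvgr0Pnorm_le => e e0; exact: D.
have {L1 L2} L : G n @[n --> \oo] --> c by exact: (cvgM L1 L2).
have {D} {}L : mean P (fun w => ind (A n w)) @[n --> \oo] --> c.
  have -> : (fun n => mean P (fun w => ind (A n w))) =
      (fun n => mean P (fun w => ind (A n w)) - G n + G n).
    by apply/funext => n; rewrite subrK.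
  by rewrite -[c]add0r; exact: cvgD.
apply: (@cvg_trans _ ((mean P (fun w => ind (A n w)))%:E @[n --> \oo])).
  apply: near_eq_cvg; near=> n.
  (* At [n = 0] the event [A] is the whole space while [run_max X 0] is [X 0], so the two events are
     identified for positive [n] only. *)
  have n0 : (0 < n)%N by near: n; exact: nbhs_infty_gt.
  rewrite -pr_mean; last first.
    apply: measurable_forall => i; apply: measurable_and; last exact: measurable_fun_ler.
    apply: measurable_fun_ler => //; apply: measurable_funD.
      by apply: measurable_funM => //; apply: measurable_boolR; exact: measurable_funPT.
    apply: measurable_funM => //; apply: measurable_funB => //.
    by apply: measurable_boolR; exact: measurable_funPT.
  congr (P _); apply/seteqP; split => w /=; rewrite !run_max_le//.
    move=> /forallP H; split; apply/forallP => i; by have /andP[] := H i.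
  by move=> [/forallP H1 /forallP H2]; apply/forallP => i; rewrite H1 H2.
by apply: cvg_EFin; [near=> n|exact: L].
Unshelve. all: by end_near.
Qed.
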